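(* Let $\mathfrak F_{vc}$ be the class of all virtually cyclic groups. Every countable virtually nilpotent group lies in $\mathbf{H}_2^{\mathfrak F_{vc}}\mathfrak F_{vc}$, and every semi-direct product $G=A\rtimes\mathbb Z$ with $A$ a countable abelian group lies in $\mathbf{H}_3^{\mathfrak F_{vc}}\mathfrak F_{vc}$.
   Context: For a class $\mathfrak F$ of groups closed under isomorphism and taking subgroups and a group $G$, put $\mathfrak F\cap G=\{H\le G : H \text{ is isomorphic to a group in } \mathfrak F\}$. Every cellular action of a group on a CW-complex is assumed admissible: if a group element stabilises a cell, then it fixes that cell pointwise. The classes $\mathbf{H}_\alpha^{\mathfrak F}\mathfrak F$ are defined for ordinals $\alpha$ by: $\mathbf{H}_0^{\mathfrak F}\mathfrak F=\mathfrak F$; for $\alpha>0$, $\mathbf{H}_\alpha^{\mathfrak F}\mathfrak F$ is the class of groups $G$ acting cellularly on a finite dimensional CW-complex $X$ such that each stabiliser subgroup lies in $\mathbf{H}_\beta^{\mathfrak F}\mathfrak F$ for some $\beta<\alpha$ and such that $X^K$ is contractible for all $K\in\mathfrak F\cap G$. *)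

(* Defs.v *)
From HB Require Import structures.
From mathcomp Require Import all_boot all_order all_algebra.
From mathcomp Require Import all_classical all_reals all_analysis.

Set Implicit Arguments.
Unset Strict Implicit.
Unset Printing Implicit Defensive.

Import Order.TTheory GRing.Theory Num.Theory.
Import numFieldNormedType.Exports.

Local Open Scope classical_set_scope.
Local Open Scope group_scope.

(** * Groups *)

Section Groups.
Variable G : groupType.
Implicit Types A H K N Q : set G.

Definition is_subgroup H : Prop :=
  H 1 /\ forall x y, H x -> H y -> H (x * y^-1).

Definition generated A : set G := smallest is_subgroup A.

Definition finite_index H : Prop :=
  finite_set (range (fun g : G => [set g * h | h in H])).

Definition cyclic_subgroup H : Prop := exists c, H = generated [set c].

(* The lower central series of [H], indexed so that the term of index 0 is [H]
   itself. *)
Fixpoint lower_central H (n : nat) : set G :=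
  if n is m.+1 then
    generated [set [~ x, y] | x in lower_central H m & y in H]
  else H.

Definition nilpotent_subgroup H : Prop :=
  is_subgroup H /\ exists n, lower_central H n = [set 1].

Definition virtually_cyclic : Prop :=
  exists2 H, cyclic_subgroup H & finite_index H.

Definition virtually_nilpotent : Prop :=
  exists2 H, nilpotent_subgroup H & finite_index H.

Definition infinite_cyclic H : Prop :=
  exists f : int -> G,
    [/\ injective f, forall m n, f (m + n)%R = f m * f n & range f = H].

(* [G] is the (internal) semi-direct product of its normal subgroup [N] by its
   subgroup [Q]. *)
Definition semidirect_product N Q : Prop :=
  [/\ is_subgroup N, is_subgroup Q,
      forall x g, N x -> N (x ^ g),
      N `&` Q = [set 1] &
      [set n * q | n in N & q in Q] = [set: G]].

End Groups.

(* [subgroup_in F H]: [H] is a subgroup of [G] isomorphic to a group in [F]; for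
   fixed [G] this is the set F /\ G of subgroups.  (The image of a homomorphism
   is always a subgroup.) *)
Definition subgroup_in (F : groupType -> Prop) (G : groupType) (H : set G) :
    Prop :=
  exists (K : groupType) (f : {multiplicative K -> G}),
    [/\ F K, injective f & range f = H].

(** * CW-complexes *)

Section CW.
Variable R : realType.
Local Open Scope ring_scope.

(* Mathcomp-analysis norms row vectors by the supremum of their entries, so the
   Euclidean ball and sphere are written out.  For [n = 0] the ball is a point
   and the sphere is empty. *)
Definition sqnorm n (v : 'rV[R]_n) : R := \sum_(i < n) v 0 i ^+ 2.
Definition disk n : set 'rV[R]_n := [set v | sqnorm v <= 1].
Definition open_disk n : set 'rV[R]_n := [set v | sqnorm v < 1].
Definition sphere n : set 'rV[R]_n := [set v | sqnorm v = 1].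

(* A CW-structure in the sense of Whitehead.  That each characteristic map is a
   homeomorphism from the open disk onto its cell follows from the other
   fields, by compactness of the disk. *)
Record cw_structure (X : topologicalType) := CWStructure {
  cw_index : Type ;
  cw_dim : cw_index -> nat ;
  cw_char : forall i, 'rV[R]_(cw_dim i) -> X ;
  cw_cell := fun i => [set cw_char v | v in @open_disk (cw_dim i)] ;
  cw_hausdorff : hausdorff_space X ;
  cw_char_continuous :
    forall i, {within @disk (cw_dim i), continuous (@cw_char i)} ;
  cw_char_inj : forall i, set_inj (@open_disk (cw_dim i)) (@cw_char i) ;
  cw_disjoint : trivIset [set: cw_index] cw_cell ;
  cw_cover : \bigcup_i cw_cell i = [set: X] ;
  cw_closure_finite : forall i, exists J : set cw_index,
    [/\ finite_set J,
        forall j, J j -> (cw_dim j < cw_dim i)%N &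
        [set cw_char v | v in @sphere (cw_dim i)] `<=`
          \bigcup_(j in J) cw_cell j] ;
  cw_weak_topology : forall A : set X,
    (forall i, closed (A `&` [set cw_char v | v in @disk (cw_dim i)])) ->
    closed A }.

Definition finite_dimensional (X : topologicalType) (C : cw_structure X) : Prop :=
  exists n : nat, forall i, (@cw_dim X C i <= n)%N.

Definition contractible (X : topologicalType) (A : set X) : Prop :=
  exists (h : X * R -> X) (x0 : X),
    [/\ A x0,
        {within A `*` `[0, 1]%classic, continuous h},
        h @` (A `*` `[0, 1]%classic) `<=` A &
        forall x, A x -> h (x, 0) = x /\ h (x, 1) = x0].

End CW.

(** * Actions *)

Section Actions.
Variables (R : realType) (G : groupType) (X : topologicalType).
Implicit Types (act : G -> X -> X) (C : cw_structure R X).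

Definition continuous_action act : Prop :=
  [/\ forall x, act 1 x = x,
      forall g h x, act (g * h) x = act g (act h x) &
      forall g, continuous (act g)].

Definition cellular_action C act : Prop :=
  continuous_action act /\
  forall g (i : cw_index C), exists2 j : cw_index C,
    cw_dim j = cw_dim i & act g @` cw_cell i = cw_cell j.

Definition admissible_action C act : Prop :=
  cellular_action C act /\
  forall g (i : cw_index C), act g @` cw_cell i = cw_cell i ->
    forall x, cw_cell i x -> act g x = x.

Definition stabiliser act (x : X) : set G := [set g | act g x = x].

Definition fixed_points act (K : set G) : set X :=
  [set x | forall g, K g -> act g x = x].

End Actions.

(** * The hierarchy *)

(* [acts_with R F S G]: [G] acts on a finite dimensional CW-complex [X] with
   stabilisers satisfying [S] and with contractible [X^K] for [K] in F /\ G.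
   For an admissible action the stabiliser of a cell is the stabiliser of each
   of its points, so it is enough to speak of the latter. *)
Definition acts_with (R : realType) (F : groupType -> Prop)
    (G : groupType) (S : set G -> Prop) : Prop :=
  exists (X : topologicalType) (C : cw_structure R X) (act : G -> X -> X),
    [/\ finite_dimensional C,
        admissible_action C act,
        forall x, S (stabiliser act x) &
        forall K : set G, subgroup_in F K ->
          contractible R (fixed_points act K)].

(* The class [H_a^F F].  Ordinals are represented by the elements of a
   well-ordered type [W], the element [a] standing for the order type of
   [{b | b < a}]; finite ordinals are obtained with [W := nat].  When [W] is
   well ordered, the inductive predicate is the predicate defined by transfinite
   recursion on [a]. *)
Inductive hierarchy (R : realType) (F : groupType -> Prop)
    (d : Order.disp_t) (W : orderType d) : W -> groupType -> Prop :=
| hierarchy_base (a : W) (G : groupType) :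
    (forall b : W, ~ (b < a)%O) -> F G -> hierarchy R F a G
| hierarchy_step (a : W) (G : groupType) :
    (exists b : W, (b < a)%O) ->
    acts_with R F (fun H : set G =>
      exists2 b : W, (b < a)%O & subgroup_in (hierarchy R F b) H) ->
    hierarchy R F a G.

(* Main.v *)
Require Import Defs.
From mathcomp Require Import all_boot all_order all_algebra.
From mathcomp Require Import finmap.
From mathcomp Require Import all_classical all_reals all_analysis.
From mathcomp Require Import ring lra zify.
From HB Require Import structures.

(* All complexes are realizations of posets on which the group acts, and fixed
   points are contracted by zigzags of monotone maps.

   A finitely generated virtually nilpotent group has a finite dimensional
   classifying space for virtually cyclic subgroups.  For a group mapping to Z^2
   so that virtually cyclic subgroups are recognised by their slopes, one takes the
   join of a line, on which Z^2 translates through a coordinate, with a disjoint union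
   of lines, one for each slope s, on which Z^2 translates through a linear form with
   kernel s.  For a central extension by <z> of a group G/<z> with such a model X, the
   stabilisers in G of the points of X are finite extensions of central extensions
   of Z by Z, and are mapped to Z^2 by the transfer; their models are spread over X
   as finite sections.  Finally one passes to overgroups of finite index by
   coinduction.

   A countable group G which is locally virtually nilpotent is an increasing union of
   finitely generated subgroups, and acts on the tree of their cosets; virtually
   cyclic subgroups are finitely generated, hence fix a point.

   If G maps onto Z with abelian kernel A, let U be the subgroup of the elements of A
   on which a power of a generator of Z acts unipotently.  Then G acts on the join of
   the line, with stabiliser A, and of the discrete set of the commensurators modulo
   U of the cyclic subgroups not contained in A.  These commensurators are locally
   virtually nilpotent, and a virtually cyclic subgroup not contained in A fixes
   exactly one point of the discrete set. *)

Set Implicit Arguments.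
Unset Strict Implicit.
Unset Printing Implicit Defensive.

Import Order.TTheory GRing.Theory Num.Theory.
Import numFieldNormedType.Exports.

Open Scope classical_set_scope.
Open Scope ring_scope.

(** * Realizations of posets *)

(** Posets keep fixed points, joins and sections combinatorial: when down-sets have bounded size, a
    simplex preserved by [g] is fixed pointwise, so that the action is admissible and the fixed
    points of the realization are the realization of the fixed points. Zigzags have to be infinite
    because finitely many monotone maps, starting from the identity, move the points of a line by a
    bounded distance only; being pointwise eventually constant suffices in the weak topology.

    In a central extension the maps to Z^2 depend on the point and on choices, so there is no single
    action on a plane model. Sections over the finitely many points below a given one absorb these
    choices and keep the dimension finite.

    The tree replaces countable groups by finitely generated ones at the cost of one level of the
    hierarchy, and the action of the abelian-by-cyclic group costs another. There, if [a] in [A]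
    commutes with [t], then [t] and [t * a] commute but may have no common power; dividing by [U]
    identifies them, and then the commensurators are their own normalisers and meet [A] exactly in
    [U]. *)

Record poset := Poset {
  pcar :> choiceType ;
  ple : pcar -> pcar -> Prop ;
  plexx : forall x, ple x x ;
  ple_anti : forall x y, ple x y -> ple y x -> x = y ;
  ple_trans : forall y x z, ple x y -> ple y z -> ple x z }.

Definition plt (P : poset) (x y : P) := ple x y /\ x <> y.

Section Realization.
Variables (R : realType) (P : poset).

Definition comparable_in (w : P -> R) :=
  forall p q, w p != 0 -> w q != 0 -> ple p q \/ ple q p.

Definition barycentric (w : P -> R) : Prop :=
  [/\ forall p, 0 <= w p, comparable_in w &
      exists V : {fset P}, (forall p, w p != 0 -> p \in V) /\
        \sum_(p <- V) w p = 1].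

Record realization := Realization {
  coord :> P -> R ; coordP : barycentric coord }.

HB.instance Definition _ := gen_eqMixin realization.
HB.instance Definition _ := gen_choiceMixin realization.

Implicit Types (x y z : realization) (V W : {fset P}) (p q : P).

Lemma coord_inj x y : (forall p, x p = y p) -> x = y.
Proof.
case: x y => [w wP] [w' wP'] /= h.
have e : w = w' by apply/funext.
by subst w'; congr Realization; apply: Prop_irrelevance.
Qed.

Lemma coord_ge0 x p : 0 <= x p. Proof. by have [h _ _] := coordP x; exact: h. Qed.

Definition supp x : {fset P} :=
  let: exist V _ := cid (let: And3 _ _ h := coordP x in h) in
  [fset p in V | x p != 0]%fset.

Lemma in_supp x p : (p \in supp x) = (x p != 0).
Proof.
rewrite /supp; case: cid => V [Vx _].
by rewrite !inE /=; case: (boolP (x p != 0)) => [/Vx ->|_] //; rewrite andbF.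
Qed.

Lemma sum_supp (M : nmodType) x V (F : P -> M) :
  (supp x `<=` V)%fset -> (forall p, x p = 0 -> F p = 0) ->
  \sum_(p <- supp x) F p = \sum_(p <- V) F p.
Proof.
move=> sV F0; apply: big_fset_incl => // p _.
by rewrite in_supp negbK => /eqP /F0.
Qed.

Lemma coord_sum1 x V : (supp x `<=` V)%fset -> \sum_(p <- V) x p = 1.
Proof.
have [_ _ [W [Wx W1]]] := coordP x.
move=> sV; rewrite -(sum_supp sV) //.
rewrite (@sum_supp _ _ W) //.
by apply/fsubsetP => p; rewrite in_supp; exact: Wx.
Qed.

Lemma coord_comparable x p q :
  p \in supp x -> q \in supp x -> ple p q \/ ple q p.
Proof. by rewrite !in_supp; have [_ h _] := coordP x; exact: h. Qed.

Lemma supp_neq0 x : exists p, p \in supp x.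
Proof.
have := coord_sum1 (fsubset_refl (supp x)).
case: (fset_0Vmem (supp x)) => [->|[p hp] _]; last by exists p.
by rewrite big_nil => /eqP; rewrite eq_sym oner_eq0.
Qed.

(** The neighbourhoods of [x] among the points supported in the finite set [V], for the Euclidean
    topology; the weak topology is the one coherent with these pieces. *)
Definition near_in V x : set_system realization :=
  filter_from [set e : R | 0 < e] (fun e : R =>
    [set y | (supp y `<=` V)%fset /\ forall p, p \in V -> `|y p - x p| < e]).

Global Instance near_in_filter V x : Filter (near_in V x).
Proof.
apply: filter_from_filter; first by exists 1 => /=.
move=> e f /= e0 f0; exists (Num.min e f) => /=.
  by rewrite lt_min e0.
move=> y [sy h]; split; split=> // p /h; rewrite lt_min => /andP[] //.
Qed.

Lemma near_in_supp V x : \forall y \near near_in V x, (supp y `<=` V)%fset.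
Proof. by exists 1 => //= y []. Qed.

Lemma cvg_coord V x p : (supp x `<=` V)%fset ->
  (fun y : realization => y p) @ near_in V x --> x p.
Proof.
move=> sV; apply/cvgrPdist_lt => e e0.
exists e => //= y [sy h]; rewrite distrC.
case: (boolP (p \in V)) => [/h //|pV].
have z0 (z : realization) : (supp z `<=` V)%fset -> z p = 0.
  move=> /fsubsetP /(_ p); rewrite in_supp => h'.
  by apply/eqP; apply: contraNT pV.
by rewrite !z0 // subrr normr0.
Qed.

Definition weak_open : set_system realization :=
  [set U | forall V x, U x -> (supp x `<=` V)%fset -> near_in V x U].

Lemma weak_openT : weak_open setT.
Proof. by move=> V x _ _; apply: filterT. Qed.

Lemma weak_openI : setI_closed weak_open.
Proof. by move=> A B hA hB V x [Ax Bx] sV; apply: filterI; [exact: hA|exact: hB]. Qed.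

Lemma weak_open_bigU (I : Type) (f : I -> set realization) :
  (forall i, weak_open (f i)) -> weak_open (\bigcup_i f i).
Proof.
move=> h V x [i _ fx] sV.
by apply: filterS (h i V x fx sV) => y fy; exists i.
Qed.

HB.instance Definition _ :=
  isOpenTopological.Build realization weak_openT weak_openI weak_open_bigU.

Lemma realization_openE (U : set realization) : open U = weak_open U.
Proof. by []. Qed.

Lemma near_in_nbhs V x (U : set realization) :
  (supp x `<=` V)%fset -> nbhs x U -> near_in V x U.
Proof.
move=> sV; rewrite nbhsE => -[B [oB Bx] BU].
by apply: filterS BU _; exact: oB.
Qed.

(** Coordinatewise convergence is weaker than convergence in the weak topology in general; the two
    agree once the supports stay in one finite set. *)
Lemma cvg_realization (T : Type) (G : set_system T) (H : T -> realization) V z :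
  Filter G -> (supp z `<=` V)%fset ->
  (\forall t \near G, (supp (H t) `<=` V)%fset) ->
  (forall p, p \in V -> (fun t => H t p) @ G --> z p) -> H @ G --> z.
Proof.
move=> FG sz sH hc U /(near_in_nbhs sz) [e /= e0 hU].
suff : \forall t \near G, forall p, p \in V -> `|H t p - z p| < e.
  move=> h; near=> t; apply: hU; split; first by near: t.
  by near: t.
have : \forall t \near G, forall p : V, `|H t (val p) - z (val p)| < e.
  apply: filter_forall => p; have := hc (val p) (valP p).
  by move=> /cvgrPdist_lt/(_ e e0); under eq_near do rewrite distrC.
apply: filterS => t h p pV.
by have := h (FSetSub pV).
Unshelve. all: by end_near.
Qed.

Lemma continuous_coord p : continuous (fun x : realization => x p).
Proof.
apply/continuousP => A oA; rewrite realization_openE => V x Ax sV.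
by apply: (cvg_coord (p := p) sV); exact: open_nbhs_nbhs.
Qed.

Lemma realization_hausdorff : hausdorff_space realization.
Proof.
rewrite open_hausdorff => x y xy.
have [p /eqP xyp] : exists p, x p <> y p.
  by apply/existsNP => h; move/eqP: xy; apply; apply: coord_inj.
have := @norm_hausdorff R R.
rewrite open_hausdorff => /(_ _ _ xyp) [[A B] /= [Ax By] [oA oB AB]].
exists ((fun x : realization => x p) @^-1` A, (fun x : realization => x p) @^-1` B) => /=.
  by split; apply/mem_set; [exact: (set_mem Ax)|exact: (set_mem By)].
split; [| |by rewrite -preimage_setI (eqP AB) preimage_set0].
- by move/continuousP: (@continuous_coord p); exact.
- by move/continuousP: (@continuous_coord p); exact.
Qed.

(** The subcomplex that is the realization of the subposet [Q], which may be infinite. *)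
Definition face (Q : set P) : set realization :=
  [set x | forall p, x p != 0 -> Q p].

Lemma face_closed Q : closed (face Q).
Proof.
rewrite -openC realization_openE => V x /existsNP[p /not_implyP[xp Qp]] sV.
have := cvg_coord (p := p) sV.
move=> /(_ [set r | r != 0]) h.
have : near_in V x [set y : realization | y p != 0].
  by apply: h; apply: open_nbhs_nbhs; split => //; exact: open_neq.
by apply: filterS => y yp /(_ p yp).
Qed.

End Realization.

(** * Limits of finite maxima and sums, and the standard simplex as a disk *)

Section RealLimits.
Variables (R : realType) (T : Type) (F : set_system T).
Context {FF : Filter F}.

Lemma cvg_maxr (f g : T -> R) (a b : R) :
  f @ F --> a -> g @ F --> b ->
  (fun x => Num.max (f x) (g x)) @ F --> Num.max a b.
Proof.
move=> fa gb; rewrite maxr_absE; under eq_fun do rewrite maxr_absE.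
apply: cvgM; last exact: cvg_cst.
by apply: cvgD; [exact: cvgD|apply: cvg_norm; apply: cvgB].
Qed.

Lemma cvg_minr (f g : T -> R) (a b : R) :
  f @ F --> a -> g @ F --> b ->
  (fun x => Num.min (f x) (g x)) @ F --> Num.min a b.
Proof.
move=> fa gb; rewrite minr_absE; under eq_fun do rewrite minr_absE.
apply: cvgM; last exact: cvg_cst.
by apply: cvgB; [exact: cvgD|apply: cvg_norm; apply: cvgB].
Qed.

Lemma cvg_sumr (I : Type) (s : seq I) (Q : pred I) (f : I -> T -> R) (a : I -> R) :
  (forall i, Q i -> f i @ F --> a i) ->
  (fun x => \sum_(i <- s | Q i) f i x) @ F --> \sum_(i <- s | Q i) a i.
Proof. by move=> fa; apply: cvg_big => //; exact: add_continuous. Qed.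

Lemma cvg_bigmaxr (I : Type) (s : seq I) (f : I -> T -> R) (a : I -> R) :
  (forall i, f i @ F --> a i) ->
  (fun x => \big[Num.max/0]_(i <- s) f i x) @ F --> \big[Num.max/0]_(i <- s) a i.
Proof.
move=> fa; elim: s => [|i s IH].
  by under eq_fun do rewrite big_nil; rewrite big_nil; exact: cvg_cst.
under eq_fun do rewrite big_cons; rewrite big_cons.
exact: cvg_maxr.
Qed.

End RealLimits.

(* The closed disk is mapped onto the standard simplex by a radial map centred
   at the barycentre: [displacement v] ranges over the vectors with sum 0, and
   the simplex is the unit ball of [gauge]. *)
Section DiskToSimplex.
Variables (R : realType) (n : nat).
Implicit Types (v : 'rV[R]_n) (i : 'I_n.+1).

Definition displacement v i : R :=
  if unlift ord_max i is Some j then v 0 j else - \sum_j v 0 j.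

Definition gauge v : R := \big[Num.max/0]_i (- (n.+1%:R * displacement v i)).

(** Chosen so that the displaced vector has gauge [sqnorm v]. Using the square of the norm only
    reparametrises the rays, and keeps square roots out of the definition. At [v = 0] the quotient
    is [0 / 0 = 0]. *)
Definition radial_scale v : R := sqnorm v / gauge v.

Definition simplex_weight v i : R :=
  n.+1%:R^-1 + displacement v i * radial_scale v.

Lemma displacement_sum v : \sum_i displacement v i = 0.
Proof.
rewrite big_ord_recr /= {2}/displacement unlift_none; apply/eqP.
rewrite subr_eq0; apply/eqP; apply: eq_bigr => j _; rewrite /displacement.
have -> : widen_ord (leqnSn n) j = lift ord_max j.
  by apply: val_inj; rewrite /= /bump leqNgt ltn_ord.
by rewrite liftK.
Qed.

Lemma displacement_lift v j : displacement v (lift ord_max j) = v 0 j.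
Proof. by rewrite /displacement liftK. Qed.

Lemma displacementZ c v i : displacement (c *: v) i = c * displacement v i.
Proof.
rewrite /displacement; case: unliftP => [j|] _; first by rewrite mxE.
by rewrite mulrN mulr_sumr; congr (- _); apply: eq_bigr => j _; rewrite mxE.
Qed.

Lemma displacement_inj v v' :
  (forall i, displacement v i = displacement v' i) -> v = v'.
Proof.
by move=> h; apply/rowP => j; rewrite -!displacement_lift h.
Qed.

Lemma gaugeZ c v : 0 <= c -> gauge (c *: v) = c * gauge v.
Proof.
move=> c0; rewrite /gauge (big_morph (fun x => c * x) (id1 := 0) (op1 := Num.max)).
- by apply: eq_bigr => i _; rewrite displacementZ; ring.
- by move=> x y; rewrite maxr_pMr.
- by rewrite mulr0.
Qed.

Lemma gauge_ge v i : - (n.+1%:R * displacement v i) <= gauge v.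
Proof. exact: (le_bigmax _ (fun i => - (n.+1%:R * displacement v i))). Qed.

Lemma gauge_ge0 v : 0 <= gauge v.
Proof. exact: bigmax_ge_id. Qed.

(** All entries are at least [- (gauge v / n.+1%:R)]; as they sum to 0, each one is at most [n]
    times [gauge v / n.+1%:R]. *)
Lemma displacement_le v i : `|displacement v i| <= gauge v.
Proof.
have n0 : 0 < n.+1%:R :> R by rewrite ltr0n.
have lo j : - (gauge v / n.+1%:R) <= displacement v j.
  rewrite lerNl ler_pdivlMr //; apply: le_trans (gauge_ge v j).
  by rewrite mulNr mulrC.
have q0 : 0 <= gauge v / n.+1%:R by rewrite divr_ge0 // gauge_ge0.
have qle : gauge v / n.+1%:R <= gauge v.
  by rewrite ler_pdivrMr // ler_peMr ?gauge_ge0 // ler1n.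
rewrite ler_norml; apply/andP; split.
  by apply: le_trans (lo i); rewrite lerN2.
have := displacement_sum v; rewrite (bigD1 i) //= => /eqP.
rewrite addr_eq0 => /eqP ->.
rewrite -sumrN (le_trans (y := \sum_(j | j != i) gauge v / n.+1%:R)) //.
  by apply: ler_sum => j _; rewrite lerNl.
rewrite sumr_const -[_ *+ _]mulr_natr mulrAC ler_pdivrMr // ler_wpM2l ?gauge_ge0 //.
by rewrite ler_nat (leq_trans (max_card _)) // card_ord.
Qed.

Lemma sqnorm_ge0 v : 0 <= sqnorm v.
Proof. by apply: sumr_ge0 => j _; exact: sqr_ge0. Qed.

Lemma sqnorm_eq0 v : sqnorm v = 0 -> v = 0.
Proof.
move=> /eqP; rewrite psumr_eq0 => [/allP h|j _]; last exact: sqr_ge0.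
apply/rowP => j; rewrite mxE; apply/eqP.
by have := h j (mem_index_enum j); rewrite sqrf_eq0.
Qed.

Lemma sqnormZ c v : sqnorm (c *: v) = c ^+ 2 * sqnorm v.
Proof. by rewrite mulr_sumr; apply: eq_bigr => j _; rewrite mxE exprMn. Qed.

Lemma gauge_gt0 v : v != 0 -> 0 < gauge v.
Proof.
move=> v0; rewrite lt_def gauge_ge0 andbT; apply: contra v0 => /eqP g0.
apply/eqP/displacement_inj => i; have := displacement_le v i.
have -> : displacement 0 i = 0 :> R by rewrite -(scale0r 0) displacementZ mul0r.
by rewrite g0 normr_le0 => /eqP.
Qed.

Lemma gauge_scale v : gauge v * radial_scale v = sqnorm v.
Proof.
have [->|v0] := eqVneq v 0; last by rewrite mulrC divfK // gt_eqF // gauge_gt0.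
by rewrite -(scale0r 0) sqnormZ gaugeZ // expr0n !mul0r.
Qed.

Lemma radial_scale_ge0 v : 0 <= radial_scale v.
Proof. by rewrite divr_ge0 // ?sqnorm_ge0 ?gauge_ge0. Qed.

Lemma weight_sum v : \sum_i simplex_weight v i = 1.
Proof.
rewrite big_split /= -mulr_suml displacement_sum mul0r addr0.
by rewrite sumr_const card_ord -[_ *+ _]mulr_natr mulVf // pnatr_eq0.
Qed.

Lemma weight_ge v i : (1 - sqnorm v) / n.+1%:R <= simplex_weight v i.
Proof.
have n0 : 0 < n.+1%:R :> R by rewrite ltr0n.
rewrite /simplex_weight mulrBl mul1r lerD2l lerNl ler_pdivlMr // -gauge_scale.
have := ler_wpM2r (radial_scale_ge0 v) (gauge_ge v i).
by apply: le_trans; rewrite le_eqVlt; apply/orP; left; apply/eqP; ring.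
Qed.

Lemma weight_ge0 v i : disk v -> 0 <= simplex_weight v i.
Proof.
move=> v1; apply: le_trans (weight_ge v i).
by rewrite divr_ge0 // subr_ge0.
Qed.

Lemma weight_gt0 v i : open_disk v -> 0 < simplex_weight v i.
Proof.
move=> v1; apply: lt_le_trans (weight_ge v i).
by rewrite divr_gt0 // subr_gt0.
Qed.

Lemma sphere_weight v : sphere v -> exists i, simplex_weight v i = 0.
Proof.
move=> v1.
have n0 : 0 < n.+1%:R :> R by rewrite ltr0n.
have v0 : v != 0.
  apply/eqP => v0; move: v1; rewrite /sphere /= v0 -(scale0r 0) sqnormZ expr0n mul0r.
  by move=> /eqP; rewrite eq_sym oner_eq0.
(* An index attaining the maximum is extracted from the falsity of [gauge v < gauge v]; at this
   index the weight vanishes. *)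
have : ~~ (gauge v < gauge v) by rewrite ltxx.
rewrite {1}/gauge => /bigmax_ltP h.
have [i hi] : exists i, gauge v <= - (n.+1%:R * displacement v i).
  apply: contrapT => /forallNP h'; apply: h; split; first exact: gauge_gt0.
  by move=> i _; rewrite ltNge; apply/negP; exact: h'.
exists i; apply/eqP; rewrite eq_le weight_ge0 ?andbT; last first.
  by rewrite /disk /= v1.
have := ler_wpM2r (radial_scale_ge0 v) hi.
rewrite gauge_scale v1 /simplex_weight => h2.
rewrite -(ler_pM2l n0) mulr0 mulrDr mulfV ?gt_eqF //.
by move: h2; rewrite mulNr -mulrA; lra.
Qed.

(** Nonzero vectors with the same image lie on one ray, [v = c *: v'] with [c > 0]; comparing gauges
    gives [sqnorm v = sqnorm v'], whence [c = 1]. *)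
Lemma weight_inj v v' :
  (forall i, simplex_weight v i = simplex_weight v' i) -> v = v'.
Proof.
move=> h.
have e i : displacement v i * radial_scale v = displacement v' i * radial_scale v'.
  exact: (addrI _ (h i)).
have ev : radial_scale v *: v = radial_scale v' *: v'.
  by apply: displacement_inj => i; rewrite !displacementZ mulrC e mulrC.
have pos w : w != 0 -> 0 < radial_scale w.
  move=> w0; rewrite divr_gt0 ?gauge_gt0 // lt_def sqnorm_ge0 andbT.
  by apply: contra w0 => /eqP /sqnorm_eq0 ->.
have [z|v0] := eqVneq v 0.
  have [//|/[dup] v'0 /pos p'] := eqVneq v' 0; first by rewrite z.
  move/eqP: ev; rewrite z scaler0 eq_sym scaler_eq0 gt_eqF //= => /eqP ->.
  by [].
have [z|v'0] := eqVneq v' 0.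
  by move/eqP: ev; rewrite z scaler0 scaler_eq0 gt_eqF ?pos //= => /eqP.
have s0 := pos _ v0; have s'0 := pos _ v'0.
have eg : sqnorm v = sqnorm v'.
  rewrite -!gauge_scale mulrC -(gaugeZ _ (ltW s0)) ev gaugeZ ?ltW //.
  by rewrite mulrC.
pose c := radial_scale v' / radial_scale v.
have c0 : 0 < c by rewrite divr_gt0.
have ev' : v = c *: v'.
  rewrite /c mulrC -scalerA -ev scalerA mulVf ?gt_eqF // scale1r //.
have : c ^+ 2 = 1.
  apply: (@mulIf _ (sqnorm v')); last by rewrite mul1r -sqnormZ -ev'.
  by apply: contra v'0 => /eqP /sqnorm_eq0 ->.
move=> /eqP; rewrite sqrf_eq1 => /orP[/eqP c1|/eqP c1].
  by rewrite ev' c1 scale1r.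
by move: c0; rewrite c1 ltr0N1.
Qed.

Lemma weight_surj (w : 'I_n.+1 -> R) :
  (forall i, 0 <= w i) -> \sum_i w i = 1 ->
  exists2 v, (forall i, simplex_weight v i = w i) &
    disk v /\ ((forall i, 0 < w i) -> open_disk v).
Proof.
move=> w0 w1.
have n0 : 0 < n.+1%:R :> R by rewrite ltr0n.
pose d i := w i - n.+1%:R^-1.
have d0 : \sum_i d i = 0.
  by rewrite sumrB w1 sumr_const card_ord -[_ *+ _]mulr_natr mulVf ?subrr ?gt_eqF.
pose u : 'rV[R]_n := \row_j d (lift ord_max j).
have du i : displacement u i = d i.
  rewrite /displacement; case: unliftP => [j ->|->]; first by rewrite mxE.
  move: d0; rewrite big_ord_recr /= => /eqP; rewrite addrC addr_eq0 => /eqP ->.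
  congr (- _); apply: eq_bigr => j _; rewrite mxE; congr d.
  by apply: val_inj; rewrite /= /bump leqNgt ltn_ord.
have gle : gauge u <= 1.
  apply/bigmax_leP; split=> // i _; rewrite du /d mulrBr.
  by rewrite mulfV ?gt_eqF // opprB gerBl mulr_ge0 // ltW.
have glt : (forall i, 0 < w i) -> gauge u < 1.
  move=> wpos; apply/bigmax_ltP; split=> // i _; rewrite du /d mulrBr.
  by rewrite mulfV ?gt_eqF // opprB gtrBl mulr_gt0.
have [u0|u0] := eqVneq u 0.
  exists 0; last first.
    have s0 : sqnorm (0 : 'rV[R]_n) = 0 by rewrite -(scale0r 0) sqnormZ expr0n mul0r.
    by rewrite /disk /open_disk /= s0 ler01 ltr01.
  move=> i; rewrite /simplex_weight -u0 du.
  have : d i = 0 by rewrite -du u0 -(scale0r 0) displacementZ mul0r.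
  by rewrite /d => /eqP; rewrite subr_eq0 => /eqP ->; rewrite subrr mul0r addr0.
have s0 : 0 < sqnorm u.
  by rewrite lt_def sqnorm_ge0 andbT; apply: contra u0 => /eqP /sqnorm_eq0 ->.
have r0 : 0 < radial_scale u by rewrite divr_gt0 ?gauge_gt0.
(* The radial scale is homogeneous of degree 1, so the displacement of [c *: u] is scaled by
   [c ^+ 2 * radial_scale u] relative to that of [u]; this [c] makes the factor 1. *)
pose c := Num.sqrt (radial_scale u)^-1.
have c2 : c ^+ 2 = (radial_scale u)^-1 by rewrite sqr_sqrtr // invr_ge0 ltW.
have c0 : 0 < c by rewrite sqrtr_gt0 invr_gt0.
have sc : sqnorm (c *: u) = gauge u.
  by rewrite sqnormZ c2 -gauge_scale mulrC mulfK ?gt_eqF.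
have rc : radial_scale (c *: u) = c * radial_scale u.
  rewrite /radial_scale sqnormZ gaugeZ ?ltW //.
  by have := gauge_gt0 u0; move=> g0; field; rewrite !gt_eqF.
exists (c *: u); last by rewrite /disk /open_disk /= sc.
move=> i; rewrite /simplex_weight displacementZ rc mulrACA -expr2 c2 mulrCA.
by rewrite mulVf ?gt_eqF // mulr1 du /d addrC subrK.
Qed.

Lemma continuous_displacement i : continuous (fun v => displacement v i).
Proof.
move=> v; rewrite /displacement; case: unlift => [j|].
  exact: coord_continuous.
have h : (fun w : 'rV[R]_n => \sum_j w 0 j) @ v --> \sum_j v 0 j.
  apply: (cvg_sumr (FF := nbhs_filter v) (f := fun j (w : 'rV[R]_n) => w 0 j)) => j _.
  exact: (@coord_continuous R 1 n 0 j v).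
exact: (cvgN h).
Qed.

Lemma continuous_sqnorm : continuous (@sqnorm R n).
Proof.
move=> v; rewrite /sqnorm.
apply: (cvg_sumr (FF := nbhs_filter v) (f := fun j (v : 'rV[R]_n) => v 0 j ^+ 2)) => j _.
rewrite expr2; under eq_fun do rewrite expr2.
have h := @coord_continuous R 1 n 0 j v.
exact: (cvgM h h).
Qed.

Lemma continuous_gauge : continuous gauge.
Proof.
move=> v; rewrite /gauge.
apply: (cvg_bigmaxr (FF := nbhs_filter v)
  (f := fun j (w : 'rV[R]_n) => - (n.+1%:R * displacement w j))) => j.
have h : displacement w j @[w --> v] --> displacement v j.
  exact: continuous_displacement.
exact: (cvgN (cvgM (@cvg_cst _ (n.+1%:R : R) _ (nbhs v) _) h)).
Qed.

Lemma continuous_weight i : continuous (fun v => simplex_weight v i).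
Proof.
move=> v.
suff h : displacement w i * radial_scale w @[w --> v] --> displacement v i * radial_scale v.
  exact: (cvgD (@cvg_cst _ (n.+1%:R^-1 : R) _ (nbhs v) _) h).
(* The quotient rule fails at 0, where the gauge vanishes; there the product is bounded by
   [gauge w * radial_scale w = sqnorm w]. *)
have [->|v0] := eqVneq v 0.
  have d0 : displacement 0 i = 0 :> R by rewrite -(scale0r 0) displacementZ mul0r.
  rewrite d0 mul0r.
  suff h : `|displacement w i * radial_scale w| @[w --> (0 : 'rV[R]_n)] --> (0 : R).
    by move/(norm_cvg0P (fun w => displacement w i * radial_scale w)) : h.
  have s0 : sqnorm (0 : 'rV[R]_n) = 0 by rewrite -(scale0r 0) sqnormZ expr0n mul0r.
  apply: (@squeeze_cvgr _ _ (nbhs_filter (0 : 'rV[R]_n)) R (fun _ => 0) (@sqnorm R n)).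
  - apply: nearW => w; rewrite normr_ge0 /= normrM (ger0_norm (radial_scale_ge0 _)) ?radial_scale_ge0 //.
    by rewrite -gauge_scale ler_wpM2r ?radial_scale_ge0 // displacement_le.
  - exact: (@cvg_cst _ (0 : R) _ (nbhs _) _).
  - by have := @continuous_sqnorm 0; rewrite /continuous_at s0.
have g0 : gauge v != 0 by rewrite gt_eqF // gauge_gt0.
exact: (cvgM (@continuous_displacement i v)
  (cvgM (@continuous_sqnorm v) (cvgV g0 (@continuous_gauge v)))).
Qed.

End DiskToSimplex.

(** * The CW-structure of the realization *)

Definition chain (P : poset) (V : {fset P}) :=
  forall p q, p \in V -> q \in V -> ple p q \/ ple q p.

(** The uniform bound serves twice: it bounds the length of chains, hence the dimension, and it
    prevents a group element from moving a point to another one comparable with it. *)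
Definition small_down_sets (P : poset) (B : nat) :=
  forall x : P, exists2 s : seq P, (size s <= B)%N & forall y, ple y x -> y \in s.

Lemma chain_max (P : poset) (V : {fset P}) :
  chain V -> V != fset0 -> exists2 m, m \in V & forall p, p \in V -> ple p m.
Proof.
move=> cV /fset0Pn[p0 p0V].
suff : forall s : seq P, {subset s <= V} -> exists2 m, m \in V &
    forall p, p \in s -> ple p m.
  by move=> /(_ (enum_fset V)); apply.
elim=> [|p s IH] sV; first by exists p0.
have [|m mV hm] := IH; first by move=> q qs; apply: sV; rewrite inE qs orbT.
have pV : p \in V by apply: sV; rewrite inE eqxx.
have [pm|mp] := cV _ _ pV mV.
  by exists m => // q; rewrite inE => /predU1P[->|/hm].
exists p => // q; rewrite inE => /predU1P[->|/hm qm]; first exact: plexx.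
exact: ple_trans mp.
Qed.

Lemma chain_size (P : poset) (V : {fset P}) B :
  small_down_sets P B -> chain V -> (#|` V| <= B)%N.
Proof.
move=> bP cV; have [->|V0] := eqVneq V fset0; first by rewrite cardfs0.
have [m mV hm] := chain_max cV V0.
have [s sB sP] := bP m; apply: leq_trans sB.
by apply: uniq_leq_size => // p /hm /sP.
Qed.

Section Simplices.
Variables (R : realType) (P : poset).
Local Notation X := (realization R P).

Record simplex := Simplex {
  verts : {fset P} ;
  verts_neq0 : verts != fset0 ;
  verts_chain : chain verts }.

Lemma verts_inj : injective verts.
Proof.
move=> [V V0 cV] [W W0 cW] /= e; subst W.
by congr Simplex; apply: Prop_irrelevance.
Qed.

Lemma supp_chain (x : X) : chain (supp x).
Proof. by move=> p q; exact: coord_comparable. Qed.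

Lemma supp_nonempty (x : X) : supp x != fset0.
Proof. by have [p px] := supp_neq0 x; apply/fset0Pn; exists p. Qed.

Definition supp_simplex (x : X) := Simplex (supp_nonempty x) (@supp_chain x).

Definition simplex_dim (s : simplex) := #|` verts s|.-1.

Lemma simplex_card (s : simplex) : #|` verts s| = (simplex_dim s).+1.
Proof. by rewrite prednK // cardfs_gt0 verts_neq0. Qed.

Section CharacteristicMap.
Variable s : simplex.
Local Notation n := (simplex_dim s).

Definition vert_rank (p : P) : 'I_n.+1 := inord (index p (verts s)).

Definition weight_at (v : 'rV[R]_n) (p : P) : R :=
  if p \in verts s then simplex_weight v (vert_rank p) else 0.

Lemma sum_vert_rank (w : 'I_n.+1 -> R) :
  \sum_(p <- verts s) w (vert_rank p) = \sum_i w i.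
Proof.
have /fset0Pn[p0 _] := verts_neq0 s.
rewrite (big_nth p0) -[size _]/(#|` verts s|) simplex_card big_mkord.
apply: eq_bigr => i _; congr w; rewrite /vert_rank index_uniq //.
  exact: inord_val.
by rewrite -[size _]/(#|` verts s|) simplex_card.
Qed.

Lemma vert_rankK (i : 'I_n.+1) : exists2 p, p \in verts s & vert_rank p = i.
Proof.
have /fset0Pn[p0 _] := verts_neq0 s.
have hi : (i < size (verts s))%N.
  by rewrite -[size _]/(#|` verts s|) simplex_card.
exists (nth p0 (verts s) i); first exact: mem_nth.
by rewrite /vert_rank index_uniq // inord_val.
Qed.

Lemma weight_at_barycentric v : disk v -> barycentric (weight_at v).
Proof.
move=> v1; split.
- by move=> p; rewrite /weight_at; case: ifP => // _; exact: weight_ge0.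
- move=> p q; rewrite /weight_at.
  case: ifP => [ps _|]; last by rewrite eqxx.
  case: ifP => [qs _|]; last by rewrite eqxx.
  exact: (@verts_chain s).
- exists (verts s); split; last first.
    rewrite -[RHS](weight_sum v) -sum_vert_rank big_seq [RHS]big_seq.
    by apply: eq_bigr => p ps; rewrite /weight_at ps.
  by move=> p; rewrite /weight_at; case: ifP => //; rewrite eqxx.
Qed.

Lemma disk0 : disk (0 : 'rV[R]_n).
Proof. by rewrite /disk /= -(scale0r 0) sqnormZ expr0n mul0r ler01. Qed.

(** Where the weights are not barycentric coordinates the value is a dummy; on the disk they always
    are. *)
Definition characteristic_map (v : 'rV[R]_n) : X :=
  if pselect (barycentric (weight_at v)) is left h then Realization h
  else Realization (weight_at_barycentric disk0).

Lemma characteristic_mapE v p : disk v -> characteristic_map v p = weight_at v p.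
Proof.
by move=> /weight_at_barycentric h; rewrite /characteristic_map; case: pselect.
Qed.

Lemma characteristic_map_supp v : disk v -> (supp (characteristic_map v) `<=` verts s)%fset.
Proof.
move=> v1; apply/fsubsetP => p.
by rewrite in_supp characteristic_mapE // /weight_at; case: ifP => //; rewrite eqxx.
Qed.

Lemma open_disk_disk (v : 'rV[R]_n) : open_disk v -> disk v.
Proof. exact: ltW. Qed.

Lemma sphere_disk (v : 'rV[R]_n) : sphere v -> disk v.
Proof. by rewrite /sphere /disk /= => ->. Qed.

Lemma characteristic_map_disk :
  [set characteristic_map v | v in @disk R n] = face [set p | p \in verts s].
Proof.
apply/seteqP; split=> [_ [v v1 <-] p|x xs].
  by rewrite -in_supp => /(fsubsetP (characteristic_map_supp v1)).
have sx : (supp x `<=` verts s)%fset by apply/fsubsetP => p; rewrite in_supp => /xs.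
have [/fset0Pn [p0 p0s]] := verts_neq0 s.
pose w (i : 'I_n.+1) := x (nth p0 (verts s) i).
have wr p : p \in verts s -> w (vert_rank p) = x p.
  move=> ps; rewrite /w inordK ?nth_index //.
  by rewrite -simplex_card index_mem.
have w1 : \sum_i w i = 1.
  rewrite -sum_vert_rank -(coord_sum1 sx) big_seq [RHS]big_seq.
  by apply: eq_bigr => p /wr.
have w0 i : 0 <= w i by exact: coord_ge0.
have [v vw [v1 _]] := weight_surj w0 w1.
exists v => //; apply: coord_inj => p; rewrite characteristic_mapE // /weight_at.
case: ifP => [ps|/negbT ps]; first by rewrite vw wr.
by apply/esym/eqP; apply: contraNT ps => /xs.
Qed.

Lemma characteristic_map_open_disk :
  [set characteristic_map v | v in @open_disk R n] = [set x | supp x = verts s].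
Proof.
apply/seteqP; split=> [_ [v v1 <-]|x xs] /=.
  have v1' := open_disk_disk v1.
  apply/fsetP => p; rewrite in_supp characteristic_mapE // /weight_at.
  by case: ifP => _; [rewrite gt_eqF ?weight_gt0|rewrite eqxx].
have : face [set p | p \in verts s] x by move=> p; rewrite -in_supp xs.
rewrite -characteristic_map_disk => -[v v1 vx].
exists v => //.
have [//|ge1] := pselect (open_disk v).
have /sphere_weight [i i0] : sphere v.
  by apply/eqP; rewrite eq_le v1 /= leNgt; apply/negP.
have [p ps pi] := vert_rankK i.
move: (ps); rewrite -xs in_supp -vx characteristic_mapE // /weight_at ps pi i0.
by rewrite eqxx.
Qed.

Lemma characteristic_map_sphere v : sphere v ->
  (supp (characteristic_map v) `<` verts s)%fset.
Proof.
move=> v1; have v1' := sphere_disk v1.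
rewrite fproperEneq characteristic_map_supp // andbT.
have [i i0] := sphere_weight v1; have [p ps pi] := vert_rankK i.
apply/eqP => /fsetP /(_ p); rewrite ps in_supp characteristic_mapE //.
by rewrite /weight_at ps pi i0 eqxx.
Qed.

Lemma characteristic_map_inj : set_inj (@open_disk R n) characteristic_map.
Proof.
move=> v v' /set_mem v1 /set_mem v1' e; apply: weight_inj => i.
have [p ps <-] := vert_rankK i.
have := congr1 (fun x : X => x p) e.
by rewrite !characteristic_mapE ?/weight_at ?ps //; exact: open_disk_disk.
Qed.

Lemma characteristic_map_continuous :
  {within @disk R n, continuous characteristic_map}.
Proof.
apply/subspace_continuousP => v v1.
have dT : \forall w \near within (@disk R n) (nbhs v), disk w by exact: withinT.
apply: (@cvg_realization _ _ _ _ _ (verts s)).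
- exact: characteristic_map_supp.
- by apply: filterS dT; exact: characteristic_map_supp.
- move=> p ps; rewrite characteristic_mapE //.
  apply: (@cvg_trans _ (weight_at w p @[w --> within (@disk R n) (nbhs v)])).
    apply: near_eq_cvg; apply: filterS dT => w w1.
    by rewrite characteristic_mapE.
  rewrite /weight_at ps; apply: cvg_within_filter.
  exact: continuous_weight.
Qed.

End CharacteristicMap.

Lemma simplex_dim_proper (s t : simplex) :
  (verts s `<` verts t)%fset -> (simplex_dim s < simplex_dim t)%N.
Proof. by move=> /fproper_ltn_card; rewrite !simplex_card. Qed.

Lemma realization_closure_finite (s : simplex) : exists J : set simplex,
  [/\ finite_set J, forall t, J t -> (simplex_dim t < simplex_dim s)%N &
    [set characteristic_map v | v in @sphere R (simplex_dim s)] `<=`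
      \bigcup_(t in J) [set characteristic_map v | v in @open_disk R (simplex_dim t)]].
Proof.
exists [set t | (verts t `<` verts s)%fset]; split.
- apply: (@sub_finite_set _ _ (verts @^-1` [set V | V \in fpowerset (verts s)])).
    by move=> t /fproper_sub; rewrite /= fpowersetE.
  apply: finite_preimage; first by move=> ? ? _ _; exact: verts_inj.
  exact: finite_fset.
- by move=> t; exact: simplex_dim_proper.
- move=> _ [v v1 <-]; exists (supp_simplex (characteristic_map v)).
    exact: characteristic_map_sphere.
  by rewrite characteristic_map_open_disk.
Qed.

(** A finite [V] has finitely many subsets, so near [x] one can avoid [A] on the closed cells of all
    the simplices with vertices in [V] at once; and each [y] supported in [V] lies on the cell of
    [supp y]. *)
Lemma realization_weak_topology (A : set X) :
  (forall s : simplex,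
    closed (A `&` [set characteristic_map v | v in @disk R (simplex_dim s)])) ->
  closed A.
Proof.
move=> h; rewrite -openC realization_openE => V x Ax sV.
have : \forall y \near near_in V x, forall W : fpowerset V,
    fsval W = supp y -> ~ A y.
  apply: filter_forall => -[W WV] /=.
  have [[W0 cW]|nW] := pselect (W != fset0 /\ chain W); last first.
    apply: filterE => y e; exfalso; apply: nW; rewrite e; split.
      exact: supp_nonempty.
    exact: supp_chain.
  have := h (Simplex W0 cW); rewrite characteristic_map_disk -openC /=.
  move=> /(_ V x) h1; have := h1 (fun Ax' => Ax Ax'.1) sV.
  apply: filterS => y hy e Ay; apply: hy; split=> // p /=.
  by rewrite e in_supp.
move=> h1; near=> y => /=.
have yV : (supp y `<=` V)%fset by near: y; exact: near_in_supp.
have WV : supp y \in fpowerset V by rewrite fpowersetE.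
have hh : forall W : fpowerset V, fsval W = supp y -> ~ A y by near: y.
exact: (hh (FSetSub WV)).
Unshelve. all: by end_near.
Qed.

Lemma realization_trivIset :
  trivIset [set: simplex]
    (fun s => [set characteristic_map v | v in @open_disk R (simplex_dim s)]).
Proof.
move=> s t _ _ [x []]; rewrite !characteristic_map_open_disk /= => -> e.
exact: verts_inj.
Qed.

Lemma realization_cover :
  \bigcup_s [set characteristic_map v | v in @open_disk R (simplex_dim s)]
  = [set: X].
Proof.
apply/seteqP; split=> // x _; exists (supp_simplex x) => //.
by rewrite characteristic_map_open_disk.
Qed.

Definition realization_cw : cw_structure R X :=
  CWStructure (@realization_hausdorff R P) characteristic_map_continuous
    characteristic_map_inj realization_trivIset realization_cover
    realization_closure_finite realization_weak_topology.

Lemma realization_cell (s : cw_index realization_cw) :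
  cw_cell s = [set x | supp x = verts s].
Proof. exact: characteristic_map_open_disk. Qed.

Lemma realization_finite_dimensional B :
  small_down_sets P B -> finite_dimensional realization_cw.
Proof.
move=> bP; exists B => s; apply: leq_trans (leq_pred _) _.
exact: (chain_size bP (@verts_chain s)).
Qed.

End Simplices.

(** * Zigzags of monotone maps *)

Definition monotone_on (P : poset) (Q : set P) (f : P -> P) : Prop :=
  (forall p, Q p -> Q (f p)) /\
  (forall p q, Q p -> Q q -> ple p q -> ple (f p) (f q)).

(* The maps [h n] alternately increase and decrease with [n], which makes
   consecutive ones homotopic, and tend to [l] pointwise. *)
Definition zigzag (P : poset) (Q : set P) (h : nat -> P -> P) (l : P -> P) : Prop :=
  [/\ forall n, monotone_on Q (h n),
      forall n p, Q p ->
        if odd n then ple (h n.+1 p) (h n p) else ple (h n p) (h n.+1 p) &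
      forall p, Q p -> exists N, forall n, (N <= n)%N -> h n p = l p].

(* A zigzag is run backwards, from its limit to its map of index 0, so that the
   stages lead from [id] to [h 0 0], [h 1 0], ..., [h m 0]. *)
Definition contraction (P : poset) (Q : set P) (m : nat)
    (h : nat -> nat -> P -> P) : Prop :=
  [/\ zigzag Q (h 0%N) id, forall i, zigzag Q (h i.+1) (h i 0%N) &
      exists2 p0, Q p0 & forall p, Q p -> h m 0%N p = p0].

Section Homotopies.
Variables (R : realType) (P : poset).
Local Notation X := (realization R P).
Implicit Types (x y : X) (V : {fset P}) (Q : set P) (f g : P -> P).

(** Continuity on each finite piece times the interval: this is what can be checked by
    coordinates. *)
Definition locally_continuous Q (H : X -> R -> X) : Prop :=
  forall V x t, face Q x -> (supp x `<=` V)%fset -> 0 <= t <= 1 ->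
  forall U, nbhs (H x t) U ->
  \forall y \near near_in V x & s \near nbhs t, face Q y -> 0 <= s <= 1 -> U (H y s).

Lemma near_in_refl V x (U : set X) :
  (supp x `<=` V)%fset -> near_in V x U -> U x.
Proof.
move=> sV [e /= e0]; apply; split=> // p _.
by rewrite subrr normr0.
Qed.

(** The product topology on [X * R] is not given as the one coherent with finite pieces. The gap is
    bridged by a compact neighbourhood [[a, b]] of [t0] in the unit interval: by the tube lemma on
    each piece, the points [x] for which [H x] sends [[a, b]] into [O] form a weakly open set. *)
Lemma locally_continuous_within Q H : locally_continuous Q H ->
  {within face Q `*` `[0, 1]%classic, continuous (fun xt : X * R => H xt.1 xt.2)}.
Proof.
move=> lcH; apply/subspace_continuousP => -[x0 t0] [/= Qx0 t01] U hU.
have {}t01 : 0 <= t0 <= 1 by move: t01; rewrite /= in_itv.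
rewrite nbhsE in hU; case: hU => O [oO Ox0] OU.
have [[S1 S2] [/= S1x S2t] S12] :=
  lcH (supp x0) x0 t0 Qx0 (fsubset_refl _) t01 O (open_nbhs_nbhs (conj oO Ox0)).
have S1x0 := near_in_refl (fsubset_refl _) S1x.
have /nbhs_ballP [e /= e0 eS2] := S2t.
pose a := Num.max 0 (t0 - e / 2); pose b := Num.min 1 (t0 + e / 2).
have abP s : s \in `[a, b] -> [/\ 0 <= s, s <= 1 & `|t0 - s| < e].
  rewrite in_itv /= ge_max le_min => /andP[/andP[s0 s1] /andP[s2 s3]].
  by split=> //; rewrite ltr_norml; lra.
pose V' := [set x | face Q x -> forall s, s \in `[a, b] -> O (H x s)].
have oV' : open V'.
  rewrite realization_openE => V x V'x sV.
  have [Qx|Qx] := pselect (face Q x); last first.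
    have : open (~` face (R := R) Q) by rewrite openC; exact: face_closed.
    move=> /(_ V x Qx sV); apply: filterS => y Qy Qy'.
    by exfalso; exact: Qy.
  have := (@segment_compact R a b).
  move=> /compact_near_coveringP.
  move=> /(_ X (near_in V x) (fun y s => face Q y -> 0 <= s <= 1 -> O (H y s)) _).
  case.
    move=> s sab; have [s0 s1 _] := abP s sab.
    have := lcH V x s Qx sV; rewrite s0 s1 => /(_ isT O).
    case; first by apply: open_nbhs_nbhs; split=> //; exact: V'x.
    by move=> [A B] [hA hB] h; exists (B, A) => //= -[s' y] [/= Bs Ay]; exact: (h (y, s')).
  move=> e' /= e'0 h; exists e' => // y /h hy Qy s sab.
  have [s0 s1 _] := abP s sab.
  by apply: hy => //; rewrite s0 s1.
have V'x0 : V' x0.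
  move=> _ s /abP [s0 s1 st]; apply: (S12 (x0, s)) => //=.
    by split=> //; apply: eS2; exact: st.
  by rewrite s0.
exists (V', ball t0 (e / 2)) => /=.
  split; first by apply: open_nbhs_nbhs.
  by apply: nbhsx_ballx; rewrite divr_gt0.
move=> [y s] [/= V'y bs] [/= Qy]; rewrite in_itv /= => /andP[s0 s1].
apply: OU => /=; apply: V'y => //.
move: bs; rewrite /ball /= ltr_norml => /andP[b1 b2].
by rewrite in_itv /= /a /b ge_max le_min s0 s1 /=; apply/andP; split; lra.
Qed.

(** * The prism between two comparable maps *)

Section Prism.

Definition above y p : R := \sum_(q <- supp y | `[< plt p q >]) y q.

Definition upper y s p : R := Num.min (y p) (Num.max 0 (s - above y p)).

(* Order the support of [y] as a chain: the topmost part of the mass, of total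
   weight [s], is transported by [g], and the remaining part by [f]. *)
Definition prism_coord f g y s q : R :=
  \sum_(p <- supp y) ((if f p == q then y p - upper y s p else 0) +
                      (if g p == q then upper y s p else 0)).

Definition prism f g y s : X :=
  if pselect (barycentric (prism_coord f g y s)) is left h then Realization h
  else y.

(** The map of realizations induced by [f]; with two equal maps the prism does not depend on time,
    whence the arbitrary time 0. *)
Definition push f y : X := prism f f y 0.

Lemma aboveV V y p : (supp y `<=` V)%fset ->
  above y p = \sum_(q <- V | `[< plt p q >]) y q.
Proof.
move=> sV; rewrite /above big_mkcond [RHS]big_mkcond.
by apply: sum_supp => // q ->; rewrite if_same.
Qed.

Lemma upper_ge0 y s p : 0 <= upper y s p.
Proof. by rewrite le_min coord_ge0 le_max lexx. Qed.

Lemma upper_le y s p : upper y s p <= y p.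
Proof. by rewrite ge_min lexx. Qed.

Lemma above_ge0 y p : 0 <= above y p.
Proof. by apply: sumr_ge0 => q _; exact: coord_ge0. Qed.

Lemma prism_coordV V f g y s q : (supp y `<=` V)%fset ->
  prism_coord f g y s q =
  \sum_(p <- V) ((if f p == q then y p - upper y s p else 0) +
                 (if g p == q then upper y s p else 0)).
Proof.
move=> sV; apply: sum_supp => // p yp.
have -> : upper y s p = 0.
  by apply/eqP; rewrite eq_le upper_ge0 -yp upper_le.
by rewrite yp subrr !if_same addr0.
Qed.

Lemma prism_congr f g f' g' y s s' :
  prism_coord f g y s = prism_coord f' g' y s' -> prism f g y s = prism f' g' y s'.
Proof.
rewrite /prism => e.
by case: pselect => h; case: pselect => h' //; [apply: coord_inj => p /=; rewrite e|
  exfalso; apply: h'; rewrite -e|exfalso; apply: h; rewrite e].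
Qed.

Lemma prism_eq_on f g f' g' y s :
  {in supp y, f =1 f'} -> {in supp y, g =1 g'} -> prism f g y s = prism f' g' y s.
Proof.
move=> ff gg; apply: prism_congr; apply/funext => q.
by rewrite /prism_coord !big_seq; apply: eq_bigr => p ps; rewrite ff ?gg.
Qed.

Lemma prism_same f y s : prism f f y s = push f y.
Proof.
apply: prism_congr; apply/funext => q; apply: eq_bigr => p _.
by case: ifP; rewrite ?subrK.
Qed.

Lemma prism_le0 f g y s : s <= 0 -> prism f g y s = push f y.
Proof.
move=> s0; rewrite -(prism_same f y s).
have u0 p : upper y s p = 0.
  rewrite /upper (max_idPl _) ?(min_idPr _) ?coord_ge0 //.
  by rewrite subr_le0 (le_trans s0) // above_ge0.
by apply: prism_congr; apply/funext => q; apply: eq_bigr => p _; rewrite u0 !if_same.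
Qed.

Lemma above_le1 y p : p \in supp y -> above y p + y p <= 1.
Proof.
move=> ps; rewrite -(coord_sum1 (fsubset_refl (supp y))).
rewrite [leRHS](bigD1_seq p) ?fset_uniq //= [leLHS]addrC lerD2l.
rewrite /above [leRHS](bigID (fun q => `[< plt p q >])) /=.
rewrite (eq_bigl (fun q => (q != p) && `[< plt p q >])); last first.
  move=> q; case: asboolP => [[_ pq]|]; last by rewrite andbF.
  by rewrite andbT; apply/esym/eqP => e; apply: pq.
by rewrite lerDl; apply: sumr_ge0 => q _; exact: coord_ge0.
Qed.

Lemma prism_ge1 f g y s : 1 <= s -> prism f g y s = push g y.
Proof.
move=> s1; rewrite -(prism_same g y s); apply: prism_congr; apply/funext => q.
rewrite /prism_coord big_seq [RHS]big_seq; apply: eq_bigr => p ps.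
have -> : upper y s p = y p.
  rewrite /upper; apply/min_idPl; rewrite le_max; apply/orP; right.
  by rewrite lerBrDl (le_trans _ s1) // above_le1.
by rewrite subrr !if_same.
Qed.

Variables (Q : set P) (f g : P -> P).
Hypotheses (fQ : monotone_on Q f) (gQ : monotone_on Q g).
Hypothesis fg : forall p, Q p -> ple (f p) (g p).

Lemma prism_coord_neq0 y s q : prism_coord f g y s q != 0 ->
  exists2 p, p \in supp y &
    (f p = q /\ upper y s p < y p) \/ (g p = q /\ 0 < upper y s p).
Proof.
apply: contraNP => h; apply/eqP; apply: big1_seq => p /andP[_ ps].
have [fp|_] := eqVneq (f p) q; have [gp|_] := eqVneq (g p) q.
- exfalso; apply: h; exists p => //.
  have [u0|u0] := ltP 0 (upper y s p); first by right.
  left; split=> //; apply: le_lt_trans u0 _.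
  by rewrite lt_def coord_ge0 andbT -in_supp.
- rewrite addr0; apply/eqP; rewrite subr_eq0 eq_sym eq_le upper_le leNgt.
  by apply/negP => u1; apply: h; exists p => //; left.
- rewrite add0r; apply/eqP; rewrite eq_le upper_ge0 andbT leNgt.
  by apply/negP => u1; apply: h; exists p => //; right.
- by rewrite addr0.
Qed.

(** The point is that the new support is a chain. If [f p] and [g p'] both occur, some mass at [p]
    is below the cut and some mass at [p'] is above it, so [p] is at most [p'], and
    [f p <= f p' <= g p']. *)
Lemma prism_barycentric y s : face Q y -> barycentric (prism_coord f g y s).
Proof.
move=> Qy.
have Qs p : p \in supp y -> Q p by rewrite in_supp; exact: Qy.
split.
- move=> q; apply: sumr_ge0 => p _; apply: addr_ge0; case: ifP => // _.
    by rewrite subr_ge0 upper_le.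
  exact: upper_ge0.
- have mixed p p' : p \in supp y -> p' \in supp y ->
      upper y s p < y p -> 0 < upper y s p' -> ple (f p) (g p').
    move=> ps p's up up'.
    have [pp'|p'p] := coord_comparable ps p's.
      apply: (ple_trans (fQ.2 _ _ (Qs _ ps) (Qs _ p's) pp')).
      exact: fg (Qs _ p's).
    have [e|np] := pselect (p' = p).
      by subst p'; exact: fg (Qs _ ps).
    (* With [p'] strictly below [p], all the mass at [p] counts in [above y p']; but the cut would
       satisfy [above y p' < s < above y p + y p]. *)
    exfalso.
    have ap : above y p + y p <= above y p'.
      have pp' : `[< plt p' p >] by apply/asboolP.
      rewrite /above [leRHS]big_mkcond [leRHS](bigD1_seq p) ?fset_uniq //= pp'.
      rewrite [leLHS]addrC lerD2l big_mkcond [leRHS]big_mkcond /=.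
      apply: ler_sum => q _; case: asboolP => [[pq npq]|_]; last first.
        by case: ifP => // _; case: ifP => // _; exact: coord_ge0.
      have -> : q != p by apply/eqP => e; apply: npq.
      have -> // : `[< plt p' q >].
      apply/asboolP; split; first exact: ple_trans pq.
      by move=> e; apply: np; apply: ple_anti => //; rewrite e.
    move: up up'; rewrite /upper lt_min lt_max ltxx /= gt_min ltxx /=.
    rewrite gt_max => /andP[_ h1] /andP[_ h2].
    rewrite subr_gt0 in h2; rewrite ltrBlDl in h1.
    by have := lt_le_trans (lt_trans h2 h1) ap; rewrite ltxx.
  move=> q q' /prism_coord_neq0[p ps hp] /prism_coord_neq0[p' p's hp'].
  case: hp hp' => -[<- up] [] [<- up'].
  + have [pp'|pp'] := coord_comparable ps p's; [left|right].
      by apply: fQ.2 => //; exact: Qs.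
    by apply: fQ.2 => //; exact: Qs.
  + by left; exact: mixed.
  + by right; exact: mixed.
  + have [pp'|pp'] := coord_comparable ps p's; [left|right].
      by apply: gQ.2 => //; exact: Qs.
    by apply: gQ.2 => //; exact: Qs.
- exists ([fset f p | p in supp y] `|` [fset g p | p in supp y])%fset; split.
    move=> q /prism_coord_neq0[p ps hp]; rewrite inE.
    by case: hp => -[<- _]; rewrite in_imfset ?orbT.
  rewrite /prism_coord exchange_big /= -[RHS](coord_sum1 (fsubset_refl (supp y))).
  rewrite big_seq [RHS]big_seq; apply: eq_bigr => p ps.
  have one (V : {fset P}) (a : R) v : v \in V -> \sum_(i <- V) (if v == i then a else 0) = a.
    move=> vV; rewrite (bigD1_seq v) ?fset_uniq //= eqxx big1 ?addr0 //.
    by move=> i; rewrite eq_sym => /negbTE ->.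
  by rewrite big_split /= !one ?subrK // inE in_imfset ?orbT.
Qed.

Lemma prismE y s q : face Q y -> prism f g y s q = prism_coord f g y s q.
Proof. by move=> /(prism_barycentric s) h; rewrite /prism; case: pselect. Qed.

Lemma face_prism y s : face Q y -> face Q (prism f g y s).
Proof.
move=> Qy q; rewrite prismE // => /prism_coord_neq0[p ps].
have Qp : Q p by apply: Qy; rewrite -in_supp.
by case=> -[<- _]; [exact: fQ.1|exact: gQ.1].
Qed.

(** Written as sums over the fixed set [V] instead of over the varying supports, the coordinates of
    the prism are continuous functions of those of [y] and of [s]. *)
Lemma prism_cvg (T : Type) (G : set_system T) (FG : Filter G) (Y : T -> X)
    (S : T -> R) V x s :
  face Q x -> (supp x `<=` V)%fset ->
  (\forall t \near G, (supp (Y t) `<=` V)%fset) ->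
  (\forall t \near G, face Q (Y t)) ->
  (forall p, (fun t => Y t p) @ G --> x p) -> S @ G --> s ->
  (fun t => prism f g (Y t) (S t)) @ G --> prism f g x s.
Proof.
move=> Qx sx sY QY cY cS.
pose V' := ([fset f p | p in V] `|` [fset g p | p in V])%fset.
have sub y u : face Q y -> (supp y `<=` V)%fset -> (supp (prism f g y u) `<=` V')%fset.
  move=> Qy sy; apply/fsubsetP => q; rewrite in_supp prismE //.
  move=> /prism_coord_neq0[p /(fsubsetP sy) ps hp]; rewrite inE.
  by case: hp => -[<- _]; rewrite in_imfset ?orbT.
apply: (@cvg_realization _ _ _ _ _ V') => //.
- exact: sub.
- by near=> t; apply: sub; near: t.
move=> q _; rewrite prismE // (prism_coordV _ _ _ _ sx).
pose U y u p := Num.min (y p) (Num.max 0 (u - \sum_(q <- V | `[< plt p q >]) y q)) : R.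
have upE y u p : (supp y `<=` V)%fset -> upper y u p = U y u p.
  by move=> sy; rewrite /upper (aboveV _ sy).
apply: (@cvg_trans _ ((fun t => \sum_(p <- V)
    ((if f p == q then Y t p - U (Y t) (S t) p else 0) +
     (if g p == q then U (Y t) (S t) p else 0))) @ G)).
  apply: near_eq_cvg; near=> t.
  have st : (supp (Y t) `<=` V)%fset by near: t.
  have Qt : face Q (Y t) by near: t.
  rewrite prismE // (prism_coordV _ _ _ _ st).
  by apply: eq_bigr => p _; rewrite upE.
have Uc p : U (Y t) (S t) p @[t --> G] --> upper x s p.
  rewrite upE //; apply: cvg_minr => //; apply: cvg_maxr; first exact: cvg_cst.
  apply: cvgB => //; exact: (cvg_sumr (f := fun q t => Y t q)).
apply: (cvg_sumr (f := fun p t => (if f p == q then Y t p - U (Y t) (S t) p else 0) +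
     (if g p == q then U (Y t) (S t) p else 0))) => p _.
apply: cvgD.
- by case: (f p == q); [apply: cvgB|exact: cvg_cst].
- by case: (g p == q) => //; exact: cvg_cst.
Unshelve. all: by end_near.
Qed.

End Prism.

Lemma push_id y f : {in supp y, f =1 id} -> push f y = y.
Proof.
move=> fi; rewrite /push (prism_eq_on _ fi fi).
have mon : monotone_on [set p : P | True] id by [].
apply: coord_inj => q.
rewrite (@prismE [set _ | True]) //; last by move=> p _; exact: plexx.
rewrite /prism_coord; under eq_bigr do rewrite /=.
transitivity (\sum_(p <- supp y) (if p == q then y p else 0)).
  by apply: eq_bigr => p _; case: eqP; rewrite ?subrK ?addr0.
have [qs|qs] := boolP (q \in supp y).
  rewrite (bigD1_seq q) ?fset_uniq //= eqxx big1 ?addr0 //.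
  by move=> i /negbTE ->.
have -> : y q = 0 by move: qs; rewrite in_supp negbK => /eqP.
apply: big1_seq => p /andP[_ ps]; case: eqP => // e.
by move: qs; rewrite -e ps.
Qed.

End Homotopies.

(** * Homotopies from zigzags *)

Section Stages.
Variables (R : realType) (P : poset) (Q : set P).
Local Notation X := (realization R P).
Implicit Types (x y : X) (V : {fset P}).

Definition homotopic (f g : X -> X) : Prop :=
  exists H : X -> R -> X,
    [/\ locally_continuous Q H,
        forall y t, face Q y -> 0 <= t <= 1 -> face Q (H y t) &
        forall y, face Q y -> H y 0 = f y /\ H y 1 = g y].

Lemma homotopic_trans g f h : homotopic f g -> homotopic g h -> homotopic f h.
Proof.
move=> [H1 [c1 Q1 e1]] [H2 [c2 Q2 e2]].
pose H y (t : R) := if t <= 2^-1 then H1 y (2 * t) else H2 y (2 * t - 1).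
exists H; split; last first.
- move=> y Qy; rewrite /H; split.
    by rewrite ifT ?mulr0 ?(e1 _ Qy).1 // invr_ge0.
  rewrite ifF; last by apply/negbTE; rewrite -ltNge invf_lt1 // ltr1n.
  by rewrite mulr1 (_ : 2 - 1 = 1 :> R) ?(e2 _ Qy).2 //; lra.
- move=> y t Qy t01; rewrite /H; case: ifP => [t2|/negbT]; last rewrite -ltNge => t2.
    by apply: Q1 => //; lra.
  by apply: Q2 => //; lra.
move=> V x t Qx sx t01 U hU.
pose S1 (s : R) := 2 * s; pose S2 (s : R) := 2 * s - 1.
have cS1 : S1 @ t --> 2 * t by apply: cvgM; [exact: cvg_cst|exact: cvg_id].
have cS2 : S2 @ t --> 2 * t - 1 by apply: cvgB; [exact: cS1|exact: cvg_cst].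
have n1 : t <= 2^-1 -> \forall y \near near_in V x & s \near nbhs t,
    face Q y -> 0 <= s <= 1 -> s <= 2^-1 -> U (H y s).
  move=> t2; have t2' : 0 <= 2 * t <= 1 by lra.
  have hU1 : nbhs (H1 x (2 * t)) U by move: hU; rewrite /H t2.
  have [[A B] /= [hA hB] hAB] := c1 V x (2 * t) Qx sx t2' U hU1.
  exists (A, S1 @^-1` B) => /=; first by split=> //; exact: cS1.
  move=> [y s] /= [Ay Bs] Qy s01 s2; rewrite /H s2.
  by apply: (hAB (y, 2 * s)) => //=; lra.
have n2 : 2^-1 <= t -> \forall y \near near_in V x & s \near nbhs t,
    face Q y -> 0 <= s <= 1 -> 2^-1 < s -> U (H y s).
  move=> t2; have t2' : 0 <= 2 * t - 1 <= 1 by lra.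
  have hU1 : nbhs (H2 x (2 * t - 1)) U.
    move: hU; rewrite /H; case: ifP => // t3.
    have et : t = 2^-1 by lra.
    by rewrite et mulfV // subrr (e1 _ Qx).2 (e2 _ Qx).1.
  have [[A B] /= [hA hB] hAB] := c2 V x (2 * t - 1) Qx sx t2' U hU1.
  exists (A, S2 @^-1` B) => /=; first by split=> //; exact: cS2.
  move=> [y s] /= [Ay Bs] Qy s01 s2; rewrite /H leNgt s2.
  by apply: (hAB (y, 2 * s - 1)) => //=; lra.
have [t2|t2|t2] := ltgtP t (2^-1).
- have hn := n1 (ltW t2).
  have ht : \forall y \near near_in V x & s \near nbhs t, s < 2^-1.
    exists (setT, [set s | s < 2^-1]) => /=; last by move=> [y s] [].
    by split; [exact: filterT|exact: lt_nbhsl].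
  by apply: filterS2 hn ht => -[y s] /= h1 h2 Qy s01; apply: h1 => //; exact: ltW.
- have hn := n2 (ltW t2).
  have ht : \forall y \near near_in V x & s \near nbhs t, 2^-1 < s.
    exists (setT, [set s | 2^-1 < s]) => /=; last by move=> [y s] [].
    by split; [exact: filterT|exact: lt_nbhsr].
  by apply: filterS2 hn ht => -[y s] /= h1 h2 Qy s01; exact: h1.
- apply: filterS2 (n1 _) (n2 _); rewrite ?t2 //.
  move=> -[y s] /= h1 h2 Qy s01.
  by have [s2|s2] := leP s (2^-1); [exact: h1|exact: h2].
Qed.

Section Stage.
Variables (h : nat -> P -> P) (l : P -> P).
Hypothesis hl : zigzag Q h l.

(** For odd [n] the smaller map is [h n.+1], and the prism is run backwards. *)
Definition step n y s : X :=
  if odd n then prism (h n.+1) (h n) y (1 - s) else prism (h n) (h n.+1) y s.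

Lemma step0 n y : step n y 0 = push (h n) y.
Proof.
by rewrite /step; case: odd; [rewrite subr0 prism_ge1|rewrite prism_le0].
Qed.

Lemma step1 n y : step n y 1 = push (h n.+1) y.
Proof.
by rewrite /step; case: odd; [rewrite subrr prism_le0|rewrite prism_ge1].
Qed.

Lemma face_step n y s : face Q y -> face Q (step n y s).
Proof.
have [mh alt _] := hl; move=> Qy.
rewrite /step; case: ifP => on.
  by apply: face_prism => // p Qp; have := alt n p Qp; rewrite on.
by apply: face_prism => // p Qp; have := alt n p Qp; rewrite on.
Qed.

Lemma step_cvg n (T : Type) (G : set_system T) (FG : Filter G) (Y : T -> X)
    (S : T -> R) V x s :
  face Q x -> (supp x `<=` V)%fset ->
  (\forall t \near G, (supp (Y t) `<=` V)%fset) ->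
  (\forall t \near G, face Q (Y t)) ->
  (forall p, (fun t => Y t p) @ G --> x p) -> S @ G --> s ->
  (fun t => step n (Y t) (S t)) @ G --> step n x s.
Proof.
have [mh alt _] := hl; move=> Qx sx sY QY cY cS.
rewrite /step; case: ifP => on.
  apply: (@prism_cvg R P Q (h n.+1) (h n) (mh _) (mh _) _ T G FG Y _ V x _) => //.
    by move=> p Qp; have := alt n p Qp; rewrite on.
  by apply: cvgB => //; exact: cvg_cst.
apply: (@prism_cvg R P Q (h n) (h n.+1) (mh _) (mh _) _ T G FG Y _ V x _) => //.
by move=> p Qp; have := alt n p Qp; rewrite on.
Qed.

(** A decreasing bijection from []0, 1]] to the nonnegative reals: the zigzag is at its index 0 at
    time 1, and reaches its limit at time 0. *)
Definition stage_time (t : R) : R := t^-1 - 1.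

Definition stage y (t : R) : X :=
  if t <= 0 then push l y
  else step (Num.truncn (stage_time t)) y
         (stage_time t - (Num.truncn (stage_time t))%:R).

Lemma face_eventually (V : {fset P}) : exists N, forall n, (N <= n)%N ->
  forall p, p \in V -> Q p -> h n p = l p.
Proof.
have [_ _ ev] := hl.
suff : forall s : seq P, exists N, forall n, (N <= n)%N ->
  forall p, p \in s -> Q p -> h n p = l p by apply.
elim=> [|p s [N hN]]; first by exists 0%N.
have [Qp|Qp] := pselect (Q p); last first.
  by exists N => n /hN hn q; rewrite inE => /predU1P[->//|]; exact: hn.
have [N' hN'] := ev p Qp; exists (maxn N N') => n.
rewrite geq_max => /andP[nN nN'] q; rewrite inE => /predU1P[->|]; last exact: hN.
by rewrite hN'.
Qed.

Lemma limit_monotone : monotone_on Q l.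
Proof.
have [mh _ ev] := hl; split=> [p Qp|p q Qp Qq pq].
  by have [N hN] := ev p Qp; rewrite -(hN N) //; exact: (mh N).1.
have [N hN] := ev p Qp; have [N' hN'] := ev q Qq.
rewrite -(hN (maxn N N')) ?leq_maxl // -(hN' (maxn N N')) ?leq_maxr //.
exact: (mh _).2.
Qed.

Lemma face_push y : face Q y -> face Q (push l y).
Proof.
by move=> Qy; apply: face_prism => //; try exact: limit_monotone; move=> p _; exact: plexx.
Qed.

(** On a finite [V] the zigzag is eventually stationary, so near time 0 the homotopy does not depend
    on time. Near a positive time it is a single step, or two consecutive steps that agree where
    [stage_time] is an integer. *)
Lemma stage_locally_continuous : locally_continuous Q stage.
Proof.
move=> V x t Qx sx t01 U hU.
pose G : set_system (X * R) :=
  within [set ys | face Q ys.1] (filter_prod (near_in V x) (nbhs t)).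
have FG : Filter G by apply: within_filter.
suff : \forall ys \near G, 0 <= ys.2 <= 1 -> U (stage ys.1 ys.2).
  rewrite /G near_withinE; apply: filterS => -[y s] /= h1 Qy s01; exact: h1.
have G2 (S : set X) (S' : set R) : near_in V x S -> nbhs t S' ->
    \forall ys \near G, S ys.1 /\ S' ys.2.
  move=> hS hS'; apply: (@cvg_within _ (filter_prod (near_in V x) (nbhs t))).
  by exists (S, S').
have GV : \forall ys \near G, (supp ys.1 `<=` V)%fset.
  apply: filterS (G2 _ setT (near_in_supp V x) _) => [ys []//|].
  exact: filterT.
have GQ : \forall ys \near G, face Q ys.1 by rewrite /G near_withinE; apply: nearW.
have Gc p : (fun ys : X * R => ys.1 p) @ G --> x p.
  move=> A hA; apply: filterS (G2 (fun y : X => A (y p)) setT _ _) => [ys []//||].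
    exact: cvg_coord hA.
  exact: filterT.
have Gt : (fun ys : X * R => ys.2) @ G --> t.
  move=> A hA; apply: filterS (G2 setT A _ hA) => [ys []//|]; exact: filterT.
have [t0|t0] := leP t 0.
  have [N hN] := face_eventually V.
  have cst : \forall ys \near G, stage ys.1 ys.2 = push l ys.1.
    (* A positive time below [N.+1%:R^-1] has [stage_time] at least [N]. *)
    have GN : \forall ys \near G, ys.2 < N.+1%:R^-1.
      apply: (Gt _ (lt_nbhsl _)); apply: le_lt_trans t0 _.
      by rewrite invr_gt0 ltr0n.
    near=> ys.
    have Qy : face Q ys.1 by near: ys.
    have sy : (supp ys.1 `<=` V)%fset by near: ys.
    have sN : ys.2 < N.+1%:R^-1 by near: ys.
    have loc n : (N <= n)%N -> {in supp ys.1, h n =1 l}.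
      move=> nN p ps; apply: hN => //; first exact: (fsubsetP sy).
      by apply: Qy; rewrite -in_supp.
    rewrite /stage; case: leP => // s0.
    have : (N <= Num.truncn (stage_time ys.2))%N.
      have tN : N%:R <= stage_time ys.2.
        rewrite /stage_time lerBrDr natr1 -[leLHS]invrK lef_pV2 ?ltW //.
        by rewrite posrE invr_gt0 ltr0n.
      by rewrite truncn_ge_nat // (le_trans _ tN).
    move: (Num.truncn _) (_ - _) => n u nN; rewrite /step; case: ifP => _.
      rewrite (prism_eq_on _ (loc n.+1 _) (loc n _)) ?prism_same //.
      exact: leqW.
    by rewrite (prism_eq_on _ (loc n _) (loc n.+1 _)) ?prism_same // leqW.
  have t0' : t = 0 by apply/eqP; rewrite eq_le t0; case/andP: t01.
  have lm := limit_monotone.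
  have : (fun ys : X * R => push l ys.1) @ G --> push l x.
    apply: (@prism_cvg R P Q l l lm lm _ _ G FG _ _ V x _) => //.
      by move=> p _; exact: plexx.
    exact: cvg_cst.
  have -> : push l x = stage x t by rewrite /stage t0.
  move=> /(_ U hU) h1; near=> ys => _.
  by rewrite (near cst ys) //; near: ys.
have ct : stage_time ys.2 @[ys --> G] --> stage_time t.
  apply: cvgB; last exact: cvg_cst.
  by apply: cvgV => //; rewrite gt_eqF.
have st0 : 0 <= stage_time t.
  by rewrite subr_ge0 invf_ge1 //; case/andP: t01.
pose n := Num.truncn (stage_time t).
have nt : n%:R <= stage_time t < n.+1%:R by exact: truncn_itv.
have stE : stage x t = step n x (stage_time t - n%:R) by rewrite /stage leNgt t0.
have pos : \forall ys \near G, 0 < ys.2 by apply: (Gt _ (lt_nbhsr _)).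
have c k : step k ys.1 (stage_time ys.2 - k%:R) @[ys --> G] -->
    step k x (stage_time t - k%:R).
  apply: (@step_cvg k _ G FG (fun ys : X * R => ys.1) _ V) => //.
  by apply: cvgB => //; exact: cvg_cst.
have up : \forall ys \near G, stage_time ys.2 < n.+1%:R.
  by apply: (ct _ (lt_nbhsl _)); case/andP: nt.
have in_n : \forall ys \near G, n%:R <= stage_time ys.2 -> U (stage ys.1 ys.2).
  have := c n; rewrite -stE => /(_ U hU) h1; near=> ys => nle.
  have e : Num.truncn (stage_time ys.2) = n.
    by apply: truncn_def; rewrite nle /=; near: ys.
  have s0 : 0 < ys.2 by near: ys.
  by rewrite /stage leNgt s0 /= e; near: ys.
have [nlt|nge] := ltP n%:R (stage_time t).
  have lo : \forall ys \near G, n%:R < stage_time ys.2.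
    by apply: (ct _ (lt_nbhsr _)).
  by apply: filterS2 in_n lo => ys h1 /ltW h2 _; exact: h1.
have en : stage_time t = n%:R by apply/eqP; rewrite eq_le nge; case/andP: nt.
(* At an integer [n] both steps [n.-1] and [n] come into play, except for [n = 0]: then [t = 1] is
   the end of the interval. *)
have [n0|n0] := posnP n.
  near=> ys => /andP[s0 s1]; have /(_ _) := near in_n ys; apply=> //.
  have s0' : 0 < ys.2 by near: ys.
  by rewrite n0 /stage_time subr_ge0 invf_ge1.
have in_n' : \forall ys \near G, stage_time ys.2 < n%:R -> U (stage ys.1 ys.2).
  have := c n.-1.
  have -> : step n.-1 x (stage_time t - n.-1%:R) = stage x t.
    rewrite stE en subrr step0 -[in n%:R](prednK n0) -natr1 addrAC subrr add0r.
    by rewrite step1 prednK.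
  move=> /(_ U hU) h1.
  have lo : \forall ys \near G, n.-1%:R < stage_time ys.2.
    by apply: (ct _ (lt_nbhsr _)); rewrite en ltr_nat prednK.
  near=> ys => nlt.
  have e : Num.truncn (stage_time ys.2) = n.-1.
    by apply: truncn_def; rewrite prednK // nlt andbT ltW //; near: ys.
  have s0 : 0 < ys.2 by near: ys.
  by rewrite /stage leNgt s0 /= e; near: ys.
apply: filterS2 in_n in_n' => ys h1 h2 _.
by have [|] := leP n%:R (stage_time ys.2); [exact: h1|exact: h2].
Unshelve. all: by end_near.
Qed.

Lemma stage_homotopic : homotopic (push l) (push (h 0%N)).
Proof.
exists stage; split; first exact: stage_locally_continuous.
- move=> y t Qy _; rewrite /stage; case: ifP => _; first exact: face_push.
  exact: face_step.
- move=> y Qy; rewrite /stage lexx ler10; split=> //.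
  by rewrite /stage_time invr1 subrr truncn0 subrr step0.
Qed.

End Stage.

Lemma contraction_contractible m h :
  contraction Q m h -> contractible R (face (R := R) Q).
Proof.
move=> [h0 hS [p0 Qp0 hp0]].
have /(_ m) [H [cH QH eH]] : forall k, homotopic id (push (h k 0%N)).
  elim=> [|k IH].
    have [H [c hQ e]] := stage_homotopic h0; exists H; split=> // y Qy.
    by have [e0 ->] := e y Qy; rewrite e0 push_id.
  exact: homotopic_trans IH (stage_homotopic (hS k)).
pose c0 : P -> P := fun=> p0.
have bV : barycentric (fun p => (p == p0)%:R : R).
  split.
  - by move=> p; rewrite ler0n.
  - move=> p q; rewrite !pnatr_eq0 !eqb0 !negbK => /eqP -> /eqP ->.
    by left; exact: plexx.
  - exists [fset p0]%fset; rewrite big_seq_fset1 eqxx; split=> // p.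
    by rewrite pnatr_eq0 eqb0 negbK inE.
exists (fun yt => H yt.1 yt.2), (Realization bV); split.
- by move=> p /=; rewrite pnatr_eq0 eqb0 negbK => /eqP ->.
- exact: locally_continuous_within.
- by move=> _ [[y t] [/= Qy]] h01 <-; apply: QH => //; move: h01; rewrite in_itv.
- move=> y Qy; have [-> ->] := eH y Qy; split=> //.
  have mono : monotone_on [set: P] c0 by split=> // p q _ _ _; exact: plexx.
  have cc : {in supp y, h m 0%N =1 c0}.
    by move=> p ps; rewrite hp0 //; apply: Qy; rewrite -in_supp.
  apply: coord_inj => q; rewrite /push (prism_eq_on _ cc cc).
  rewrite (@prismE _ _ setT) //; last by move=> p _; exact: plexx.
  rewrite /prism_coord /c0; transitivity (\sum_(p <- supp y) if p0 == q then y p else 0).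
    by apply: eq_bigr => p _; case: ifP; rewrite ?subrK ?addr0.
  rewrite /= eq_sym; case: eqP => _; last by rewrite big1.
  by rewrite coord_sum1.
Qed.

End Stages.

(** * Group actions on posets *)

Record gposet (G : groupType) := GPoset {
  gposet_poset :> poset ;
  gact : G -> gposet_poset -> gposet_poset ;
  gact1 : forall x, gact 1%g x = x ;
  gactM : forall g h x, gact (g * h)%g x = gact g (gact h x) ;
  gact_le : forall g x y, ple x y -> ple (gact g x) (gact g y) }.

Section GPosetTheory.
Variables (G : groupType) (P : gposet G).
Implicit Types (g : G) (p : P).

Lemma gactK g : cancel (@gact G P g) (gact g^-1%g).
Proof. by move=> p; rewrite -gactM mulVg gact1. Qed.

Lemma gactVK g : cancel (@gact G P g^-1%g) (gact g).
Proof. by move=> p; rewrite -gactM mulgV gact1. Qed.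

Lemma gact_inj g : injective (@gact G P g).
Proof. exact: can_inj (gactK g). Qed.

Lemma gact_le_iff g p q : ple (gact g p) (gact g q) <-> ple p q.
Proof.
by split; [move/(gact_le g^-1%g); rewrite !gactK|exact: gact_le].
Qed.

Definition pstab p : set G := [set g | gact g p = p].
Definition pfix (K : set G) : set P := [set p | forall g, K g -> gact g p = p].

Lemma gact_lt_iter g p n m : ple p (gact g p) -> gact g p <> p ->
  (m < n)%N -> ple (gact (g ^+ m)%g p) (gact (g ^+ n)%g p) /\
               gact (g ^+ m)%g p <> gact (g ^+ n)%g p.
Proof.
move=> le ne; elim: n => // n IH; rewrite ltnS leq_eqVlt.
have st k : ple (gact (g ^+ k)%g p) (gact (g ^+ k.+1)%g p).
  by rewrite expgSr gactM; exact: gact_le.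
have nst k : gact (g ^+ k)%g p <> gact (g ^+ k.+1)%g p.
  by rewrite expgSr gactM => /gact_inj /esym.
move=> /predU1P[->|/IH[h1 h2]]; first by split.
split; first exact: ple_trans (st n).
by move=> e; apply: h2; apply: ple_anti => //; rewrite e.
Qed.

(** If [p] were strictly below its translate, the [B.+1] points [g ^+ i] applied to [p], for
    [i <= B], would be distinct and would all lie in the down-set of the last one. *)
Lemma gact_comparable B g p : small_down_sets P B ->
  ple p (gact g p) \/ ple (gact g p) p -> gact g p = p.
Proof.
move=> bP; wlog le : g / ple p (gact g p).
  move=> wl [le|le]; first by apply: wl => //; left.
  have le' : ple p (gact g^-1%g p) by rewrite -(gact_le_iff g) gactVK.
  have e := wl g^-1%g le' (or_introl le').
  by rewrite -{1}e gactVK.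
move=> _; apply: contrapT => ne.
have [s sB sP] := bP (gact (g ^+ B)%g p).
have : uniq [seq gact (g ^+ i)%g p | i <- iota 0 B.+1].
  rewrite map_inj_in_uniq ?iota_uniq // => i j _ _ e; apply/eqP.
  have [ij|ji|//] := ltngtP i j; first by have [_] := gact_lt_iter le ne ij.
  by have [_ h] := gact_lt_iter le ne ji; case: h.
move=> us; have h := @uniq_leq_size _ _ s us; have : (B.+1 <= B)%N; last by rewrite ltnn.
apply: leq_trans sB; rewrite -(size_iota 0 B.+1) -(size_map (fun i => gact (g ^+ i)%g p)).
apply: h => q /mapP[i]; rewrite mem_iota => /andP[_ iB] ->; apply: sP.
move: iB; rewrite add0n ltnS leq_eqVlt => /predU1P[->|iB]; first exact: plexx.
by have [] := gact_lt_iter le ne iB.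
Qed.

Variable R : realType.
Local Notation X := (realization R P).
Implicit Types x : X.

Lemma ract_barycentric g x : barycentric (fun p => x (gact g^-1%g p)).
Proof.
split.
- by move=> p; exact: coord_ge0.
- move=> p q hp hq.
  have := @coord_comparable R P x (gact g^-1%g p) (gact g^-1%g q).
  by rewrite !in_supp => /(_ hp hq) [h|h]; [left|right]; apply/(gact_le_iff g^-1%g).
- exists [fset gact g p | p in supp x]%fset; split.
    move=> p hp; apply/imfsetP; exists (gact g^-1%g p); last by rewrite gactVK.
    by rewrite /= in_supp.
  rewrite big_imfset /=; last by move=> p q _ _; exact: gact_inj.
  rewrite -[RHS](coord_sum1 (fsubset_refl (supp x))).
  by apply: eq_bigr => p _; rewrite gactK.
Qed.

Definition ract g x : X := Realization (ract_barycentric g x).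

Lemma ract_supp g x : supp (ract g x) = [fset gact g p | p in supp x]%fset.
Proof.
apply/fsetP => p; rewrite in_supp /=; apply/idP/imfsetP => [hp|[q /= qs ->]].
  by exists (gact g^-1%g p); rewrite /= ?in_supp // gactVK.
by rewrite gactK -in_supp.
Qed.

Lemma ract_continuous g : continuous (ract g).
Proof.
apply/continuousP => U oU; rewrite realization_openE => V x Ux sV.
pose V' := [fset gact g p | p in V]%fset.
have sub (y : X) : (supp y `<=` V)%fset -> (supp (ract g y) `<=` V')%fset.
  move=> /fsubsetP sy; rewrite ract_supp; apply/fsubsetP => _ /imfsetP[p /= /sy pV ->].
  by rewrite in_imfset.
have [e /= e0 he] := oU V' _ Ux (sub _ sV).
exists e => // y [sy hy] /=; apply: he; split; first exact: sub.
by move=> _ /imfsetP[p /= pV ->]; rewrite /= gactK; exact: hy.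
Qed.

Lemma ract_action : continuous_action ract.
Proof.
split; last exact: ract_continuous.
- by move=> x; apply: coord_inj => p /=; rewrite invg1 gact1.
- by move=> g h x; apply: coord_inj => p /=; rewrite invgM gactM.
Qed.

Lemma translate_neq0 g (s : simplex P) : [fset gact g p | p in verts s]%fset != fset0.
Proof.
have /fset0Pn[p ps] := verts_neq0 s.
by apply/fset0Pn; exists (gact g p); rewrite in_imfset.
Qed.

Lemma translate_chain g (s : simplex P) : chain [fset gact g p | p in verts s]%fset.
Proof.
move=> _ _ /imfsetP[p /= ps ->] /imfsetP[q /= qs ->].
by have [h|h] := verts_chain ps qs; [left|right]; exact: gact_le.
Qed.

Definition translate g (s : simplex P) : simplex P :=
  Simplex (translate_neq0 g s) (@translate_chain g s).

Lemma ract_cell g (s : cw_index (realization_cw R P)) :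
  ract g @` cw_cell s = @cw_cell _ _ (realization_cw R P) (translate g s).
Proof.
rewrite !realization_cell; apply/seteqP; split=> [_ [x /= xs <-]|x /= xs].
  by rewrite /= ract_supp xs.
have [a1 aM _] := ract_action.
exists (ract g^-1%g x) => /=; last by rewrite -aM mulgV a1.
rewrite ract_supp xs; apply/fsetP => p; apply/imfsetP/idP => /= [[_ /imfsetP[q /= qs ->] ->]|ps].
  by rewrite gactK.
by exists (gact g p); rewrite ?gactK // in_imfset.
Qed.

Variable B : nat.
Hypothesis bP : small_down_sets P B.

(** Each element of the chain is comparable with its translate. This yields admissibility without
    any subdivision. *)
Lemma chain_setwise_fixed g (V : {fset P}) : chain V ->
  [fset gact g p | p in V]%fset = V -> forall p, p \in V -> gact g p = p.
Proof.
move=> cV e p pV; apply: (gact_comparable bP); apply: cV => //.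
by rewrite -e in_imfset.
Qed.

Lemma ract_fixed g x : ract g x = x <-> forall p, p \in supp x -> gact g p = p.
Proof.
split=> [e|h].
  by apply: chain_setwise_fixed; [exact: supp_chain|rewrite -ract_supp e].
apply: coord_inj => p /=.
have [ps|ps] := boolP (p \in supp x).
  by rewrite -{1}(h p ps) gactK.
have [ps'|ps'] := boolP (gact g^-1%g p \in supp x).
  by move: ps; rewrite -(gactVK g p) h // ps'.
by move: ps ps'; rewrite !in_supp !negbK => /eqP -> /eqP ->.
Qed.

Lemma ract_fixed_points (K : set G) : fixed_points ract K = face (pfix K).
Proof.
apply/seteqP; split=> x h.
  by move=> p hp g Kg; apply: ((ract_fixed g x).1 (h g Kg)); rewrite in_supp.
by move=> g Kg; apply/ract_fixed => p; rewrite in_supp => /h; apply.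
Qed.

Lemma ract_admissible : admissible_action (realization_cw R P) ract.
Proof.
split; first split; first exact: ract_action.
- move=> g i; exists (translate g i); last exact: ract_cell.
  rewrite /= /simplex_dim /= card_in_imfset //= => p q _ _; exact: gact_inj.
- move=> g s; rewrite ract_cell !realization_cell => e x /= xs.
  apply/ract_fixed; rewrite xs; apply: chain_setwise_fixed; first exact: verts_chain.
  by have : [set x | supp x = verts s] x by []; rewrite -e /= => <-.
Qed.

Theorem poset_acts_with (F : groupType -> Prop) (S : set G -> Prop) :
  (forall V : {fset P}, chain V -> V != fset0 ->
     S [set g | forall p, p \in V -> gact g p = p]) ->
  (forall K, subgroup_in F K -> exists m h, contraction (pfix K) m h) ->
  acts_with R F S.
Proof.
move=> hS hF; exists X, (realization_cw R P), ract; split.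
- exact: realization_finite_dimensional bP.
- exact: ract_admissible.
- move=> x.
  have -> : stabiliser ract x = [set g | forall p, p \in supp x -> gact g p = p].
    by apply/seteqP; split=> g; rewrite /stabiliser /= ract_fixed.
  by apply: hS; [exact: supp_chain|exact: supp_nonempty].
- by move=> K /hF[m [h]]; rewrite ract_fixed_points; exact: contraction_contractible.
Qed.

End GPosetTheory.

Close Scope ring_scope.

(** * Graphs, joins and sections *)

Definition contractible_poset (P : poset) (Q : set P) (m : nat) : Prop :=
  exists h, contraction Q m h.

(** * Contraction of trees *)

Section RootedTree.
Variables (P : poset) (Q : set P) (root : P) (par : P -> P) (d : P -> nat).
Hypotheses (Qroot : Q root) (droot : forall p, Q p -> d p = 0 -> p = root).
Hypothesis Qpar : forall p, Q p -> 0 < d p -> Q (par p).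
Hypothesis dpar : forall p, Q p -> 0 < d p -> d (par p) = (d p).-1.
Hypothesis ple_par : forall p, Q p -> 0 < d p ->
  if odd (d p) then ple (par p) p else ple p (par p).
Hypothesis ple_edge : forall p q, Q p -> Q q -> ple p q ->
  [\/ p = q, 0 < d p /\ q = par p | 0 < d q /\ p = par q].

Let r n p := iter (d p - n) par p.

Let Qiter p k : Q p -> k <= d p -> Q (iter k par p) /\ d (iter k par p) = d p - k.
Proof.
move=> Qp; elim: k => [|k IH] kd; first by rewrite subn0.
have [Qk dk] := IH (ltnW kd).
by rewrite iterS dpar ?dk ?subn_gt0 // subnS; split=> //; apply: Qpar; rewrite // dk subn_gt0.
Qed.

Let rQ n p : Q p -> Q (r n p).
Proof. by move=> Qp; have [] := Qiter Qp (leq_subr n (d p)). Qed.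

Let r_par n p : Q p -> n < d p -> r n (par p) = r n p.
Proof.
move=> Qp np; rewrite /r dpar ?(leq_ltn_trans _ np) //.
have -> : d p - n = ((d p).-1 - n).+1 by lia.
by rewrite iterSr.
Qed.

Let r_id n p : d p <= n -> r n p = p.
Proof. by rewrite -subn_eq0 /r => /eqP ->. Qed.

Let r_mono n : monotone_on Q (r n).
Proof.
split; first by move=> p; exact: rQ.
have two p q : Q p -> 0 < d p -> q = par p -> ple p q \/ ple q p ->
    (ple p q -> ple (r n p) (r n q)) /\ (ple q p -> ple (r n q) (r n p)).
  move=> Qp dp -> _; have [np|pn] := ltnP n (d p).
    by rewrite r_par //; split=> _; exact: plexx.
  by rewrite !r_id // dpar // (leq_trans (leq_pred _)).
move=> p q Qp Qq pq; have [->|[dp e]|[dq e]] := ple_edge Qp Qq pq.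
- exact: plexx.
- by have [h _] := two _ _ Qp dp e (or_introl pq); exact: h.
- by have [_ h] := two _ _ Qq dq e (or_intror pq); exact: h.
Qed.

(** The map [r n] retracts the tree onto the ball of radius [n] about the root. From [r n.+1] to
    [r n] a point moves by at most one step, between a vertex and an edge, in a direction given by
    the parity of [n]: these retractions form a zigzag with limit the identity. *)
Lemma rooted_tree_contractible : contractible_poset Q 0.
Proof.
exists (fun i => if i is 0 then r else fun _ _ => root).
have r0 p : Q p -> r 0 p = root.
  move=> Qp; have [Qi di] := Qiter Qp (leq_subr 0 (d p)).
  by apply: droot Qi _; rewrite di; lia.
split.
- split=> [n|n p Qp|p Qp]; first exact: r_mono.
    have [dn|nd] := leqP (d p) n.
      by rewrite !r_id ?leqW //; case: odd; exact: plexx.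
    have [Qi di] : Q (r n.+1 p) /\ d (r n.+1 p) = n.+1.
      have [Qi di] := Qiter Qp (leq_subr n.+1 (d p)).
      by split=> //; rewrite /r di; lia.
    have -> : r n p = par (r n.+1 p).
      by rewrite /r; have -> : d p - n = (d p - n.+1).+1 by lia.
    by have := ple_par Qi; rewrite di /= => /(_ isT); case: odd.
  by exists (d p) => n; exact: r_id.
- case=> [|i]; split=> //; try by move=> n; split=> // p q _ _ _; exact: plexx.
  + by move=> n p _; case: odd; exact: plexx.
  + by move=> p Qp; exists 0 => n _; rewrite r0.
  + by move=> n p _; case: odd; exact: plexx.
  + by move=> p Qp; exists 0.
- by exists root.
Qed.

End RootedTree.

(* The graph of a function [next], as the poset of its vertices [(t, false)]
   and of its edges [(t, true)] joining [t] to [next t]. *)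
Section FunctionalGraph.
Variables (T : choiceType) (next : T -> T).

Definition fgraph_le (a b : T * bool) : Prop :=
  a = b \/ [/\ ~~ a.2, b.2 & a.1 = b.1 \/ a.1 = next b.1].

Lemma fgraph_lexx a : fgraph_le a a. Proof. by left. Qed.

Lemma fgraph_le_anti a b : fgraph_le a b -> fgraph_le b a -> a = b.
Proof. by move=> [//|[_ b2 _]] [//|[nb2 _ _]]; rewrite b2 in nb2. Qed.

Lemma fgraph_le_trans b a c : fgraph_le a b -> fgraph_le b c -> fgraph_le a c.
Proof.
move=> [->//|[a2 b2 h]] [<-|[nb2 _ _]]; first by right.
by rewrite b2 in nb2.
Qed.

Definition fgraph : poset := Poset fgraph_lexx fgraph_le_anti fgraph_le_trans.

Lemma fgraph_small : small_down_sets fgraph 3.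
Proof.
move=> [t b]; exists [:: (t, b); (t, false); (next t, false)] => //.
move=> [u c] [->|[/=]]; first by rewrite inE eqxx.
by case: c => // _ _ [|] ->; rewrite !inE eqxx ?orbT.
Qed.

Definition fgraph_set (F : set T) : set fgraph := [set a | F a.1].

Variables (F : set T) (root : T) (lev : T -> int).
Hypotheses (Froot : F root) (Fnext : forall t, F t -> F (next t)).
Hypothesis lev_next : forall t, lev (next t) = (lev t + 1)%R.
Hypothesis connected : forall t, F t -> exists i j, iter i next t = iter j next root.

Let ray t := exists j, t = iter j next root.

Let lev_iter t i : lev (iter i next t) = (lev t + i%:Z)%R.
Proof.
elim: i => [|i IH]; first by rewrite addr0.
by rewrite iterS lev_next IH -addrA -PoszD addn1.
Qed.

Let climbs t := exists i, `[< ray (iter i next t) >].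

Let climb t : nat :=
  if pselect (climbs t) is left h then ex_minn h else 0.

Let Fclimbs t : F t -> climbs t.
Proof. by move=> /connected[i [j e]]; exists i; apply/asboolP; exists j. Qed.

Let height t : nat := `|lev (iter (climb t) next t) - lev root|%N.

Let climb_ray t : ray t -> climb t = 0.
Proof.
move=> rt; rewrite /climb; case: pselect => // h.
case: ex_minnP => m _ /(_ 0); rewrite leqn0 => hm; apply/eqP; apply: hm.
exact/asboolP.
Qed.

Let climb_off t : F t -> ~ ray t -> climb t = (climb (next t)).+1.
Proof.
move=> Ft rt; rewrite /climb; case: pselect => [h|]; last by have := Fclimbs Ft.
case: pselect => [h'|]; last by have := Fclimbs (Fnext Ft).
case: ex_minnP => -[|m] /asboolP hm minm; first by [].
case: ex_minnP => n /asboolP hn minn; congr S; apply/eqP; rewrite eqn_leq.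
rewrite -ltnS minm; last by apply/asboolP; rewrite iterSr.
by apply: minn; apply/asboolP; rewrite -iterSr.
Qed.

Let ray_height j : height (iter j next root) = j.
Proof.
rewrite /height climb_ray /=; last by exists j.
by rewrite lev_iter [(lev root + _)%R]addrC addrK.
Qed.

Let height_off t : F t -> ~ ray t -> height (next t) = height t.
Proof. by move=> Ft rt; rewrite /height (climb_off Ft rt) iterSr. Qed.

(** Distances are doubled to make room for the edges. On the ray of the root, [next t] is farther
    from the root than [t], and the edge has distance [n.+1]; off the ray [next t] is closer, and it
    has distance [n.-1]. *)
Let d (a : fgraph) : nat :=
  let: (t, b) := a in
  let n := (climb t + height t).*2 in
  if b then (if `[< ray t >] then n.+1 else n.-1) else n.

Let par (a : fgraph) : fgraph :=
  let: (t, b) := a in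
  if b then (if `[< ray t >] then (t, false) else (next t, false))
  else if `[< ray t >] then (iter (height t).-1 next root, true) else (t, true).

Let d_ray j b : d (iter j next root, b) = j.*2 + b.
Proof.
have rj : ray (iter j next root) by exists j.
rewrite /d climb_ray // ray_height add0n; case: b; rewrite ?addn0 ?addn1 //.
by rewrite asboolT.
Qed.

Let par_ray j b : par (iter j next root, b) =
  if b then (iter j next root, false) else (iter j.-1 next root, true).
Proof.
have rj : ray (iter j next root) by exists j.
by rewrite /par (asboolT rj) ray_height.
Qed.

Let par_off t b : ~ ray t -> par (t, b) = if b then (next t, false) else (t, true).
Proof. by move=> rt; rewrite /par (asboolF rt). Qed.

Let d_off t b : F t -> ~ ray t ->
  d (t, b) = (climb (next t) + height (next t)).*2.+2 - b.
Proof.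
move=> Ft rt; rewrite /d (climb_off Ft rt) height_off // addSn doubleS.
by case: b; rewrite ?subn0 // asboolF // subn1.
Qed.

Let d_next t : d (next t, false) = (climb (next t) + height (next t)).*2.
Proof. by []. Qed.

(** The graph is a tree: [lev] excludes cycles, and forward orbits meet that of the root. The path
    from the root to [t] follows the forward ray of the root for [height t] edges, then goes back
    [climb t] edges to [t]. *)
Lemma fgraph_contractible : contractible_poset (fgraph_set F) 0.
Proof.
apply: (@rooted_tree_contractible fgraph _ (root, false) par d) => //.
- move=> [t b] Ft dt; have {}Ft : F t by []; have [[j e]|rt] := pselect (ray t); last first.
    by have := d_off b Ft rt; rewrite dt; case: (b); lia.
  by subst t; move: dt; rewrite d_ray; case: b; case: j {Ft} => //=; lia.
- move=> [t b] Ft _; have {}Ft : F t by []; rewrite /par /fgraph_set /=.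
  case: b; case: asboolP => rt //=; first exact: Fnext.
  by elim: (height t).-1 => //= k; exact: Fnext.
- move=> [t b] Ft; have {}Ft : F t by []; have [[j ->]|rt] := pselect (ray t).
    rewrite d_ray par_ray; case: b => dt.
      by rewrite (d_ray j false); lia.
    by rewrite (d_ray _ true); lia.
  rewrite (d_off b Ft rt) (par_off _ rt) => _; case: b.
    by rewrite d_next subn1.
  by rewrite (d_off true Ft rt) subn0 subn1.
- move=> [t b] Ft; have {}Ft : F t by []; have [[j ->]|rt] := pselect (ray t).
    rewrite d_ray par_ray; case: b => dt.
      by rewrite oddD odd_double /=; right; split=> //=; left.
    rewrite oddD odd_double /=; right; split=> //=; right.
    by case: j dt => // j _; rewrite -iterS.
  rewrite (d_off b Ft rt) (par_off _ rt) => _; case: b.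
    by rewrite subn1 /= odd_double /=; right; split=> //=; right.
  by rewrite subn0 /= negbK odd_double /=; right; split=> //=; left.
- move=> [t b] [u c] Ft Fu [->|[nb uc h]]; first by constructor 1.
  have {}Ft : F t by []; have {}Fu : F u by [].
  have {}h : t = u \/ t = next u by [].
  have {}nb : ~~ b by []; have {}uc : is_true c by [].
  move: b c nb uc => [//|] [|//] _ _.
  have [[j e]|ru] := pselect (ray u).
    subst u; case: h => h; subst t.
      by apply: Or33; rewrite d_ray addn1 par_ray.
    by apply: Or32; rewrite -(iterS j next root) d_ray addn0 par_ray.
  case: h => ->.
    by apply: Or32; rewrite d_off // subn0 par_off.
  by apply: Or33; rewrite d_off // subn1 par_off.
Qed.

End FunctionalGraph.

Section FunctionalGraphAction.
Variables (G : groupType) (T : choiceType) (next : T -> T) (a : G -> T -> T).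
Hypotheses (a1 : forall t, a 1%g t = t).
Hypothesis aM : forall g h t, a (g * h)%g t = a g (a h t).
Hypothesis anext : forall g t, a g (next t) = next (a g t).

Definition fgraph_act (g : G) (x : fgraph next) : fgraph next := (a g x.1, x.2).

Lemma fgraph_act1 x : fgraph_act 1%g x = x.
Proof. by case: x => t b; rewrite /fgraph_act a1. Qed.

Lemma fgraph_actM g h x : fgraph_act (g * h)%g x = fgraph_act g (fgraph_act h x).
Proof. by rewrite /fgraph_act aM. Qed.

Lemma fgraph_act_le g x y : ple x y -> ple (fgraph_act g x) (fgraph_act g y).
Proof.
case=> [->|[x2 y2 h]]; [by left|right; split=> //=].
by case: h => ->; [left|right; rewrite anext].
Qed.

Definition fgraph_gposet : gposet G := GPoset fgraph_act1 fgraph_actM fgraph_act_le.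

Lemma fgraph_pfix (K : set G) :
  @pfix G fgraph_gposet K = fgraph_set (next := next) [set t | forall g, K g -> a g t = t].
Proof.
apply/seteqP; split=> -[t b] h g /h //=; first by case.
by rewrite /fgraph_act /= => ->.
Qed.

Lemma fgraph_pstab x : @pstab G fgraph_gposet x = [set g | a g x.1 = x.1].
Proof.
case: x => t b; apply/seteqP; split=> g; rewrite /pstab /= /fgraph_act /=; first by case.
by move=> ->.
Qed.

End FunctionalGraphAction.

(** * Joins *)

Definition ole (P : poset) (a b : option P) : Prop :=
  match a, b with
  | None, _ => True
  | Some x, Some y => ple x y
  | Some _, None => False
  end.

Section OptionOrder.
Variable P : poset.
Implicit Types a b c : option P.

Lemma olexx a : ole a a. Proof. by case: a => //= x; exact: plexx. Qed.

Lemma ole_anti a b : ole a b -> ole b a -> a = b.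
Proof. by case: a b => [x|] [y|] //= xy yx; congr Some; exact: ple_anti. Qed.

Lemma ole_trans b a c : ole a b -> ole b c -> ole a c.
Proof. by case: a b c => [x|] [y|] [z|] //=; exact: ple_trans. Qed.

Lemma ole_omap (f : P -> P) a b :
  (forall x y, ple x y -> ple (f x) (f y)) -> ole a b -> ole (omap f a) (omap f b).
Proof. by case: a b => [x|] [y|] //= h; exact: h. Qed.

Lemma small_option B a : small_down_sets P B ->
  exists2 s : seq (option P), size s <= B.+1 & forall b, ole b a -> b \in s.
Proof.
move=> bP; case: a => [x|]; last by exists [:: None] => // -[].
have [s sB sP] := bP x; exists (None :: map Some s); first by rewrite /= size_map ltnS.
case=> [y /= /sP ys|]; last by rewrite inE eqxx.
by rewrite inE /=; apply: map_f.
Qed.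

End OptionOrder.

(* The order complex of [join Y W] is the join of those of [Y] and [W]. *)
Section Join.
Variables Y W : poset.

(** The product of [Y] and [W], each with a bottom element [None] adjoined, minus the pair of the
    two bottoms. *)
Definition join_type : Type := (Y + W + Y * W)%type.
HB.instance Definition _ := Choice.on join_type.

Definition join_left (j : join_type) : option Y :=
  match j with inl (inl y) => Some y | inl (inr _) => None | inr (y, _) => Some y end.
Definition join_right (j : join_type) : option W :=
  match j with inl (inl _) => None | inl (inr w) => Some w | inr (_, w) => Some w end.

Definition join_mk (y : option Y) (w : option W) : option join_type :=
  match y, w with
  | Some y, Some w => Some (inr (y, w))
  | Some y, None => Some (inl (inl y))
  | None, Some w => Some (inl (inr w))
  | None, None => None
  end.

Lemma join_mkK j : join_mk (join_left j) (join_right j) = Some j.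
Proof. by case: j => [[y|w]|[y w]]. Qed.

Definition join_le (i j : join_type) : Prop :=
  ole (join_left i) (join_left j) /\ ole (join_right i) (join_right j).

Lemma join_lexx j : join_le j j. Proof. by split; exact: olexx. Qed.

Lemma join_le_anti i j : join_le i j -> join_le j i -> i = j.
Proof.
move=> [h1 h2] [h3 h4]; apply: Some_inj.
by rewrite -(join_mkK i) -(join_mkK j) (ole_anti h1 h3) (ole_anti h2 h4).
Qed.

Lemma join_le_trans j i k : join_le i j -> join_le j k -> join_le i k.
Proof. by move=> [h1 h2] [h3 h4]; split; [exact: ole_trans h3|exact: ole_trans h4]. Qed.

Definition join : poset := Poset join_lexx join_le_anti join_le_trans.

Lemma join_small B1 B2 : small_down_sets Y B1 -> small_down_sets W B2 ->
  small_down_sets join (B1.+1 * B2.+1).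
Proof.
move=> b1 b2 j.
have [s1 s1B s1P] := small_option (join_left j) b1.
have [s2 s2B s2P] := small_option (join_right j) b2.
exists (pmap (fun yw => join_mk yw.1 yw.2) [seq (y, w) | y <- s1, w <- s2]).
  rewrite size_pmap (leq_trans (count_size _ _)) // size_allpairs.
  exact: leq_mul.
move=> i [h1 h2]; rewrite mem_pmap; apply/mapP.
exists (join_left i, join_right i); last by rewrite /= join_mkK.
by apply/allpairsP; exists (join_left i, join_right i); split=> //; [exact: s1P|exact: s2P].
Qed.

Definition join_map (f : Y -> Y) (g : W -> W) (j : join) : join :=
  match j with
  | inl (inl y) => inl (inl (f y))
  | inl (inr w) => inl (inr (g w))
  | inr (y, w) => inr (f y, g w)
  end.

Lemma join_left_map f g j : join_left (join_map f g j) = omap f (join_left j).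
Proof. by case: j => [[y|w]|[y w]]. Qed.

Lemma join_right_map f g j : join_right (join_map f g j) = omap g (join_right j).
Proof. by case: j => [[y|w]|[y w]]. Qed.

Definition oset (T : Type) (Q : set T) : set (option T) :=
  [set a | if a is Some x then Q x else True].

Definition join_set (Q1 : set Y) (Q2 : set W) : set join :=
  [set j | oset Q1 (join_left j) /\ oset Q2 (join_right j)].

Definition join_withl (y : Y) (j : join) : join :=
  match j with
  | inl (inl _) => inl (inl y)
  | inl (inr w) => inr (y, w)
  | inr (_, w) => inr (y, w)
  end.

(** The contraction of the left factor, extended by the identity on the right one, ends at
    [join_map (fun=> y0) id]. The extra stage cones off at [y0]: this map is below [join_withl y0],
    which is above the constant [jl y0]. So the right factor may be arbitrary, even empty. *)
Lemma contractible_joinl Q1 Q2 m :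
  contractible_poset Q1 m -> contractible_poset (join_set Q1 Q2) m.+1.
Proof.
move=> [h [h0 hS [y0 Qy0 hm]]].
pose jl (y : Y) : join := inl (inl y).
pose hj i n (j : join) : join :=
  if i <= m then join_map (h i n) id j
  else if i == m.+1 then
    match n with 0 => jl y0 | 1 => join_withl y0 j | _ => join_map (fun=> y0) id j end
  else jl y0.
exists hj.
have mono_map f : monotone_on Q1 f -> monotone_on (join_set Q1 Q2) (join_map f id).
  move=> [fQ fm]; split.
    by move=> [[y|w]|[y w]] [] /= Qy Qw; split=> //=; exact: fQ.
  move=> [[y|w]|[y w]] [[y'|w']|[y' w']] [] /= Qy Qw [] /= Qy' Qw' [] /= h1 h2 //;
    by split=> //=; exact: fm.
have mono_c (f : Y -> Y) : (forall y, f y = y0) -> monotone_on Q1 f.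
  by move=> fc; split=> [y|y y'] *; rewrite !fc //; exact: plexx.
have stage i l : i <= m -> zigzag Q1 (h i) l -> zigzag (join_set Q1 Q2) (hj i) (join_map l id).
  move=> im [h1 h2 h3]; rewrite /hj im; split.
  - by move=> n; exact: mono_map.
  - move=> n [[y|w]|[y w]] [] /= Qy Qw.
    + by have := h2 n y Qy; case: odd => ?; split.
    + by case: odd; exact: join_lexx.
    + by have := h2 n y Qy; case: odd => ?; split=> //=; exact: plexx.
  - move=> [[y|w]|[y w]] [] /= Qy Qw; last first.
    + by have [N hN] := h3 y Qy; exists N => n /hN ->.
    + by exists 0.
    + by have [N hN] := h3 y Qy; exists N => n /hN ->.
have const (f : nat -> join -> join) l : (forall n j, f n j = jl y0) ->
    (forall j, join_set Q1 Q2 j -> l j = jl y0) -> zigzag (join_set Q1 Q2) f l.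
  move=> fc lc; split.
  - by move=> n; split=> [j|i j] *; rewrite !fc //; exact: join_lexx.
  - by move=> n j _; rewrite !fc; case: odd; exact: join_lexx.
  - by move=> j Qj; exists 0 => n _; rewrite fc lc.
split.
- have := stage 0 id (leq0n m) h0.
  by rewrite (_ : join_map id id = id) //; apply/funext => -[[y|w]|[y w]].
- move=> i; have [im|] := ltnP i m.
    by have := stage i.+1 _ im (hS i); rewrite {3}/hj ltnW.
  rewrite leq_eqVlt => /predU1P[<-|mi]; last first.
    have n1 : (i <= m) = false by apply/negbTE; rewrite -ltnNge.
    have n2 : (i.+1 <= m) = false by apply/negbTE; rewrite -ltnNge ltnW.
    apply: const => [n j|j _].
      by rewrite /hj n2 eqSS gtn_eqF.
    by rewrite /hj n1; case: eqP.
  rewrite {1}/hj ltnn eqxx; split.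
  - case=> [|[|n]].
    + by split=> *; [split|exact: join_lexx].
    + split.
        by move=> [[y|w]|[y w]] [] /= Qy Qw.
      move=> [[y|w]|[y w]] [[y'|w']|[y' w']] [] /= _ _ [] /= _ _ [] /= h1 h2 //;
      by split=> //=; exact: plexx.
    + by apply: mono_map; exact: mono_c.
  - case=> [|[|n]] [[y|w]|[y w]] [] /= Qy Qw; try (by split=> //=; exact: plexx);
      by case: odd; split=> //=; exact: plexx.
  - move=> [[y|w]|[y w]] [] /= Qy Qw; exists 2 => -[|[|n]] // _;
    by rewrite /hj leqnn /= ?hm.
- exists (jl y0) => //.
  by move=> j _; rewrite /hj ltnn eqxx.
Qed.

End Join.

Lemma contractible_iso (P P' : poset) (Q : set P) (Q' : set P')
    (f : P -> P') (g : P' -> P) m :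
  (forall p, Q p -> Q' (f p)) -> (forall p', Q' p' -> Q (g p')) ->
  (forall p', Q' p' -> f (g p') = p') -> (forall p, Q p -> g (f p) = p) ->
  (forall p q, Q p -> Q q -> ple p q -> ple (f p) (f q)) ->
  (forall p q, Q' p -> Q' q -> ple p q -> ple (g p) (g q)) ->
  contractible_poset Q m -> contractible_poset Q' m.
Proof.
move=> fQ gQ fg gf fm gm [h [h0 hS [p0 Qp0 hm]]].
have tr k l : zigzag Q k l -> zigzag Q' (fun n => f \o k n \o g) (f \o l \o g).
  move=> [h1 h2 h3]; split.
  - move=> n; split=> [p Qp|p q Qp Qq pq] /=.
      by apply: fQ; apply: (h1 n).1; exact: gQ.
    apply: fm; try by apply: (h1 n).1; exact: gQ.
    apply: (h1 n).2; try exact: gQ.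
    exact: gm.
  - move=> n p Qp; have := h2 n _ (gQ _ Qp).
    by case: odd => /= h'; apply: fm => //; apply: (h1 _).1; exact: gQ.
  - by move=> p Qp; have [N hN] := h3 _ (gQ _ Qp); exists N => n /hN /= ->.
exists (fun i n => f \o h i n \o g); split.
- have [h1 h2 h3] := tr _ _ h0; split=> // p Qp.
  by have [N hN] := h3 p Qp; exists N => n /hN -> /=; exact: fg.
- by move=> i; exact: tr.
- exists (f p0); first exact: fQ.
  by move=> p Qp /=; rewrite hm //; exact: gQ.
Qed.

Lemma contractible_joinr (Y W : poset) (Q1 : set Y) (Q2 : set W) m :
  contractible_poset Q2 m -> contractible_poset (join_set Q1 Q2) m.+1.
Proof.
move=> /(contractible_joinl Q1).
pose sw (A B : poset) (j : join A B) : join B A :=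
  match j with
  | inl (inl y) => inl (inr y)
  | inl (inr w) => inl (inl w)
  | inr (y, w) => inr (w, y)
  end.
apply: (@contractible_iso _ _ _ _ (sw W Y) (sw Y W)).
- by move=> [[?|?]|[? ?]] [].
- by move=> [[?|?]|[? ?]] [].
- by move=> [[?|?]|[? ?]].
- by move=> [[?|?]|[? ?]].
- by move=> [[?|?]|[? ?]] [[?|?]|[? ?]] _ _ [].
- by move=> [[?|?]|[? ?]] [[?|?]|[? ?]] _ _ [].
Qed.

Section JoinAction.
Variables (G : groupType) (Y W : gposet G).

Definition join_act (g : G) : join Y W -> join Y W := join_map (gact g) (gact g).

Lemma join_act1 j : join_act 1%g j = j.
Proof. by case: j => [[y|w]|[y w]]; rewrite /join_act /= ?gact1. Qed.

Lemma join_actM g h j : join_act (g * h)%g j = join_act g (join_act h j).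
Proof. by case: j => [[y|w]|[y w]]; rewrite /join_act /= ?gactM. Qed.

Lemma join_act_le g i j : ple i j -> ple (join_act g i) (join_act g j).
Proof.
move=> [h1 h2]; split; rewrite /join_act ?join_left_map ?join_right_map;
  by apply: ole_omap => // x y; exact: gact_le.
Qed.

Definition join_gposet : gposet G := GPoset join_act1 join_actM join_act_le.

Lemma join_pfix (K : set G) :
  @pfix G join_gposet K = join_set (pfix K) (pfix K).
Proof.
apply/seteqP; split=> -[[y|w]|[y w]].
- by move=> h; split=> //= g /h [].
- by move=> h; split=> //= g /h [].
- by move=> h; split=> /= g /h [].
- by move=> [/= h _] g /h /= e; rewrite /join_act /= e.
- by move=> [/= _ h] g /h /= e; rewrite /join_act /= e.
- by move=> [/= h1 h2] g Kg; rewrite /= /join_act /= (h1 g Kg) (h2 g Kg).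
Qed.

Lemma join_pstabl (y : Y) : @pstab G join_gposet (inl (inl y)) = pstab y.
Proof. by apply/seteqP; split=> g; rewrite /pstab /= /join_act /=; [case|move=> ->]. Qed.

Lemma join_pstabr (w : W) : @pstab G join_gposet (inl (inr w)) = pstab w.
Proof. by apply/seteqP; split=> g; rewrite /pstab /= /join_act /=; [case|move=> ->]. Qed.

Lemma join_pstab2 (y : Y) (w : W) :
  @pstab G join_gposet (inr (y, w)) = pstab y `&` pstab w.
Proof.
apply/seteqP; split=> g; rewrite /pstab /= /join_act /=; first by case.
by move=> [-> ->].
Qed.

End JoinAction.

(** * Orbit representatives, and sections over a set with a group action *)

Definition group_action (G : groupType) (Y : Type) (a : G -> Y -> Y) : Prop :=
  (forall y, a 1%g y = y) /\ (forall g h y, a (g * h)%g y = a g (a h y)).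

Section OrbitRepresentatives.
Variables (G : groupType) (Y : choiceType) (a : G -> Y -> Y) (K : set G).
Hypotheses (aP : group_action a) (KG : is_subgroup K).

Lemma subgroup1 : K 1%g. Proof. exact: KG.1. Qed.

Lemma subgroupV x : K x -> K x^-1%g.
Proof. by move=> Kx; have := KG.2 _ _ subgroup1 Kx; rewrite mul1g. Qed.

Lemma subgroupM x y : K x -> K y -> K (x * y)%g.
Proof. by move=> Kx /subgroupV Ky; have := KG.2 _ _ Kx Ky; rewrite invgK. Qed.

Lemma group_actionK g : cancel (a g) (a g^-1%g).
Proof. by move=> y; rewrite -aP.2 mulVg aP.1. Qed.

Lemma group_actionVK g : cancel (a g^-1%g) (a g).
Proof. by move=> y; rewrite -aP.2 mulgV aP.1. Qed.

Definition in_orbit (y : Y) : pred Y := [pred z | `[< exists2 k, K k & a k y = z >]].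

Lemma in_orbit_nonempty y : exists z, in_orbit y z.
Proof. by exists y; apply/asboolP; exists 1%g; [exact: subgroup1|exact: aP.1]. Qed.

(** The choice made by [xchoose] depends only on the predicate up to extensional equality, hence is
    the same along an orbit. *)
Definition orbit_rep y : Y := xchoose (in_orbit_nonempty y).

Lemma orbit_repP y : exists2 k, K k & a k y = orbit_rep y.
Proof. by have /asboolP := xchooseP (in_orbit_nonempty y). Qed.

Definition to_rep y : G := sval (cid2 (orbit_repP y)).

Lemma to_repK y : K (to_rep y). Proof. by rewrite /to_rep; case: cid2. Qed.

Lemma to_repE y : a (to_rep y) y = orbit_rep y.
Proof. by rewrite /to_rep; case: cid2. Qed.

Lemma from_rep y : a (to_rep y)^-1%g (orbit_rep y) = y.
Proof. by rewrite -to_repE group_actionK. Qed.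

Lemma orbit_rep_act k y : K k -> orbit_rep (a k y) = orbit_rep y.
Proof.
move=> Kk; apply: eq_xchoose => z; apply/asboolP/asboolP => -[l Kl <-].
  by exists (l * k)%g; [exact: subgroupM|rewrite aP.2].
exists (l * k^-1)%g; first by apply: subgroupM => //; exact: subgroupV.
by rewrite -aP.2 mulgVK.
Qed.

(** These elements of the stabiliser of the representative form the cocycle through which an action
    of that stabiliser is induced to the whole orbit. *)
Lemma to_rep_cocycle k y : K k ->
  a (to_rep (a k y) * k * (to_rep y)^-1)%g (orbit_rep y) = orbit_rep y.
Proof. by move=> Kk; rewrite aP.2 from_rep aP.2 to_repE orbit_rep_act. Qed.

End OrbitRepresentatives.

(* A [G]-poset [X] and, over each point [y] of a [G]-set [Y], a copy of the poset
   [E]; the cocycle [b] transports the fibre over [y] to the fibre over [g y].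
   The [G]-poset [sections] consists of the pairs of a point [x] of [X] and of a
   section of the fibres over a finite subset [S x] of [Y]. *)
Section Sections.
Variables (G : groupType) (X : gposet G) (Y : choiceType) (a : G -> Y -> Y).
Hypothesis aP : group_action a.
Variables (S : X -> Y -> Prop).
Hypothesis S_le : forall x x' y, ple x x' -> S x y -> S x' y.
Hypothesis S_act : forall g x y, S x y -> S (gact g x) (a g y).
Variables (E : poset) (b : G -> Y -> E -> E).
Hypothesis b1 : forall y e, b 1%g y e = e.
Hypothesis bM : forall g h y e, b (g * h)%g y e = b g (a h y) (b h y e).
Hypothesis S_finite : forall x, exists r : seq Y, forall y, S x y -> y \in r.
Hypothesis b_le : forall g y e e', ple e e' -> ple (b g y e) (b g y e').

Record section := Section_ {
  base : X ;
  fibre : Y -> option E ;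
  fibreP : forall y, S base y <-> fibre y <> None }.

HB.instance Definition _ := gen_eqMixin section.
HB.instance Definition _ := gen_choiceMixin section.

Lemma section_eq (s t : section) :
  base s = base t -> (forall y, fibre s y = fibre t y) -> s = t.
Proof.
case: s t => [x f fP] [x' f' f'P] /= ex ef; subst x'.
have {}ef : f = f' by apply/funext.
by subst f'; congr Section_; apply: Prop_irrelevance.
Qed.

Lemma fibre_some (s : section) y : S (base s) y -> exists e, fibre s y = Some e.
Proof. by move/fibreP; case: (fibre s y) => // e _; exists e. Qed.

Lemma fibre_S (s : section) y e : fibre s y = Some e -> S (base s) y.
Proof. by move=> h; apply/fibreP; rewrite h. Qed.

Definition section_le (s t : section) : Prop :=
  ple (base s) (base t) /\ forall y, ole (fibre s y) (fibre t y).

Lemma section_lexx s : section_le s s.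
Proof. by split=> [|y]; [exact: plexx|exact: olexx]. Qed.

Lemma section_le_anti s t : section_le s t -> section_le t s -> s = t.
Proof.
by move=> [h1 h2] [h3 h4]; apply: section_eq => [|y]; [exact: ple_anti|exact: ole_anti].
Qed.

Lemma section_le_trans t s u : section_le s t -> section_le t u -> section_le s u.
Proof.
by move=> [h1 h2] [h3 h4]; split=> [|y]; [exact: ple_trans h3|exact: ole_trans (h4 y)].
Qed.

Definition section_poset : poset := Poset section_lexx section_le_anti section_le_trans.

Lemma section_act_proof g (s : section) y :
  S (gact g (base s)) y <->
  omap (b g (a g^-1%g y)) (fibre s (a g^-1%g y)) <> None.
Proof.
transitivity (S (base s) (a g^-1%g y)).
  split=> [/(S_act g^-1%g)|/(S_act g)]; first by rewrite gactK.
  by rewrite group_actionVK.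
by rewrite fibreP; case: (fibre s _).
Qed.

Definition section_act (g : G) (s : section_poset) : section_poset :=
  Section_ (section_act_proof g s).

Lemma section_act1 s : section_act 1%g s = s.
Proof.
apply: section_eq => [|y] /=; first exact: gact1.
by rewrite invg1 aP.1; case: (fibre s y) => //= e; rewrite b1.
Qed.

Lemma section_actM g h s : section_act (g * h)%g s = section_act g (section_act h s).
Proof.
apply: section_eq => [|y] /=; first exact: gactM.
rewrite invgM aP.2; case: (fibre s _) => //= e.
by rewrite bM group_actionVK.
Qed.

Lemma section_act_le g s t : ple s t -> ple (section_act g s) (section_act g t).
Proof.
move=> [h1 h2]; split=> [|y] /=; first exact: gact_le.
by apply: ole_omap (h2 _) => e e'; exact: b_le.
Qed.

Definition sections : gposet G := GPoset section_act1 section_actM section_act_le.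

(** A section below [s] is determined by its base and its values, possibly [None], at the at most
    [BS] points allowed over the base of [s]. *)
Lemma section_small BX BS BE :
  small_down_sets X BX -> small_down_sets E BE ->
  (forall x, exists2 s : seq Y, size s <= BS & forall y, S x y -> y \in s) ->
  small_down_sets sections (BX * BE.+1 ^ BS).
Proof.
move=> bX bE bS s.
have [sx sxB sxP] := bX (base s).
have [sy syB syP] := bS (base s).
have funs : forall l : seq Y, exists2 F : seq (Y -> option E), size F <= BE.+1 ^ size l &
    forall f, (forall y, ole (f y) (fibre s y)) -> (forall y, f y <> None -> y \in l) -> f \in F.
  elim=> [|y l [F FB FP]].
    exists [:: fun=> None] => // f _ f0; rewrite inE; apply/eqP/funext => y.
    by have := f0 y; case: (f y) => // e; case.
  have [v vB vP] := small_option (fibre s y) bE.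
  exists [seq (fun z => if z == y then c else f z) | c <- v, f <- F].
    rewrite size_allpairs /= expnS; exact: leq_mul.
  move=> f fle fl; apply/allpairsP.
  exists (f y, fun z => if z \in l then f z else None); split=> /=; first exact: vP.
    apply: FP => z; last by case: ifP.
    by case: ifP => _; [exact: fle|].
  apply/funext => z; case: eqP => [-> //|zy]; case: ifP => // zl.
  have := fl z; rewrite inE zl orbF; case: (f z) => // e /(_ _) h.
  by exfalso; apply: zy; apply/eqP; exact: h.
have [F FB FP] := funs sy.
pose mk (xf : X * (Y -> option E)) : option section :=
  if pselect (forall y, S xf.1 y <-> xf.2 y <> None) is left h then Some (Section_ h) else None.
exists (pmap mk [seq (x, f) | x <- sx, f <- F]).
  rewrite size_pmap (leq_trans (count_size _ _)) // size_allpairs leq_mul //.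
  by apply: leq_trans FB _; rewrite leq_pexp2l.
move=> t [tx tf]; rewrite mem_pmap; apply/mapP; exists (base t, fibre t).
  apply/allpairsP; exists (base t, fibre t); split=> //; first exact: sxP.
  apply: FP => // y /fibreP ty; apply: syP; exact: S_le tx ty.
rewrite /mk; case: pselect => [h|nh]; last by exfalso; apply: nh; exact: fibreP.
by congr Some; apply: section_eq.
Qed.

Lemma section_pstab (s : sections) y : S (base s) y ->
  exists e, forall g, pstab s g -> a g y = y -> b g y e = e.
Proof.
move=> /fibre_some[e he]; exists e => g /(congr1 (fun t => fibre t y)) /=.
by move=> + gy; rewrite -{1 2}gy group_actionK // he => -[].
Qed.

Lemma section_pstab_base (s : sections) : pstab s `<=` pstab (base s).
Proof. by move=> g /(congr1 (@base)). Qed.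

Section FixedSections.
Variables (K : set G).
Hypothesis KG : is_subgroup K.

Definition fibre_fix y : set E := [set e | forall k, K k -> a k y = y -> b k y e = e].

Variables (mX mE : nat).
Hypothesis cX : contractible_poset (@pfix G X K) mX.
Hypothesis cE : forall y, contractible_poset (fibre_fix y) mE.

Lemma fixed_fibre_equivariant (s : sections) k y : pfix K s -> K k ->
  fibre s (a k y) = omap (b k y) (fibre s y).
Proof.
move=> /(_ k) + Kk => /(_ Kk) /(congr1 (fun t => fibre t (a k y))) /= <-.
by rewrite !group_actionK.
Qed.

Lemma pfix_sections (s : sections) : pfix K s <->
  pfix K (base s) /\ forall k y, K k -> fibre s (a k y) = omap (b k y) (fibre s y).
Proof.
split=> [h|[h1 h2] k Kk].
  split; first by move=> k /h /(congr1 (@base)).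
  by move=> k y; exact: fixed_fibre_equivariant.
apply: section_eq => [|y] /=; first exact: h1.
by rewrite -h2 // group_actionVK.
Qed.

Lemma pfix_fibre (s : sections) y e : pfix K s -> fibre s y = Some e -> fibre_fix y e.
Proof.
move=> /pfix_sections[_ h] he k Kk ky.
by have := h k y Kk; rewrite ky he /= => -[].
Qed.

Let rp := orbit_rep aP KG.
Let tr := to_rep aP KG.
Let hE y := sval (cid (cE y)).
Let hEP y : contraction (fibre_fix y) mE (hE y) := svalP (cid (cE y)).

Let b_fix y e : fibre_fix y e -> fibre_fix (rp y) (b (tr y) y e).
Proof.
move=> he k Kk krp; rewrite /rp -to_repE -bM.
pose l := ((tr y)^-1 * k * tr y)%g.
have -> : (k * tr y)%g = (tr y * l)%g by rewrite /l !mulgA mulgV mul1g.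
have Kl : K l by apply: subgroupM => //; [apply: subgroupM => //; apply: subgroupV => //|];
  exact: to_repK.
have ly : a l y = y by rewrite /l !aP.2 to_repE krp from_rep.
by rewrite bM ly (he l Kl ly).
Qed.

Let b_fixV y e : fibre_fix (rp y) e -> fibre_fix y (b (tr y)^-1%g (rp y) e).
Proof.
move=> he k Kk ky.
pose l := (tr y * k * (tr y)^-1)%g.
have Kl : K l by apply: subgroupM => //; [apply: subgroupM => //|apply: subgroupV => //];
  exact: to_repK.
have lr : a l (rp y) = rp y.
  by rewrite /l !aP.2 from_rep ky to_repE.
rewrite -{1}(from_rep aP KG y) -bM.
have -> : (k * (to_rep aP KG y)^-1)%g = ((tr y)^-1 * l)%g by rewrite /l !mulgA mulVg mul1g.
by rewrite bM lr (he l Kl lr).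
Qed.

Let bK y e : b (tr y)^-1%g (rp y) (b (tr y) y e) = e.
Proof. by rewrite /rp -to_repE -bM mulVg b1. Qed.

(* The contractions of the fibres, made [K]-equivariant by transporting those of
   the fibres over orbit representatives. *)
Definition fibre_contraction i n y (e : E) : E :=
  b (tr y)^-1%g (rp y) (hE (rp y) i n (b (tr y) y e)).

Let fibre_contraction_zig y :
  contraction (fibre_fix y) mE (fun i n => fibre_contraction i n y).
Proof.
have [h0 hS [e0 Qe0 hm]] := hEP (rp y).
have conj k l : zigzag (fibre_fix (rp y)) k l ->
    zigzag (fibre_fix y) (fun n e => b (tr y)^-1%g (rp y) (k n (b (tr y) y e)))
      (fun e => b (tr y)^-1%g (rp y) (l (b (tr y) y e))).
  move=> [h1 h2 h3]; split.
  - move=> n; split=> [e /b_fix He|e e' /b_fix He /b_fix He' ee'].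
      by apply: b_fixV; exact: (h1 n).1.
    by apply: b_le; apply: (h1 n).2 => //; exact: b_le.
  - move=> n e /b_fix He; have := h2 n _ He.
    by case: odd => h; exact: b_le.
  - by move=> e /b_fix /h3 [N hN]; exists N => n /hN ->.
split.
- have [h1 h2 h3] := conj _ _ h0; split=> // e He.
  by have [N hN] := h3 e He; exists N => n /hN; rewrite /= bK.
- by move=> i; exact: conj (hS i).
- exists (b (tr y)^-1%g (rp y) e0); first exact: b_fixV.
  by move=> e /b_fix He; rewrite /fibre_contraction hm.
Qed.

Let fibre_contraction_equivariant i n k y e : K k -> fibre_fix y e ->
  fibre_contraction i n (a k y) (b k y e) = b k y (fibre_contraction i n y e).
Proof.
move=> Kk He; rewrite /fibre_contraction.
have rk : rp (a k y) = rp y by exact: orbit_rep_act.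
rewrite rk; set e0 := b (tr y) y e.
have He0 : fibre_fix (rp y) e0 by exact: b_fix.
pose l := (tr (a k y) * k * (tr y)^-1)%g.
have Kl : K l.
  by apply: subgroupM => //; [apply: subgroupM => //|apply: subgroupV => //]; exact: to_repK.
have lr : a l (rp y) = rp y by exact: to_rep_cocycle.
have -> : b (tr (a k y)) (a k y) (b k y e) = e0.
  rewrite -bM (_ : (tr (a k y) * k)%g = (l * tr y)%g); last by rewrite /l mulgVK.
  by rewrite bM to_repE -/e0 (He0 l Kl lr).
set e1 := hE _ _ _ _.
have He1 : fibre_fix (rp y) e1.
  have [h0 hS _] := hEP (rp y).
  by case: i @e1 => [|i] /=; [have [h _ _] := h0|have [h _ _] := hS i]; exact: (h n).1.
have -> : b k y (b (tr y)^-1%g (rp y) e1) = b (k * (tr y)^-1)%g (rp y) e1.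
  by rewrite bM from_rep.
have -> : (k * (tr y)^-1)%g = ((tr (a k y))^-1 * l)%g.
  by rewrite /l !mulgA mulVg mul1g.
by rewrite bM lr (He1 l Kl lr).
Qed.

Let fib_proof i n (s : sections) y :
  S (base s) y <-> omap (fibre_contraction i n y) (fibre s y) <> None.
Proof. by rewrite fibreP; case: (fibre s y). Qed.

Let fib_map i n (s : sections) : sections := Section_ (@fib_proof i n s).

Let basepoint_ex y : exists2 e0, fibre_fix y e0 &
  forall e, fibre_fix y e -> fibre_contraction mE 0 y e = e0.
Proof. by have [_ _] := fibre_contraction_zig y. Qed.

Let basepoint y : E := sval (cid2 (basepoint_ex y)).

Let basepoint_fix y : fibre_fix y (basepoint y).
Proof. by rewrite /basepoint; case: cid2. Qed.

Let basepointE y e : fibre_fix y e -> fibre_contraction mE 0 y e = basepoint y.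
Proof. by rewrite /basepoint; case: cid2 => ? ? h; exact: h. Qed.

Let b_fix_act k y e : K k -> fibre_fix y e -> fibre_fix (a k y) (b k y e).
Proof.
move=> Kk He l Kl ly.
pose l' := (k^-1 * l * k)%g.
have Kl' : K l' by apply: subgroupM => //; apply: subgroupM => //; exact: subgroupV.
have l'y : a l' y = y by rewrite /l' !aP.2 ly group_actionK.
rewrite -bM (_ : (l * k)%g = (k * l')%g); last by rewrite /l' !mulgA mulgV mul1g.
by rewrite bM l'y (He l' Kl' l'y).
Qed.

Let basepoint_equivariant k y : K k -> basepoint (a k y) = b k y (basepoint y).
Proof.
move=> Kk; rewrite -(basepointE (b_fix_act Kk (@basepoint_fix y))).
by rewrite fibre_contraction_equivariant // basepointE.
Qed.

Let base_proof (x : X) y :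
  S x y <-> (if `[< S x y >] then Some (basepoint y) else None) <> None.
Proof. by case: asboolP. Qed.

Let base_section (x : X) : sections := Section_ (base_proof x).

Let fib_map_fix i n s : pfix K s -> pfix K (fib_map i n s).
Proof.
move=> Ks; have /pfix_sections[h1 h2] := Ks; apply/pfix_sections; split=> //= k y Kk.
rewrite h2 //; case e : (fibre s y) => [c|] //=; congr Some.
by apply: fibre_contraction_equivariant => //; exact: pfix_fibre e.
Qed.

Let base_section_fix x : pfix K x -> pfix K (base_section x).
Proof.
move=> Kx; apply/pfix_sections; split=> // k y Kk /=.
have -> : `[< S x (a k y) >] = `[< S x y >].
  apply/asboolP/asboolP => [/(S_act k^-1%g)|/(S_act k)].
    by rewrite group_actionK // Kx //; exact: subgroupV.
  by rewrite Kx.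
by case: asboolP => //= _; rewrite basepoint_equivariant.
Qed.

(** Over an immobile base, all fibres are contracted in parallel and equivariantly onto their
    basepoints. The resulting sections depend only on their base, so the contraction of [X] can
    follow. As stages are numbered from 0, the first phase has [mE.+1] of them. *)
Lemma sections_contractible : contractible_poset (@pfix G sections K) (mE + mX).+1.
Proof.
have [hX [h0 hS [x0 Kx0 hm]]] := cX.
pose h i n (s : sections) : sections :=
  if i <= mE then fib_map i n s else base_section (hX (i - mE.+1) n (base s)).
have fzig i l : (forall y, zigzag (fibre_fix y) (fun n => fibre_contraction i n y) (l y)) ->
    forall L : sections -> sections,
    (forall s, pfix K s -> base (L s) = base s /\ forall y, fibre (L s) y = omap (l y) (fibre s y)) ->
    zigzag (@pfix G sections K) (fun n => fib_map i n) L.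
  move=> hz L hL; split.
  - move=> n; split=> [s|s t Ks Kt [st1 st2]]; first exact: fib_map_fix.
    split=> //= y; have := st2 y.
    case es : (fibre s y) => [e|] //=; case et : (fibre t y) => [e'|] //= ee'.
    have [hh _ _] := hz y.
    by apply: (hh n).2 => //; [exact: pfix_fibre es|exact: pfix_fibre et].
  - move=> n s Ks.
    have alt y e : fibre s y = Some e -> if odd n
        then ple (fibre_contraction i n.+1 y e) (fibre_contraction i n y e)
        else ple (fibre_contraction i n y e) (fibre_contraction i n.+1 y e).
      by move=> es; have [_ hh _] := hz y; apply: hh; exact: pfix_fibre es.
    by case on : (odd n); split=> /=; try exact: plexx; move=> y;
      case es : (fibre s y) => [e|] //=; have := alt y e es; rewrite on.
  - move=> s Ks.
    (* The fibres become stationary at different indices; the finiteness of the domain of a section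
       provides a common one. *)
    have fin_ev : forall r : seq Y, exists N, forall n, N <= n -> forall y e,
        y \in r -> fibre s y = Some e -> fibre_contraction i n y e = l y e.
      elim=> [|y r [N hN]]; first by exists 0.
      case es : (fibre s y) => [e|]; last first.
        by exists N => n Nn z e; rewrite inE => /predU1P[->|]; [rewrite es|exact: hN].
      have [_ _ hh] := hz y; have [N' hN'] := hh e (pfix_fibre Ks es).
      exists (maxn N N') => n; rewrite geq_max => /andP[nN nN'] z c.
      rewrite inE => /predU1P[->|]; last exact: hN.
      by rewrite es => -[<-]; exact: hN'.
    have [r rP] : exists r : seq Y, forall y, S (base s) y -> y \in r.
      exact: S_finite.
    have [N hN] := fin_ev r; exists N => n Nn.
    have [L1 L2] := hL s Ks.
    apply: section_eq => [|y] /=; first by rewrite L1.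
    rewrite L2; case es : (fibre s y) => [e|] //=.
    by rewrite (hN n Nn y e) //; apply: rP; exact: fibre_S es.
have bzig k l : zigzag (@pfix G X K) k l ->
    zigzag (@pfix G sections K) (fun n s => base_section (k n (base s)))
      (fun s => base_section (l (base s))).
  have bs_le x x' : ple x x' -> ple (base_section x) (base_section x').
    move=> xx'; split=> //= y; case: asboolP => // Sy.
    by rewrite asboolT; [exact: plexx|exact: S_le xx' Sy].
  move=> [h1 h2 h3]; split.
  - move=> n; split=> [s|s t] /pfix_sections[Ks _].
      by apply: base_section_fix; exact: (h1 n).1.
    move=> /pfix_sections[Kt _] [st _].
    by apply: bs_le; exact: (h1 n).2.
  - move=> n s /pfix_sections[Ks _]; have := h2 n _ Ks.
    by case: odd => ?; exact: bs_le.
  - by move=> s /pfix_sections[Ks _]; have [N hN] := h3 _ Ks; exists N => n /hN ->.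
exists h; split.
- apply: (@fzig 0 (fun _ => id)) => [y|s Ks].
    by have [] := fibre_contraction_zig y.
  by split=> // y; case: (fibre s y).
- move=> i; rewrite /h; have [iE|] := ltnP i mE.
    rewrite (ltnW iE); apply: (@fzig i.+1 (fun y => fibre_contraction i 0 y)) => [y|s Ks //].
    by have [_ hh _] := fibre_contraction_zig y.
  rewrite leq_eqVlt => /predU1P[<-|iE].
    rewrite leqnn subnn.
    have [h1 h2 h3] := bzig _ _ h0; split=> // s Ks.
    have [N hN] := h3 s Ks; exists N => n /hN ->.
    apply: section_eq => //= y.
    case es : (fibre s y) => [e|] /=; first by rewrite asboolT ?basepointE //;
      [exact: pfix_fibre es|exact: fibre_S es].
    by rewrite asboolF // => /fibreP; rewrite es.
  have n2 : (i <= mE) = false by lia.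
  have e : i.+1 - mE.+1 = (i - mE.+1).+1 by lia.
  by rewrite n2 e; apply: bzig; exact: hS.
- exists (base_section x0); first exact: base_section_fix.
  move=> s /pfix_sections[Ks _]; rewrite /h leqNgt ltnS leq_addr /=.
  by rewrite subSS addKn hm.
Qed.

End FixedSections.

End Sections.

(** * Virtually cyclic subgroups *)

Section IntegerPowers.
Variable G : groupType.
Local Open Scope group_scope.
Implicit Types (x y : G) (m n : int).

Definition zpow x n : G :=
  match n with Posz k => x ^+ k | Negz k => x ^- k.+1 end.

Lemma zpow_nat x (k : nat) : zpow x k = x ^+ k. Proof. by []. Qed.

Lemma zpowS x n : zpow x (n + 1)%R = zpow x n * x.
Proof.
case: n => [k|[|k]]; first by rewrite -PoszD addn1 /= expgSr.
  by rewrite /= mulVg.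
have -> : (Negz k.+1 + 1 = Negz k)%R by lia.
by rewrite /zpow [x ^+ k.+2]expgS invgM mulgVK.
Qed.

Lemma zpowP x n : zpow x (n - 1)%R = zpow x n * x^-1.
Proof. by rewrite -{2}(subrK 1%R n) zpowS mulgK. Qed.

Lemma zpowD x m n : zpow x (m + n)%R = zpow x m * zpow x n.
Proof.
elim/int_ind: n => [|n IH|n IH]; first by rewrite addr0 mulg1.
  by rewrite -addn1 PoszD addrA !zpowS IH mulgA.
by rewrite -addn1 PoszD opprD addrA !zpowP IH mulgA.
Qed.

Lemma zpowN x n : zpow x (- n)%R = (zpow x n)^-1.
Proof. by apply: (mulIg (zpow x n)); rewrite -zpowD addNr mulVg. Qed.

Lemma zpowM x m n : zpow x (m * n)%R = zpow (zpow x m) n.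
Proof.
elim/int_ind: n => [|n IH|n IH]; first by rewrite mulr0.
  by rewrite -addn1 PoszD mulrDr mulr1 [LHS]zpowD IH zpowS.
by rewrite -addn1 PoszD opprD mulrDr mulrN1 [LHS]zpowD IH zpowP (zpowN x m).
Qed.

Lemma commute_zpow x y n : commute x y -> commute x (zpow y n).
Proof.
move=> xy; case: n => k /=; first exact: commuteX.
by apply: commuteV; exact: commuteX.
Qed.

Lemma zpow_mul x y n : commute x y -> zpow (x * y) n = zpow x n * zpow y n.
Proof.
move=> xy; case: n => k /=; rewrite expgMn // invgM.
by apply: commuteV; apply: commute_sym; apply: commuteV; apply: commuteX2; exact: commute_sym.
Qed.

Lemma zpowJ x y n : (zpow x n) ^ y = zpow (x ^ y) n.
Proof. by case: n => k /=; rewrite ?conjVg conjXg. Qed.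

Lemma zpow1g n : zpow 1 n = 1.
Proof. by case: n => k /=; rewrite expg1n ?invg1. Qed.

Definition cyc x : set G := range (zpow x).

Lemma subgroup_zpow (H : set G) x n : is_subgroup H -> H x -> H (zpow x n).
Proof.
move=> HG Hx; have HX k : H (x ^+ k).
  by elim: k => [|k IH]; [exact: subgroup1|rewrite expgS; exact: subgroupM].
by case: n => k /=; [|apply: subgroupV].
Qed.

Lemma cyc_subgroup x : is_subgroup (cyc x).
Proof.
split; first by exists 0%R.
move=> _ _ [m _ <-] [n _ <-]; exists (m - n)%R => //.
by rewrite zpowD zpowN.
Qed.

Lemma subgroupI (H K : set G) : is_subgroup H -> is_subgroup K -> is_subgroup (H `&` K).
Proof.
move=> HG KG; split; first by split; exact: subgroup1.
by move=> x y [Hx Kx] [Hy Ky]; split; [exact: HG.2|exact: KG.2].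
Qed.

End IntegerPowers.

Section Morphisms.
Local Open Scope group_scope.

Lemma zpow_morph (G G' : groupType) (f : G -> G') (x : G) (n : int) :
  {morph f : x y / x * y} -> f (zpow x n) = zpow (f x) n.
Proof.
move=> fM.
have f1 : f 1 = 1 by apply: (mulgI (f 1)); rewrite -fM !mulg1.
have fV u : f u^-1 = (f u)^-1 by apply: (mulgI (f u)); rewrite -fM !mulgV.
have fX k u : f (u ^+ k) = f u ^+ k.
  by elim: k => [|k IH]; rewrite ?expg0 // !expgS fM IH.
by case: n => k /=; rewrite ?fV fX.
Qed.

End Morphisms.

(** * Finite index and virtually cyclic subgroups *)

Section FiniteIndex.
Variable G : groupType.
Local Open Scope group_scope.
Implicit Types (H K A B : set G) (T : seq G).

(** Finite index, without asking that [A] or [T] be contained in [H]: coverings then compose freely,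
    and [covered_sub] recovers representatives in a given subgroup. *)
Definition covered H A T : Prop :=
  forall h, H h -> exists2 t, t \in T & A (t^-1 * h).

Lemma covered_trans H A B T : covered H A T -> (exists T', covered A B T') ->
  exists T'', covered H B T''.
Proof.
move=> hT [T' hT']; exists [seq t * t' | t <- T, t' <- T'] => h Hh.
have [t tT At] := hT h Hh; have [t' t'T' Bt'] := hT' _ At.
exists (t * t'); first by apply/allpairsP; exists (t, t').
by rewrite invgM -mulgA.
Qed.

Lemma coveredS H A B T : A `<=` B -> covered H A T -> covered H B T.
Proof. by move=> AB hT h /hT[t tT At]; exists t => //; exact: AB. Qed.

Lemma covered_sub H A T K : is_subgroup A -> is_subgroup K -> K `<=` H ->
  covered H A T -> exists2 T', (forall t, t \in T' -> K t) & covered K (K `&` A) T'.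
Proof.
move=> AG KG KH hT.
pose ch (t : G) := if pselect (exists k, K k /\ A (t^-1 * k)) is left h then Some (sval (cid h)) else None.
have chP t k : ch t = Some k -> K k /\ A (t^-1 * k).
  by rewrite /ch; case: pselect => // h -[<-]; case: cid.
exists (pmap ch T).
  by move=> t; rewrite mem_pmap => /mapP[u _ /esym /chP[]].
move=> k Kk; have [t tT Ak] := hT _ (KH _ Kk).
case e : (ch t) => [l|]; last first.
  by move: e; rewrite /ch; case: pselect => // h; exfalso; apply: h; exists k.
have [Kl Al] := chP _ _ e.
exists l; first by rewrite mem_pmap -e map_f.
split; first by apply: subgroupM => //; exact: subgroupV.
have -> : l^-1 * k = (t^-1 * l)^-1 * (t^-1 * k).
  by rewrite invgM invgK -mulgA mulVKg.
by apply: subgroupM => //; exact: subgroupV.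
Qed.

Lemma covered_pigeonhole H A T (g : nat -> G) : is_subgroup A -> covered H A T ->
  (forall i, H (g i)) -> exists i j, (i < j <= size T)%N /\ A ((g i)^-1 * g j).
Proof.
move=> AG hT Hg.
pose t i := s2val (cid2 (hT _ (Hg i))).
have tT i : t i \in T by rewrite /t; case: cid2.
have tA i : A ((t i)^-1 * g i) by rewrite /t; case: cid2.
have [i [j [/andP[ij jT] e]]] : exists i j, (i < j <= size T)%N /\ t i = t j.
  apply: contrapT => h.
  have : uniq [seq t i | i <- iota 0 (size T).+1].
    rewrite map_inj_in_uniq ?iota_uniq // => i j.
    rewrite !mem_iota !add0n /= !ltnS => iT jT e.
    have [ij|ji|//] := ltngtP i j; exfalso; apply: h.
      by exists i, j; rewrite ij.
    by exists j, i; rewrite ji.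
  move=> us; have := @uniq_leq_size _ _ T us.
  rewrite size_map size_iota ltnn => h'; have : false; last by [].
  by apply: h' => _ /mapP[i _ ->].
exists i, j; rewrite ij jT; split=> //.
have -> : (g i)^-1 * g j = ((t i)^-1 * g i)^-1 * ((t j)^-1 * g j).
  by rewrite e invgM invgK -mulgA mulVKg.
by apply: subgroupM => //; exact: subgroupV.
Qed.

Lemma covered_power H A T h : is_subgroup H -> is_subgroup A -> covered H A T -> H h ->
  exists2 e, (0 < e)%N & A (h ^+ e).
Proof.
move=> HG AG hT Hh.
have [|i [j [/andP[ij _] hA]]] := @covered_pigeonhole H A T (fun i => h ^+ i) AG hT.
  by move=> i; have := subgroup_zpow (Posz i) HG Hh.
exists (j - i); first by rewrite subn_gt0.
by move: hA; rewrite -{1}(subnKC (ltnW ij)) expgnDr mulKg.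
Qed.

(** An internal form of virtual cyclicity. The element [c] may have finite order, so finite
    subgroups are included. *)
Definition vc_sub K : Prop :=
  is_subgroup K /\ exists2 c, K c & exists T, covered K (cyc c) T.

Lemma covered_cyc_power c (n : nat) : (0 < n)%N ->
  exists T, covered (cyc c) (cyc (c ^+ n)) T.
Proof.
move=> n0; exists [seq c ^+ i | i <- iota 0 n] => _ [m _ <-].
exists (c ^+ `|(m %% n)%Z|).
  apply: map_f; rewrite mem_iota /= add0n -ltz_nat gez0_abs ?modz_ge0 ?gt_eqF //.
  by rewrite ltz_pmod.
exists (m %/ n)%Z => //.
rewrite -zpow_nat -zpowM -[c ^+ _]zpow_nat gez0_abs ?modz_ge0 ?gt_eqF //.
rewrite -zpowN -zpowD; congr zpow.
have := divz_eq m n; move: (m %/ n)%Z (m %% n)%Z => q r ->; ring.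
Qed.

(** Either [K'] contains a positive power of [c], whose multiples have finite index in [K'], or it
    meets [cyc c] trivially and is finite. *)
Lemma vc_subS K K' : vc_sub K -> is_subgroup K' -> K' `<=` K -> vc_sub K'.
Proof.
move=> [KG [c Kc [T hT]]] K'G K'K; split=> //.
have [T' _ hT'] := covered_sub (cyc_subgroup c) K'G K'K hT.
have [[n n0 K'n]|no] := pselect (exists2 n, (0 < n)%N & K' (c ^+ n)).
  exists (c ^+ n) => //; apply: covered_trans hT' _.
  have [T2 h2] := covered_cyc_power c n0.
  by exists T2 => h [_ /h2].
exists 1; first exact: subgroup1.
exists T'; apply: coveredS hT' => z [K'z [m _ e]].
have [m0|m0] := eqVneq m 0%R; first by exists 0%R; rewrite // -e m0.
exfalso; apply: no; exists `|m|%N; first by rewrite absz_gt0.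
rewrite -zpow_nat; have [mp|mn] := leP 0%R m; first by rewrite gez0_abs // e.
rewrite ltz0_abs // zpowN e; exact: subgroupV.
Qed.

Lemma vc_sub_extension H K T : is_subgroup H -> vc_sub K -> K `<=` H ->
  covered H K T -> vc_sub H.
Proof.
move=> HG [KG [c Kc hK]] KH hT; split=> //; exists c; first exact: KH.
exact: covered_trans hT hK.
Qed.

Lemma vc_sub_cyc c : vc_sub (cyc c).
Proof.
split; first exact: cyc_subgroup.
exists c; first by exists 1%R.
by exists [:: 1] => h ch; exists 1; rewrite ?inE // invg1 mul1g.
Qed.

Lemma vc_sub1 : vc_sub [set 1].
Proof.
have e : [set 1] = cyc (1 : G).
  by apply/seteqP; split=> [_ ->|_ [n _ <-]] /=; [exists 0%R|rewrite zpow1g].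
by rewrite e; exact: vc_sub_cyc.
Qed.

Lemma vc_sub_powers_meet K x c T : is_subgroup K -> covered K (cyc c) T -> K x ->
  exists2 e, (0 < e)%N & cyc c (x ^+ e).
Proof. by move=> KG hT Kx; exact: covered_power KG (cyc_subgroup c) hT Kx. Qed.

End FiniteIndex.

(** * Images of subgroups, and subgroups as groups *)

Section Subgroups.
Local Open Scope group_scope.

Lemma morph1 (G G' : groupType) (f : G -> G') : {morph f : x y / x * y} -> f 1 = 1.
Proof. by move=> fM; apply: (mulgI (f 1)); rewrite -fM !mulg1. Qed.

Lemma morphV (G G' : groupType) (f : G -> G') x :
  {morph f : x y / x * y} -> f x^-1 = (f x)^-1.
Proof. by move=> fM; apply: (mulgI (f x)); rewrite -fM !mulgV morph1. Qed.

Lemma morphR (G G' : groupType) (f : G -> G') x y :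
  {morph f : x y / x * y} -> f [~ x, y] = [~ f x, f y].
Proof. by move=> fM; rewrite !commgEl !conjgE !fM !(morphV _ fM). Qed.

Lemma subgroup_image (G G' : groupType) (f : G -> G') (H : set G) :
  {morph f : x y / x * y} -> is_subgroup H -> is_subgroup (f @` H).
Proof.
move=> fM HG; split; first by exists 1; [exact: subgroup1|exact: morph1].
move=> _ _ [x Hx <-] [y Hy <-]; exists (x * y^-1); first exact: HG.2.
by rewrite fM morphV.
Qed.

Lemma subgroup_preimage (G G' : groupType) (f : G -> G') (H : set G') :
  {morph f : x y / x * y} -> is_subgroup H -> is_subgroup (f @^-1` H).
Proof.
move=> fM HG; split; first by rewrite /= morph1 //; exact: subgroup1.
by move=> x y Hx Hy; rewrite /= fM morphV //; exact: HG.2.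
Qed.

Lemma vc_sub_image (G G' : groupType) (f : G -> G') (K : set G) :
  {morph f : x y / x * y} -> vc_sub K -> vc_sub (f @` K).
Proof.
move=> fM [KG [c Kc [T hT]]]; split; first exact: subgroup_image.
exists (f c); first by exists c.
exists (map f T) => _ [k Kk <-]; have [t tT [n _ e]] := hT k Kk.
exists (f t); first exact: map_f.
by exists n => //; rewrite -(zpow_morph _ _ fM) e fM morphV.
Qed.

Lemma vc_sub_conj (G : groupType) (K : set G) g :
  vc_sub K -> vc_sub [set x | K (x ^ g)].
Proof.
move=> /(@vc_sub_image _ _ (fun x => x ^ g^-1)) h.
rewrite (_ : [set x | _] = (fun x => x ^ g^-1) @` K).
  by apply: h => x y; exact: conjMg.
apply/seteqP; split=> [x Kx|_ [x Kx <-]]; last by rewrite /= conjgKV.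
by exists (x ^ g) => //; rewrite conjgK.
Qed.

Section SubgroupType.
Variables (G : groupType) (H : set G) (HG : is_subgroup H).

Record subgroup_type := SubgroupElt { sgval : G ; sgvalP : H sgval }.

HB.instance Definition _ := gen_eqMixin subgroup_type.
HB.instance Definition _ := gen_choiceMixin subgroup_type.

Lemma sgval_inj : injective sgval.
Proof.
by move=> [x Hx] [y Hy] /= e; subst y; congr SubgroupElt; apply: Prop_irrelevance.
Qed.

End SubgroupType.

Section SubgroupGroup.
Variables (G : groupType) (H : set G) (HG : is_subgroup H).

(** The proof that [H] is a subgroup is recorded in the type so that the canonical group structure
    can depend on it. *)
Definition subgroup_of & is_subgroup H : Type := subgroup_type H.
Local Notation U := (subgroup_of HG).
HB.instance Definition _ := Choice.on U.

Definition sg_one : U := SubgroupElt (subgroup1 HG).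
Definition sg_inv (x : U) : U := SubgroupElt (subgroupV HG (sgvalP x)).
Definition sg_mul (x y : U) : U := SubgroupElt (subgroupM HG (sgvalP x) (sgvalP y)).

Lemma sg_mulA : associative sg_mul.
Proof. by move=> x y z; apply: sgval_inj; rewrite /= mulgA. Qed.
Lemma sg_mul1 : left_id sg_one sg_mul.
Proof. by move=> x; apply: sgval_inj; rewrite /= mul1g. Qed.
Lemma sg_mulg1 : right_id sg_one sg_mul.
Proof. by move=> x; apply: sgval_inj; rewrite /= mulg1. Qed.
Lemma sg_mulV : left_inverse sg_one sg_inv sg_mul.
Proof. by move=> x; apply: sgval_inj; rewrite /= mulVg. Qed.
Lemma sg_mulgV : right_inverse sg_one sg_inv sg_mul.
Proof. by move=> x; apply: sgval_inj; rewrite /= mulgV. Qed.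

HB.instance Definition _ :=
  isGroup.Build U sg_mulA sg_mul1 sg_mulg1 sg_mulV sg_mulgV.

Definition sg_incl (x : U) : G := sgval x.

Lemma sg_inclM : {morph sg_incl : x y / x * y}. Proof. by []. Qed.

HB.instance Definition _ := isMultiplicative.Build U G sg_incl sg_inclM.

Lemma sg_incl_inj : injective sg_incl. Proof. exact: sgval_inj. Qed.

Lemma range_sg_incl : range sg_incl = H.
Proof.
apply/seteqP; split=> [_ [[x Hx] _ <-]//|x Hx].
by exists (SubgroupElt Hx).
Qed.

Lemma subgroup_in_of (F : groupType -> Prop) : F U -> subgroup_in F H.
Proof.
move=> FU; exists U, sg_incl; split=> //; [exact: sg_incl_inj|exact: range_sg_incl].
Qed.

End SubgroupGroup.

Lemma generated_subgroup (G : groupType) (A : set G) : is_subgroup (generated A).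
Proof.
split; first by move=> K [KG _]; exact: subgroup1.
by move=> x y hx hy K KA; apply: KA.1.2; [exact: hx|exact: hy].
Qed.

Lemma sub_generated (G : groupType) (A : set G) : A `<=` generated A.
Proof. by move=> x Ax K [_]; apply. Qed.

Lemma generated_le (G : groupType) (A H : set G) :
  is_subgroup H -> A `<=` H -> generated A `<=` H.
Proof. by move=> HG AH x; apply. Qed.

Lemma generated1 (G : groupType) (c : G) : generated [set c] = cyc c.
Proof.
apply/seteqP; split.
  by apply: generated_le; [exact: cyc_subgroup|move=> _ ->; exists 1%R].
move=> _ [n _ <-]; apply: (@subgroup_zpow _ (generated [set c])); first exact: generated_subgroup.
exact: sub_generated.
Qed.

Lemma subgroupT (G : groupType) : is_subgroup [set: G].
Proof. by []. Qed.

Lemma finite_index_covered (G : groupType) (H : set G) :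
  is_subgroup H -> finite_index H <-> exists T, covered [set: G] H T.
Proof.
move=> HG; split.
  move=> /finite_seqP[s hs].
  pose ch (A : set G) := if pselect (exists g, [set g * h | h in H] = A) is left h
    then sval (cid h) else 1.
  exists (map ch s) => g _.
  have gs : [set g * h | h in H] \in s.
    by have : [set` s] [set g * h | h in H] by rewrite -hs; exists g.
  exists (ch [set g * h | h in H]); first exact: map_f.
  rewrite /ch; case: pselect => [e|]; last by case; exists g.
  case: cid => /= t e'; have : [set g * h | h in H] g.
    by exists 1; [exact: subgroup1|rewrite mulg1].
  by rewrite -e' => -[h Hh <-]; rewrite mulKg.
move=> [T hT]; apply: (@sub_finite_set _ _ [set` map (fun t => [set t * h | h in H]) T]).
  move=> _ [g _ <-]; have [t tT Ht] := hT g I.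
  apply/mapP; exists t => //; apply/seteqP; split=> _ [h Hh <-].
    exists (t^-1 * g * h); last by rewrite !mulgA mulgV mul1g.
    exact: subgroupM.
  exists ((t^-1 * g)^-1 * h); first by apply: subgroupM => //; exact: subgroupV.
  by rewrite invgM invgK !mulgA mulgV mul1g.
exact: finite_seq.
Qed.

Lemma virtually_cyclicP (G : groupType) :
  virtually_cyclic G <-> vc_sub [set: G].
Proof.
split.
  move=> [_ [c ->]]; rewrite generated1 finite_index_covered; last exact: cyc_subgroup.
  by move=> hT; split=> //; exists c.
move=> [_ [c _ hT]]; exists (generated [set c]); first by exists c.
rewrite generated1; apply/finite_index_covered; [exact: cyc_subgroup|exact: hT].
Qed.

Lemma vc_subP (G : groupType) (K : set G) : subgroup_in virtually_cyclic K <-> vc_sub K.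
Proof.
split.
  move=> [U [f [/virtually_cyclicP h _ <-]]]; apply: vc_sub_image h.
  exact: gmulfM.
move=> [KG [c Kc [T hT]]]; apply: (@subgroup_in_of _ _ KG); apply/virtually_cyclicP.
split=> //; exists (SubgroupElt Kc) => //.
have [T' T'K hT'] := covered_sub (cyc_subgroup c) KG (@subset_refl _ K) hT.
pose mk (t : G) : seq (subgroup_of KG) := if pselect (K t) is left h then [:: SubgroupElt h] else [::].
exists (flatten (map mk T')) => -[k Kk] _.
have [t tT [_ [n _ e]]] := hT' k Kk.
have Kt := T'K t tT; exists (SubgroupElt Kt).
  apply/flattenP; exists (mk t); first exact: map_f.
  rewrite /mk; case: pselect => // h; rewrite inE; apply/eqP; exact: sgval_inj.
exists n => //; apply: (@sg_incl_inj _ _ KG); rewrite (zpow_morph _ _ (@sg_inclM _ _ KG)) /=.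
exact: e.
Qed.

End Subgroups.

(** * Cosets and quotient groups *)

Section LeftCosets.
Variables (G : groupType) (N : set G) (NG : is_subgroup N).
Local Open Scope group_scope.

Definition rtranslate (k y : G) : G := y * k^-1.

Lemma rtranslate_action : group_action rtranslate.
Proof.
split=> [y|g h y]; first by rewrite /rtranslate invg1 mulg1.
by rewrite /rtranslate invgM mulgA.
Qed.

(** Left cosets of [N] are the orbits of [N] under right translation by inverses. *)
Definition coset_rep : G -> G := orbit_rep rtranslate_action NG.

Lemma coset_repP x : N ((coset_rep x)^-1 * x).
Proof.
rewrite /coset_rep; have [k Nk <-] := orbit_repP rtranslate_action NG x.
by rewrite /rtranslate invgM invgK mulgVK.
Qed.

Lemma coset_rep_eq x y : N (x^-1 * y) -> coset_rep x = coset_rep y.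
Proof.
move=> Nxy; rewrite /coset_rep -(orbit_rep_act rtranslate_action NG x (subgroupV NG Nxy)).
by rewrite /rtranslate invgK mulVKg.
Qed.

Lemma coset_repK x : coset_rep (coset_rep x) = coset_rep x.
Proof. by apply: coset_rep_eq; exact: coset_repP. Qed.

Lemma coset_rep_iff x y : coset_rep x = coset_rep y <-> N (x^-1 * y).
Proof.
split=> [e|]; last exact: coset_rep_eq.
have := subgroupM NG (subgroupV NG (coset_repP x)) (coset_repP y).
by rewrite e invgM invgK -mulgA mulVKg.
Qed.

Hypothesis Nn : forall x g, N x -> N (x ^ g).

Record quotient_type := QuotientElt { qrep : G ; qrepP : coset_rep qrep = qrep }.

HB.instance Definition _ := gen_eqMixin quotient_type.
HB.instance Definition _ := gen_choiceMixin quotient_type.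

Lemma qrep_inj : injective qrep.
Proof.
by move=> [x hx] [y hy] /= e; subst y; congr QuotientElt; apply: Prop_irrelevance.
Qed.

Definition qproj (x : G) : quotient_type := QuotientElt (coset_repK x).

Lemma qproj_eq x y : qproj x = qproj y <-> N (x^-1 * y).
Proof.
rewrite -coset_rep_iff; split=> [/(congr1 qrep) //|e].
exact: qrep_inj.
Qed.

Lemma qprojK q : qproj (qrep q) = q.
Proof. by apply: qrep_inj; rewrite /= qrepP. Qed.

Definition qmul (p q : quotient_type) := qproj (qrep p * qrep q).
Definition qinv (p : quotient_type) := qproj (qrep p)^-1.

Lemma qprojM x y : qproj (x * y) = qmul (qproj x) (qproj y).
Proof.
apply/qproj_eq => /=.
have -> : (x * y)^-1 * (coset_rep x * coset_rep y) =
    (x^-1 * coset_rep x) ^ y * (y^-1 * coset_rep y).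
  by rewrite conjgE invgM !mulgA mulgK.
have h u : N (u^-1 * coset_rep u).
  by have := subgroupV NG (coset_repP u); rewrite invgM invgK.
by apply: subgroupM => //; exact: Nn.
Qed.

Lemma qprojV x : qproj x^-1 = qinv (qproj x).
Proof.
apply/qproj_eq; rewrite invgK /=.
have := Nn (x^-1) (coset_repP x).
by rewrite conjgE invgK mulgK.
Qed.

Lemma qmulA : associative qmul.
Proof.
move=> p q r; rewrite -(qprojK p) -(qprojK q) -(qprojK r).
by rewrite -!qprojM mulgA.
Qed.
Lemma qmul1 : left_id (qproj 1) qmul.
Proof. by move=> p; rewrite -(qprojK p) -!qprojM mul1g. Qed.
Lemma qmulg1 : right_id (qproj 1) qmul.
Proof. by move=> p; rewrite -(qprojK p) -!qprojM mulg1. Qed.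
Lemma qmulV : left_inverse (qproj 1) qinv qmul.
Proof. by move=> p; rewrite -(qprojK p) -qprojV -!qprojM mulVg. Qed.
Lemma qmulgV : right_inverse (qproj 1) qinv qmul.
Proof. by move=> p; rewrite -(qprojK p) -qprojV -!qprojM mulgV. Qed.

End LeftCosets.

Lemma quotient_exists (G : groupType) (N : set G) :
  is_subgroup N -> (forall x g, N x -> N (x ^ g)%g) ->
  exists (Q : groupType) (f : G -> Q),
    [/\ {morph f : x y / (x * y)%g}, forall q, exists x, f x = q &
        forall x, f x = 1%g <-> N x].
Proof.
move=> NG Nn; pose Q := quotient_type NG.
pose Q' : groupType := HB.pack Q (isGroup.Build Q (qmulA Nn) (qmul1 Nn)
  (qmulg1 Nn) (qmulV Nn) (qmulgV Nn)).
exists Q', (@qproj G N NG); split.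
- exact: qprojM.
- by move=> q; exists (qrep q); exact: qprojK.
- move=> x; split=> [e|Nx].
    have /qproj_eq : qproj NG 1 = qproj NG x by rewrite e.
    by rewrite invg1 mul1g.
  by apply/esym/qproj_eq; rewrite invg1 mul1g.
Qed.

(** * Integral characters of subgroups and the transfer *)

Section SubgroupCharacters.
Variables (G : groupType) (H : set G) (HG : is_subgroup H).
Local Open Scope group_scope.

(** A character of [H] is a total function on [G], constrained on [H] only; it restricts to smaller
    subgroups as it is. *)
Definition additive_on (f : G -> int) : Prop :=
  forall x y, H x -> H y -> f (x * y) = (f x + f y)%R.

Variable f : G -> int.
Hypothesis fM : additive_on f.

Lemma additive1 : f 1 = 0%R.
Proof.
have := fM (subgroup1 HG) (subgroup1 HG); rewrite mulg1 => /eqP.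
by rewrite -subr_eq0 opprD addNKr oppr_eq0 => /eqP.
Qed.

Lemma additiveV x : H x -> f x^-1 = (- f x)%R.
Proof.
move=> Hx; have := fM Hx (subgroupV HG Hx); rewrite mulgV additive1 => /eqP.
by rewrite eq_sym addrC addr_eq0 => /eqP.
Qed.

Lemma additiveX x (n : nat) : H x -> f (x ^+ n) = (n%:Z * f x)%R.
Proof.
move=> Hx; elim: n => [|n IH]; first by rewrite additive1 mul0r.
have HX : H (x ^+ n) by have := subgroup_zpow (Posz n) HG Hx.
by rewrite expgS fM // IH -addn1 PoszD; ring.
Qed.

Lemma additive_zpow x (n : int) : H x -> f (zpow x n) = (n * f x)%R.
Proof.
move=> Hx; case: n => n; first exact: additiveX.
have HX : H (x ^+ n.+1) by have := subgroup_zpow (Posz n.+1) HG Hx.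
by rewrite [zpow _ _]/(x ^- n.+1) additiveV // additiveX // NegzE; ring.
Qed.

Lemma covered_residues (n : nat) : (0 < n)%N ->
  exists T, covered H [set x | H x /\ (n%:Z %| f x)%Z] T.
Proof.
move=> n0.
pose ch (r : nat) := if pselect (exists x, H x /\ (f x %% n)%Z = r) is left h
  then sval (cid h) else 1.
exists (map ch (iota 0 n)) => x Hx.
have rx : (`|(f x %% n)%Z|%N < n)%N.
  by rewrite -ltz_nat gez0_abs ?modz_ge0 ?gt_eqF // ltz_pmod.
have rE : Posz `|(f x %% n)%Z|%N = (f x %% n)%Z by rewrite gez0_abs ?modz_ge0 ?gt_eqF.
exists (ch `|(f x %% n)%Z|%N); first by apply: map_f; rewrite mem_iota.
rewrite /ch; case: pselect => [h|h]; last by exfalso; apply: h; exists x.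
case: cid => /= y [Hy ey]; split; first by apply: subgroupM => //; exact: subgroupV.
rewrite fM ?additiveV //; last exact: subgroupV.
by rewrite addrC -eqz_mod_dvd ey rE.
Qed.

End SubgroupCharacters.

Section Transfer.
Variables (G : groupType) (H A : set G).
Local Open Scope group_scope.
Hypotheses (HG : is_subgroup H) (AG : is_subgroup A) (AH : A `<=` H).
Hypothesis Ac : forall a h, A a -> H h -> commute a h.
Variable T : seq G.
Hypothesis hT : covered H A T.

Let rep := coset_rep AG.

Let repH h : H h -> H (rep h).
Proof.
move=> Hh; have := coset_repP AG h => /AH h1.
have := subgroupM HG Hh (subgroupV HG h1).
by rewrite invgM invgK mulVKg.
Qed.

(** The transfer to the central subgroup [A], composed with [chi]: the sum over coset
    representatives [t] of the value of [chi] on the [A]-part of [h * t]. By centrality it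
    multiplies [chi] by the index [n] on [A]; the same [n] serves for all characters. *)
Lemma transfer : exists2 n : nat, (0 < n)%N &
  forall chi, additive_on A chi -> exists tau : G -> int, additive_on H tau /\
    forall a, A a -> tau a = (n%:Z * chi a)%R.
Proof.
have [T' T'H hT'] := covered_sub AG HG (@subset_refl _ H) hT.
pose R := undup (map rep T').
have Rh h : H h -> rep h \in R.
  move=> Hh; have [t tT [_ At]] := hT' h Hh.
  have e : rep t = rep h := coset_rep_eq AG At.
  by rewrite mem_undup -e; exact: map_f.
have RH t : t \in R -> H t.
  by rewrite mem_undup => /mapP[u uT ->]; apply: repH; exact: T'H.
have Rr t : t \in R -> rep t = t.
  by rewrite mem_undup => /mapP[u uT ->]; exact: coset_repK.
have R0 : (0 < size R)%N.
  by have := Rh 1 (subgroup1 HG); case: (R).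
exists (size R) => // chi chiM.
pose al h t := (rep (h * t))^-1 * (h * t).
have alA h t : A (al h t) by exact: coset_repP.
exists (fun h => \sum_(t <- R) chi (al h t))%R; split.
  move=> h k Hh Hk.
  pose s t := rep (k * t).
  (* Multiplication by [k] permutes the cosets; reindexing by this permutation gives additivity. *)
  have sR : perm_eq R (map s R).
    have us : uniq (map s R).
      rewrite map_inj_in_uniq ?undup_uniq // => t u tR uR e.
      rewrite -(Rr t tR) -(Rr u uR); apply: coset_rep_eq.
      by have /coset_rep_iff := e; rewrite invgM -mulgA mulKg.
    rewrite perm_sym; apply: uniq_perm; rewrite ?undup_uniq //.
    apply: (uniq_min_size us _ _).2; last by rewrite size_map.
    by move=> _ /mapP[t /RH tR ->]; apply: Rh; exact: subgroupM.
  rewrite [X in (X + _)%R](perm_big _ sR) /= big_map -big_split /=.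
  rewrite big_seq [RHS]big_seq; apply: eq_bigr => t tR.
  rewrite -chiM //; congr chi.
  have kt : k * t = s t * al k t by rewrite /al /s mulVKg.

  have Hst : H (s t) by apply: repH; apply: subgroupM => //; exact: RH.
  have e2 : h * k * t = h * s t * al k t.
    by rewrite -[h * k * t]mulgA kt [h * (_ * _)]mulgA.
  have e1 : rep (h * k * t) = rep (h * s t).
    by apply/esym/coset_rep_eq; rewrite e2 mulKg.
  by rewrite [LHS]/al e1 e2 mulgA.
move=> a Aa.
transitivity (\sum_(t <- R) chi a)%R.
  rewrite big_seq [RHS]big_seq; apply: eq_bigr => t tR; congr chi.
  have e : a * t = t * a by apply: Ac => //; exact: RH.
  have -> : al a t = (rep (t * a))^-1 * (t * a) by rewrite /al e.
  have -> : rep (t * a) = t.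
    rewrite -[RHS](Rr t tR); apply/esym/coset_rep_eq.
    by rewrite mulKg.
  by rewrite mulKg.
by rewrite big_const_seq count_predT iter_addr_0 -mulr_natl natz.
Qed.

End Transfer.
Section CosetAction.
Variables (G : groupType) (N : set G) (NG : is_subgroup N).
Local Open Scope group_scope.

Definition coset_act (g : G) (q : quotient_type NG) : quotient_type NG :=
  qproj NG (g * qrep q).

Lemma coset_actE g x : coset_act g (qproj NG x) = qproj NG (g * x).
Proof.
apply: (qproj_eq NG _ _).2 => /=.
have := subgroupV NG (coset_repP NG x).
rewrite invgM invgK => h.
have -> : (g * coset_rep NG x)^-1 * (g * x) = (x^-1 * coset_rep NG x)^-1.
  by rewrite !invgM invgK -mulgA mulKg.
exact: (subgroupV NG h).
Qed.

Lemma coset_act_action : group_action coset_act.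
Proof.
split=> [q|g h q]; first by rewrite /coset_act mul1g qprojK.
by rewrite -(qprojK q) !coset_actE mulgA.
Qed.

Lemma coset_act_fix g q : coset_act g q = q <-> N (g ^ qrep q).
Proof.
rewrite -{2}(qprojK q) qproj_eq; split=> /(subgroupV NG);
  by rewrite !conjgE !invgM !invgK // -!mulgA.
Qed.

End CosetAction.

(** * Maps to Z^2 *)

Definition cyc2 (G : groupType) (c z : G) : set G :=
  [set x | exists i j : int, x = (zpow c i * zpow z j)%g].

(* The virtually cyclic subgroups of [H] are recognised by the slope of their
   image in Z^2. *)
Definition rank2_map (G : groupType) (H : set G) (f1 f2 : G -> int) : Prop :=
  [/\ additive_on H f1, additive_on H f2 &
      forall a b : int, (a, b) <> (0, 0)%R ->
        vc_sub [set h | H h /\ (a * f1 h + b * f2 h = 0)%R]].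

Section Rank2.
Variables (G : groupType).
Local Open Scope group_scope.
Implicit Types (H : set G) (c z : G) (T : seq G).

(** Some positive power of each [k] is a power of [d], and the integers are torsion-free: a linear
    form vanishing on the image of [d] vanishes on that of [K]. *)
Lemma rank2_map_kills H f1 f2 K : is_subgroup H -> rank2_map H f1 f2 -> vc_sub K -> K `<=` H ->
  exists a b : int, (a, b) <> (0, 0)%R /\ forall k, K k -> (a * f1 k + b * f2 k = 0)%R.
Proof.
move=> HG [h1 h2 _] [KG [d Kd [T hT]]] KH.
have [a [b [ab ed]]] : exists a b : int, (a, b) <> (0, 0)%R /\ (a * f1 d + b * f2 d = 0)%R.
  have [e1|n1] := eqVneq (f1 d) 0%R.
    by exists 1%R, 0%R; rewrite e1 mulr0 mul0r addr0.
  exists (f2 d), (- f1 d)%R; split; last by ring.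
  by move=> [_ /eqP]; rewrite oppr_eq0 => /eqP e; rewrite e eqxx in n1.
exists a, b; split=> // k Kk.
have [e e0 [n _ en]] := vc_sub_powers_meet KG hT Kk.
have Hk := KH _ Kk; have Hd := KH _ Kd.
have E f : additive_on H f -> (e%:Z * f k = n * f d)%R.
  by move=> fM; rewrite -(additiveX HG fM) // -(additive_zpow HG fM) // en.
have e0' : (e%:Z != 0)%R by rewrite eqz_nat -lt0n.
apply/eqP; rewrite -(mulrI_eq0 _ (lregP e0')).
by rewrite mulrDr !mulrA ![(e%:Z * _)%R]mulrC -!mulrA !E // !mulrA ![(_ * n)%R]mulrC -!mulrA
  -mulrDr ed mulr0.
Qed.

Lemma vc_rank2_map H : vc_sub H -> rank2_map H (fun=> 0%R) (fun=> 0%R).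
Proof.
move=> Hvc; split; try by move=> x y _ _; rewrite addr0.
move=> a b _; rewrite (_ : [set h | _] = H) //.
by apply/seteqP; split=> [h []//|h Hh]; rewrite /= !mulr0 addr0.
Qed.

Section Commuting.
Variables (c z : G).
Hypothesis cz : commute c z.

Lemma zpow_comm i j : zpow c i * zpow z j = zpow z j * zpow c i.
Proof.
by apply: commute_zpow; apply: commute_sym; apply: commute_zpow; exact: commute_sym.
Qed.

Lemma cyc2M i j i' j' : (zpow c i * zpow z j) * (zpow c i' * zpow z j') =
  zpow c (i + i')%R * zpow z (j + j')%R.
Proof.
by rewrite !zpowD !mulgA; congr (_ * _); rewrite -!mulgA; congr (_ * _); rewrite zpow_comm.
Qed.

Lemma cyc2V i j : (zpow c i * zpow z j)^-1 = zpow c (- i)%R * zpow z (- j)%R.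
Proof. by rewrite invgM -!zpowN zpow_comm. Qed.

Lemma cyc2_subgroup : is_subgroup (cyc2 c z).
Proof.
split; first by exists 0%R, 0%R; rewrite mulg1.
move=> _ _ [i [j ->]] [i' [j' ->]]; rewrite cyc2V cyc2M.
by do 2!eexists.
Qed.

Lemma cyc2_zpow i j n : zpow (zpow c i * zpow z j) n = zpow c (i * n)%R * zpow z (j * n)%R.
Proof. by rewrite zpow_mul ?zpowM //; exact: zpow_comm. Qed.

Lemma covered_cyc2_power (k : nat) : (0 < k)%N ->
  exists T, covered (cyc2 c z) (cyc2 (c ^+ k) z) T.
Proof.
move=> k0; have [T hT] := covered_cyc_power c k0; exists T => _ [i [j ->]].
have [t tT [n _ e]] := hT (zpow c i) (ex_intro2 _ _ i I erefl).
by exists t => //; exists n, j; rewrite e mulgA.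
Qed.

Lemma covered_cyc2_relation i j : j <> 0%R -> zpow c i * zpow z j = 1 ->
  exists T, covered (cyc2 c z) (cyc c) T.
Proof.
move=> j0 e.
have jn : (0 < `|j|)%N by rewrite absz_gt0; apply/eqP.
have [T hT] := covered_cyc_power z jn.
have zj : zpow z j = zpow c (- i)%R.
  by rewrite zpowN; apply: (mulgI (zpow c i)); rewrite e mulgV.
have zjn : cyc c (z ^+ `|j|).
  rewrite -zpow_nat; have [jp|jneg] := leP 0%R j.
    by rewrite gez0_abs // zj; exists (- i)%R.
  by rewrite ltz0_abs // zpowN zj -zpowN opprK; exists i.
exists T => _ [a [b ->]].
have [t tT [n _ en]] := hT (zpow z b) (ex_intro2 _ _ b I erefl).
exists t => //; rewrite zpow_comm mulgA -en.
apply: subgroupM; [exact: cyc_subgroup| |by exists a].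
by apply: subgroup_zpow => //; exact: cyc_subgroup.
Qed.

End Commuting.

Lemma vc_of_relation H c z T i j : is_subgroup H -> commute c z -> H c -> H z ->
  covered H (cyc2 c z) T -> (i, j) <> (0, 0)%R -> zpow c i * zpow z j = 1 -> vc_sub H.
Proof.
move=> HG cz Hc Hz hT ij e.
have [j0|/eqP j0] := eqVneq j 0%R.
  have i0 : i <> 0%R by move=> i0; apply: ij; rewrite i0 j0.
  split=> //; exists z => //.
  apply: (@covered_trans _ H (cyc2 c z) (cyc z) T hT).
  rewrite (zpow_comm cz) in e.
  have [T2 h2] := covered_cyc2_relation (commute_sym cz) i0 e.
  by exists T2 => _ [a [b ->]]; rewrite (zpow_comm cz); apply: h2; exists b, a.
split=> //; exists c => //; apply: covered_trans hT _.
exact: covered_cyc2_relation j0 e.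
Qed.

(** The two coordinates of the central free abelian subgroup [cyc2 c z] extend to [H] by transfer,
    up to the factor [n]. The subgroup killed by a nonzero linear form then meets [cyc2 c z], which
    has finite index, in a group of rank 1. *)
Lemma central_rank2_map H c z T : is_subgroup H -> H c -> H z ->
  (forall h, H h -> commute c h) -> (forall h, H h -> commute z h) ->
  covered H (cyc2 c z) T ->
  (forall i j, zpow c i * zpow z j = 1 -> (i, j) = (0, 0)%R) ->
  exists f1 f2, rank2_map H f1 f2.
Proof.
move=> HG Hc Hz cC zC hT inj.
have cz : commute c z by exact: cC.
have AG := cyc2_subgroup cz; pose A := cyc2 c z.
have AH : A `<=` H.
  by move=> _ [i [j ->]]; apply: subgroupM => //; exact: subgroup_zpow.
have Ac a h : A a -> H h -> commute a h.
  move=> [i [j ->]] Hh; apply: commute_sym; apply: commuteM; apply: commute_zpow;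
  apply: commute_sym; [exact: cC|exact: zC].
have [n n0 tr] := transfer HG AG AH Ac hT.
have inj2 i j i' j' : zpow c i * zpow z j = zpow c i' * zpow z j' -> i = i' /\ j = j'.
  move=> e; have := cyc2M cz i j (- i')%R (- j')%R.
  rewrite -(cyc2V cz) e mulgV => /esym /inj [/eqP h1 /eqP h2].
  by move: h1 h2; rewrite !subr_eq0 => /eqP -> /eqP ->.
pose co a : int * int := if pselect (exists ij : int * int, a = zpow c ij.1 * zpow z ij.2)
  is left h then sval (cid h) else (0, 0)%R.
have coE i j : co (zpow c i * zpow z j) = (i, j).
  rewrite /co; case: pselect => [h|]; last by case; exists (i, j).
  by case: cid => -[i' j'] /= /inj2 [-> ->].
have co1 : additive_on A (fun a => (co a).1).
  by move=> _ _ [i [j ->]] [i' [j' ->]]; rewrite (cyc2M cz) !coE.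
have co2 : additive_on A (fun a => (co a).2).
  by move=> _ _ [i [j ->]] [i' [j' ->]]; rewrite (cyc2M cz) !coE.
have [f1 [f1M f1E]] := tr _ co1; have [f2 [f2M f2E]] := tr _ co2.
exists f1, f2; split=> // a b ab.
set L := [set h | _].
have LG : is_subgroup L.
  split; first by split; [exact: subgroup1|rewrite !(additive1 HG) // !mulr0].
  move=> x y [Hx ex] [Hy ey]; split; first exact: HG.2.
  have HV := subgroupV HG Hy.
  rewrite f1M // f2M // !(additiveV HG) //.
  by transitivity ((a * f1 x + b * f2 x) - (a * f1 y + b * f2 y))%R;
    [ring|rewrite ex ey subrr].
have LH : L `<=` H by move=> h [].
have [T' T'L hT'] := covered_sub AG LG LH hT.
(* The vector with coordinates [b] and [- a] spans rationally the kernel of the form with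
   coefficients [a] and [b]. *)
pose w := zpow c b * zpow z (- a)%R.
have Lw : L w.
  split; first by apply: AH; exists b, (- a)%R.
  by rewrite f1E ?f2E /= ?coE /=; [ring|exists b, (- a)%R|exists b, (- a)%R].
split=> //; exists w => //; apply: (covered_trans hT').
have BG : is_subgroup (L `&` A) by exact: subgroupI.
have n0' : (n%:Z != 0)%R by rewrite eqz_nat -lt0n.
have rel i j : L (zpow c i * zpow z j) -> (a * i + b * j = 0)%R.
  move=> [_ e]; apply/eqP; rewrite -(mulrI_eq0 _ (lregP n0')).
  move: e; rewrite f1E ?f2E /= ?coE /=; [|by exists i, j|by exists i, j].
  by move=> <-; apply/eqP; ring.
(* If [a] and [b] are not coprime, [w] generates only a subgroup of finite index of the kernel: the
   elements whose first coordinate is divisible by [b] when [a = 0], and otherwise those whose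
   second coordinate is divisible by [a]. *)
have [a0|a0] := eqVneq a 0%R.
  have b0 : b != 0%R by apply/eqP => b0; apply: ab; rewrite a0 b0.
  have bn : (0 < `|b|)%N by rewrite absz_gt0.
  have co1' : additive_on (L `&` A) (fun a => (co a).1).
    by move=> x y [_ Ax] [_ Ay]; exact: co1.
  have [T2 h2] := covered_residues BG co1' bn; exists T2.
  apply: coveredS h2 => x [[Lx [i [j ex]]]]; subst x.
  rewrite coE /= => /dvdzP[q iq]; have := rel i j Lx.
  rewrite a0 mul0r add0r => /eqP; rewrite mulf_eq0 (negbTE b0) /= => /eqP ->.
  have [bp|bneg] := leP 0%R b.
    by exists q => //; rewrite (cyc2_zpow cz) a0 oppr0 mul0r iq gez0_abs // mulrC.
  exists (- q)%R => //.
  rewrite (cyc2_zpow cz) a0 oppr0 mul0r iq ltz0_abs //.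
  by congr (zpow c _ * _); ring.
have an : (0 < `|a|)%N by rewrite absz_gt0.
have co2' : additive_on (L `&` A) (fun a => (co a).2).
  by move=> x y [_ Ax] [_ Ay]; exact: co2.
have [T2 h2] := covered_residues BG co2' an; exists T2.
apply: coveredS h2 => x [[Lx [i [j ex]]]]; subst x.
rewrite coE /= => /dvdzP[q0 jq]; have := rel i j Lx.
have [q jq'] : exists q, j = (a * q)%R.
  have [ap|aneg] := leP 0%R a.
    by exists q0; rewrite jq gez0_abs // mulrC.
  by exists (- q0)%R; rewrite jq ltz0_abs // mulrC; ring.
rewrite jq' => e.
have ei : i = (- b * q)%R.
  apply: (mulfI a0); apply/eqP; rewrite -subr_eq0; apply/eqP.
  by rewrite -[RHS]e; ring.
exists (- q)%R => //; rewrite (cyc2_zpow cz) ei.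
by congr (zpow c _ * zpow z _); ring.
Qed.

(* The nilpotency of [H] enters through the Engel condition: it prevents the
   conjugation by an element of [H] from inverting [c] modulo [z]. *)
Lemma engel_rank2_map H c z T n : is_subgroup H -> H c -> H z ->
  (forall h, H h -> commute z h) -> covered H (cyc2 c z) T ->
  (forall u h, H u -> H h -> iter n (fun u => [~ u, h]) u = 1) ->
  exists f1 f2, rank2_map H f1 f2.
Proof.
move=> HG Hc Hz zC hT engel.
have cz : commute c z by apply: commute_sym; exact: zC.
have AG := cyc2_subgroup cz.
have [Hvc|nvc] := pselect (vc_sub H).
  by exists (fun=> 0%R), (fun=> 0%R); exact: vc_rank2_map.
have inj i j : zpow c i * zpow z j = 1 -> (i, j) = (0, 0)%R.
  by move=> e; apply: contrapT => ij; apply: nvc; exact: vc_of_relation cz Hc Hz hT ij e.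
have inj2 i j i' j' : zpow c i * zpow z j = zpow c i' * zpow z j' -> i = i' /\ j = j'.
  move=> e; have := cyc2M cz i j (- i')%R (- j')%R.
  rewrite -(cyc2V cz) e mulgV => /esym /inj [/eqP h1 /eqP h2].
  by move: h1 h2; rewrite !subr_eq0 => /eqP -> /eqP ->.
have zJ h j : H h -> (zpow z j) ^ h = zpow z j.
  move=> Hh; rewrite zpowJ; congr zpow.
  by rewrite conjgE (zC h Hh) mulKg.
have central h : H h -> exists2 k, (0 < k)%N & commute (c ^+ k) h.
  move=> Hh.
  have [k k0 [l [m hc]]] : exists2 k, (0 < k)%N & cyc2 c z ((c ^+ k) ^ h).
    have HJ u : H u -> H (u ^ h).
      by move=> Hu; rewrite conjgE; do 2?apply: subgroupM => //; exact: subgroupV.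
    have [|i [j [/andP[ij _] hA]]] :=
      @covered_pigeonhole _ H (cyc2 c z) T (fun i => (c ^+ i) ^ h) AG hT.
      by move=> i; apply: HJ; have := subgroup_zpow (Posz i) HG Hc.
    exists (j - i)%N; first by rewrite subn_gt0.
    move: hA; rewrite -conjVg -conjMg -{1}(subnKC (ltnW ij)) expgnDr mulKg //.
  have cJ (i : int) : (zpow c (k%:Z * i)%R) ^ h = zpow c (l * i)%R * zpow z (m * i)%R.
    by rewrite zpowM zpowJ zpow_nat hc (cyc2_zpow cz).
  have comm i j : [~ zpow c (k%:Z * i)%R * zpow z j, h] =
      zpow c ((l - k%:Z) * i)%R * zpow z (m * i)%R.
    rewrite commgEl conjMg cJ zJ // (cyc2V cz) -[in X in _ * X]mulgA -zpowD (cyc2M cz).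
    by congr (zpow c _ * zpow z _); ring.
  (* Only powers of [c ^+ k] have a known conjugate by [h]: each commutator consumes a factor [k] of
     the exponent of [c] and multiplies it by [l - k]. Starting from [k ^+ n.+1] allows [n]
     commutators, and the Engel condition gives [k * (l - k) ^+ n = 0]. *)
  have it s : (s <= n)%N -> exists j, iter s (fun u => [~ u, h]) (zpow c (k%:Z ^+ n.+1)%R) =
      zpow c (k%:Z ^+ (n.+1 - s) * (l - k%:Z) ^+ s)%R * zpow z j.
    elim: s => [|s IH] sn; first by exists 0%R; rewrite subn0 expr0 mulr1 mulg1.
    have [j /= ->] := IH (ltnW sn).
    have -> : (n.+1 - s = (n - s).+1)%N by rewrite subSn // ltnW.
    rewrite exprS -mulrA comm; eexists; congr (zpow c _ * _).
    by rewrite subSS exprS; ring.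
  have lk : l = Posz k.
    have [j] := it n (leqnn n); rewrite engel //; last exact: subgroup_zpow.
    move=> /esym /inj [/eqP + _].
    rewrite subSnn expr1 mulf_eq0 => /orP[|]; first by rewrite eqz_nat gtn_eqF.
    by rewrite expf_eq0 subr_eq0 => /andP[_ /eqP].
  subst l.
  (* The power [h ^+ e] lies in the abelian group [cyc2 c z], so it centralises [c ^+ k]; but
     conjugation by it multiplies [c ^+ k] by [zpow z (m * e)]. Hence [m = 0]. *)
  have [e e0 [i [j he]]] := covered_power HG AG hT Hh.
  have cs s : (c ^+ k) ^ (h ^+ s) = zpow c (Posz k) * zpow z (m * s%:Z)%R.
    elim: s => [|s IH]; first by rewrite conjg1 mulr0 mulg1.
    rewrite expgSr conjgM IH conjMg zJ // zpow_nat hc zpow_nat -mulgA -zpowD.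
    by congr (_ * zpow z _); rewrite -addn1 PoszD; ring.
  have me : (m * e%:Z = 0)%R.
    have : (c ^+ k) ^ (h ^+ e) = zpow c (Posz k) * zpow z 0%R.
      rewrite mulg1 zpow_nat conjgE he.
      have -> : c ^+ k * (zpow c i * zpow z j) = (zpow c i * zpow z j) * c ^+ k.
        by have := cyc2M cz (Posz k) 0%R i j; rewrite mulg1 zpow_nat => ->;
           have := cyc2M cz i j (Posz k) 0%R; rewrite mulg1 zpow_nat => ->;
           rewrite addrC [(0 + _)%R]addrC.
      by rewrite mulKg.
    by rewrite cs => /inj2 [_].
  have m0 : m = 0%R.
    by move/eqP: me; rewrite mulf_eq0 eqz_nat (gtn_eqF e0) orbF => /eqP.
  exists k => //; rewrite m0 mulg1 zpow_nat in hc.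
  by rewrite /commute {2}(esym hc) -conjgC.
have [T' T'H hT'] := covered_sub AG HG (@subset_refl _ H) hT.
(* The product of the exponents found for the coset representatives serves for all of them, and the
   remaining factor in [cyc2 c z] commutes with [c] anyway. *)
have [k k0 kT] : exists2 k, (0 < k)%N & forall t, t \in T' -> commute (c ^+ k) t.
  have : forall t, t \in T' -> H t by [].
  elim: (T') => [|t s IH] sH; first by exists 1%N.
  have [u us|k k0 ks] := IH; first by apply: sH; rewrite inE us orbT.
  have [|k' k'0 kt] := central t; first by apply: sH; rewrite inE eqxx.
  exists (k * k')%N; first by rewrite muln_gt0 k0.
  move=> u; rewrite inE => /predU1P[->|us].
    by rewrite mulnC expgnA; apply: commute_sym; apply: commuteX; exact: commute_sym.
  by rewrite expgnA; apply: commute_sym; apply: commuteX; apply: commute_sym; exact: ks.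
have Hck : H (c ^+ k) by have := subgroup_zpow (Posz k) HG Hc.
have [T2 h2] := covered_cyc2_power c z k0.
have [T3 h3] := covered_trans hT (ex_intro _ T2 h2).
apply: (@central_rank2_map H (c ^+ k) z T3) => //.
  move=> h Hh; have [t tT [_ [i [j e]]]] := hT' h Hh.
  have -> : h = t * (zpow c i * zpow z j) by rewrite -e mulVKg.
  apply: commuteM; first exact: kT.
  apply: commuteM; apply: commute_zpow; last first.
    by apply: commute_sym; exact: zC.
  by apply: commute_sym; apply: commuteX; exact: commute_refl.
move=> i j; rewrite -zpow_nat -zpowM => /inj [/eqP].
by rewrite mulf_eq0 eqz_nat (gtn_eqF k0) /= => /eqP -> ->.
Qed.

End Rank2.

(** * Classifying spaces *)

(* A finite dimensional classifying space of [G] for virtually cyclic subgroups. *)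
Definition finite_vc_model (G : groupType) : Prop :=
  exists (P : gposet G) (B m : nat),
    [/\ small_down_sets P B, forall p : P, vc_sub (pstab p) &
        forall K, vc_sub K -> contractible_poset (@pfix G P K) m].

Lemma pstab_subgroup (G : groupType) (P : gposet G) (p : P) : is_subgroup (pstab p).
Proof.
split; first exact: gact1.
move=> g h hg hh; rewrite /pstab /= gactM.
by have := gactK h p; rewrite hh => ->.
Qed.

(** * Classifying spaces made of sections *)

Section SectionsModel.
Variables (G : groupType) (X : gposet G) (BX mX : nat).
Hypothesis X_small : small_down_sets X BX.
Hypothesis X_fix : forall K, vc_sub K -> contractible_poset (@pfix G X K) mX.
Variables (Y : choiceType) (a : G -> Y -> Y).
Hypothesis aP : group_action a.
Variables (S : X -> Y -> Prop) (BS : nat).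
Hypothesis S_le : forall x x' y, ple x x' -> S x y -> S x' y.
Hypothesis S_act : forall g x y, S x y -> S (gact g x) (a g y).
Hypothesis S_ex : forall x, exists y, S x y.
Hypothesis S_small : forall x, exists2 s : seq Y, size s <= BS & forall y, S x y -> y \in s.
Variables (E : poset) (BE mE : nat).
Hypothesis E_small : small_down_sets E BE.
Variable r : Y -> G -> E -> E.
Hypothesis r1 : forall y e, r y 1%g e = e.
Hypothesis rM : forall y g h e, a g y = y -> a h y = y -> r y (g * h)%g e = r y g (r y h e).
Hypothesis r_le : forall y g e e', a g y = y -> ple e e' -> ple (r y g e) (r y g e').
Hypothesis r_stab : forall y e, exists2 L, vc_sub L &
  forall g, a g y = y -> r y g e = e -> L g.
Hypothesis r_fix : forall y K, vc_sub K -> (forall k, K k -> a k y = y) ->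
  contractible_poset [set e | forall k, K k -> r y k e = e] mE.

Let TG : is_subgroup [set: G] := subgroupT G.
Let rp := orbit_rep aP TG.
Let tr := to_rep aP TG.

Let al g y := (tr (a g y) * g * (tr y)^-1)%g.

Let al_stab g y : a (al g y) (rp y) = rp y.
Proof. by apply: (to_rep_cocycle aP (K := [set: G])). Qed.

Let rp_act g y : rp (a g y) = rp y.
Proof. exact: orbit_rep_act. Qed.

(** The fibre over [y] is identified with that over its orbit representative by means of [tr y];
    only the actions [r] of the stabilisers of representatives intervene. *)
Let b g y e := r (rp y) (al g y) e.

Let b1 y e : b 1%g y e = e.
Proof. by rewrite /b /al aP.1 mulg1 mulgV r1. Qed.

Let bM g h y e : b (g * h)%g y e = b g (a h y) (b h y e).
Proof.
have h1 : a (al g (a h y)) (rp y) = rp y by have := al_stab g (a h y); rewrite rp_act.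
rewrite /b rp_act -(rM _ h1 (al_stab h y)).
by congr (r _ _ _); rewrite /al aP.2 !mulgA mulgVK.
Qed.

Let b_le g y e e' : ple e e' -> ple (b g y e) (b g y e').
Proof. by apply: r_le; exact: al_stab. Qed.

Let S_finite x : exists s : seq Y, forall y, S x y -> y \in s.
Proof. by have [s _ hs] := S_small x; exists s. Qed.

Let al_fixed g y : a g y = y -> al g y = (g ^ (tr y)^-1)%g.
Proof. by move=> gy; rewrite /al gy conjgE invgK mulgA. Qed.

(** The stabiliser of a section permutes the finitely many points of its domain. The subgroup fixing
    one of them, [y], thus has finite index, and it fixes a point of the fibre over [y], which makes
    it virtually cyclic by [r_stab]. *)
Lemma sections_model : finite_vc_model G.
Proof.
exists (sections aP S_act b1 bM b_le), (BX * BE.+1 ^ BS), (mE + mX).+1; split.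
- exact: (section_small S_le).
- move=> s; have [y Sy] := S_ex (base s).
  have [e he] := section_pstab Sy.
  have [L Lvc hL] := r_stab (rp y) e.
  have HG : is_subgroup (pstab s) by exact: pstab_subgroup.
  pose Hy := pstab s `&` [set g | a g y = y].
  have HyG : is_subgroup Hy.
    apply: subgroupI => //; split=> [|g h /= gy hy]; first exact: aP.1.
    by rewrite aP.2 -{1}hy group_actionK.
  have Hyvc : vc_sub Hy.
    apply: (vc_subS (vc_sub_conj (tr y)^-1%g Lvc) HyG) => g [gs gy].
    apply: hL; first by rewrite -al_fixed // al_stab.
    by have := he g gs gy; rewrite {1}/b al_fixed.
  have [l hl] := S_finite (base s).
  pose ch z := if pselect (exists2 h, pstab s h & a h y = z) is left h
    then s2val (cid2 h) else 1%g.
  apply: (@vc_sub_extension _ _ Hy (map ch l)) => // [g []//|h hs].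
  have hS : S (base s) (a h y).
    by have := S_act h Sy; have -> : gact h (base s) = base s by exact: section_pstab_base hs.
  exists (ch (a h y)); first by apply: map_f; exact: hl.
  rewrite /ch; case: pselect => [hh|]; last by case; exists h.
  case: cid2 => /= k ks ky; split; first by apply: subgroupM => //; exact: subgroupV.
  by rewrite /= aP.2 -ky group_actionK.
- move=> K Kvc; have KG := Kvc.1.
  apply: (sections_contractible aP S_le S_act b1 bM S_finite b_le KG (X_fix Kvc)) => y.
  pose Ky := K `&` [set g | a g y = y].
  have KyG : is_subgroup Ky.
    apply: subgroupI => //; split=> [|g h /= gy hy]; first exact: aP.1.
    by rewrite aP.2 -{1}hy group_actionK.
  have Kyvc : vc_sub Ky by apply: (vc_subS Kvc KyG) => g [].
  have K'vc := vc_sub_conj (tr y) Kyvc.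
  have K'fix k : [set x | Ky (x ^ tr y)%g] k -> a k (rp y) = rp y.
    move=> [_ /=]; rewrite conjgE !aP.2 => e.
    have h : a (tr y) y = rp y := to_repE aP TG y.
    by have := congr1 (a (tr y)) e; rewrite group_actionVK // h.
  have := r_fix K'vc K'fix; congr contractible_poset.
  apply/seteqP; split=> e he.
    move=> k Kk ky; rewrite /b al_fixed //; apply: he.
    by rewrite /= conjgKV; split.
  move=> k [Kk ky]; have := he _ Kk ky; rewrite /b al_fixed //.
  by rewrite conjgK.
Qed.

End SectionsModel.

Section TrivialPoset.
Variable G : groupType.

Definition unit_poset : poset :=
  @Poset unit (fun _ _ => True) (fun _ => I)
    (fun x y _ _ => match x, y with tt, tt => erefl end) (fun _ _ _ _ _ => I).

Definition unit_gposet : gposet G :=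
  @GPoset G unit_poset (fun _ x => x) (fun _ => erefl) (fun _ _ _ => erefl) (fun _ _ _ _ => I).

Lemma unit_small : small_down_sets unit_poset 1.
Proof. by move=> x; exists [:: tt] => // -[] _; rewrite inE. Qed.

Lemma unit_contractible (K : set G) : contractible_poset (@pfix G unit_gposet K) 0.
Proof.
exists (fun _ _ x => x).
have z : zigzag (@pfix G unit_gposet K) (fun _ x => x) id.
  by split=> //; [move=> n p _; case: odd|move=> p _; exists 0].
by split=> //; exists tt => // -[].
Qed.

Lemma trivial_model : (forall g : G, g = 1%g) -> finite_vc_model G.
Proof.
move=> G1; exists unit_gposet, 1, 0; split.
- exact: unit_small.
- move=> p; apply: (vc_subS (vc_sub1 G)) => [|g _]; last exact: G1.
  exact: pstab_subgroup.
- by move=> K _; exact: unit_contractible.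
Qed.

End TrivialPoset.

(** * The model for Z^2 *)

Section Plane.
Local Open Scope ring_scope.

(* Lines through the origin of the rational plane are indexed by their slope, and
   [slope_form s] is a primitive integral form vanishing on the line [s]. *)
Definition slope_form (s : option rat) (u v : int) : int :=
  if s is Some q then denq q * u - numq q * v else v.

Lemma slope_form_add s u v u' v' :
  slope_form s (u + u') (v + v') = slope_form s u v + slope_form s u' v'.
Proof. by case: s => [q|] //=; ring. Qed.

Lemma slope_form0 s : slope_form s 0 0 = 0.
Proof. by case: s => [q|] //=; ring. Qed.

Lemma slope_form_coef s : exists a b : int, (a, b) <> (0, 0) /\
  forall u v, slope_form s u v = a * u + b * v.
Proof.
case: s => [q|]; last by exists 0, 1; split=> // u v; rewrite mul0r add0r mul1r.
exists (denq q), (- numq q); split=> [[/eqP + _]|u v]; first by rewrite denq_eq0.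
by rewrite /=; ring.
Qed.

Lemma slope_unique (u0 v0 : int) : (u0, v0) <> (0, 0) ->
  exists s0, (forall u v, u * v0 = u0 * v -> slope_form s0 u v = 0) /\
    forall s, slope_form s u0 v0 = 0 -> s = s0.
Proof.
move=> n0; have [v00|v0n] := eqVneq v0 0.
  have u0n : u0 != 0 by apply/eqP => u00; apply: n0; rewrite u00 v00.
  exists None; split=> [u v|].
    by rewrite v00 mulr0 => /esym/eqP; rewrite mulf_eq0 (negbTE u0n) => /eqP.
  case=> [q|//]; rewrite /= v00 mulr0 subr0 => /eqP.
  by rewrite mulf_eq0 denq_eq0 (negbTE u0n).
have v0q : v0%:~R != 0 :> rat by rewrite intr_eq0.
exists (Some (u0%:~R / v0%:~R)); split=> [u v e|[q /=|/= v00]]; last by rewrite v00 eqxx in v0n.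
  rewrite /=; set q : rat := _ / _; apply/eqP; rewrite subr_eq0 -(eqr_int rat).
  rewrite !intrM; have dn : (denq q)%:~R != 0 :> rat by rewrite intr_eq0 denq_eq0.
  have qE : (numq q)%:~R = q * (denq q)%:~R by rewrite -{2}(divq_num_den q) divfK.
  rewrite qE mulrAC [X in _ == X]mulrC; apply/eqP; congr (_ * _).
  rewrite /q mulrAC; apply: (mulIf v0q); rewrite divfK // -!intrM.
  by rewrite e.
move=> e; congr Some; rewrite -(divq_num_den q).
have dn : (denq q)%:~R != 0 :> rat by rewrite intr_eq0 denq_eq0.
apply/eqP; rewrite eqr_div //; apply/eqP; rewrite -!intrM; congr _%:~R.
by move/eqP: e; rewrite subr_eq0 => /eqP e; rewrite -e mulrC.
Qed.

Definition line : poset := fgraph (fun t : int => t + 1).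
Definition slope_lines : poset :=
  fgraph (fun t : option rat * int => (t.1, t.2 + 1)).
Definition plane_poset : poset := join line slope_lines.

(** The bound is [3.+1 * 3.+1], an edge of a line having 3 elements in its down-set. *)
Lemma plane_small : small_down_sets plane_poset 16.
Proof. exact: (join_small (@fgraph_small _ _) (@fgraph_small _ _)). Qed.

(** A nonzero linear form vanishes on the stabiliser of each point, so that stabilisers have rank at
    most 1. *)
Definition plane_act (u v : int) : plane_poset -> plane_poset :=
  join_map (fun t : line => (t.1 + v, t.2))
    (fun t : slope_lines => ((t.1.1, t.1.2 + slope_form t.1.1 u v), t.2)).

Lemma plane_act0 e : plane_act 0 0 e = e.
Proof.
by case: e => [[[t c]|[[s n] c]]|[[t c] [[s n] c']]]; rewrite /plane_act /= ?slope_form0 !addr0.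
Qed.

Lemma plane_actD u v u' v' e :
  plane_act (u + u') (v + v') e = plane_act u v (plane_act u' v' e).
Proof.
have h (x y w : int) : x + (y + w) = x + w + y by ring.
by case: e => [[[t c]|[[s n] c]]|[[t c] [[s n] c']]]; rewrite /plane_act /=
  ?slope_form_add !h.
Qed.

Lemma plane_act_le u v e e' : ple e e' -> ple (plane_act u v e) (plane_act u v e').
Proof.
move=> [h1 h2]; split; rewrite /plane_act ?join_left_map ?join_right_map.
  apply: ole_omap h1 => x y [->|[x2 y2 h]]; [by left|right; split=> //=].
  by case: h => ->; [left|right; ring].
apply: ole_omap h2 => x y [->|[x2 y2 h]]; [by left|right; split=> //=].
by case: h => -> /=; [left|right; congr pair; ring].
Qed.

Lemma line_contractible : contractible_poset [set: line] 0.
Proof.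
have := @fgraph_contractible int (fun t : int => t + 1) setT 0 id.
rewrite (_ : fgraph_set setT = setT) //; apply=> // t _.
have it k x : iter k (fun t : int => t + 1) x = x + k%:Z.
  by elim: k => [|k IH]; rewrite ?addr0 //= IH -addrA -PoszD addn1.
have [t0|t0] := leP 0 t.
  by exists 0%N, `|t|%N; rewrite (it `|t|%N) /= add0r gez0_abs.
by exists `|t|%N, 0%N; rewrite (it `|t|%N) /= ltz0_abs // subrr.
Qed.

Lemma slope_line_contractible (s : option rat) :
  contractible_poset (fgraph_set (next := fun t : option rat * int => (t.1, t.2 + 1))
    [set t | t.1 = s]) 0.
Proof.
apply: (@fgraph_contractible _ _ [set t | t.1 = s] (s, 0) (fun t => t.2)) => //.
have it k x : iter k (fun t : option rat * int => (t.1, t.2 + 1)) x = (x.1, x.2 + k%:Z).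
  by elim: k => [|k IH]; rewrite ?addr0 //=; [case: x|rewrite IH /= -addrA -PoszD addn1].
move=> [s' t] /= ->; have [t0|t0] := leP 0 t.
  by exists 0%N, `|t|%N; rewrite (it `|t|%N) /= add0r gez0_abs.
by exists `|t|%N, 0%N; rewrite (it `|t|%N) /= ltz0_abs // subrr.
Qed.

(** The vectors are all proportional. If they vanish, the whole line is fixed; if not, exactly one
    of the slope lines is. Either way one factor of the fixed join is contractible, and nothing is
    asked of the other, which may be disconnected or empty. *)
Lemma plane_fix (T : Type) (f1 f2 : T -> int) (a b : int) : (a, b) <> (0, 0) ->
  (forall k, a * f1 k + b * f2 k = 0) ->
  contractible_poset [set e | forall k, plane_act (f1 k) (f2 k) e = e] 1.
Proof.
move=> ab kill.
have -> : [set e | forall k, plane_act (f1 k) (f2 k) e = e] =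
    join_set [set t : line | forall k, f2 k = 0]
      [set t : slope_lines | forall k, slope_form t.1.1 (f1 k) (f2 k) = 0].
  have z (x y : int) : x + y = x -> y = 0 by move=> e; apply: (addrI x); rewrite e addr0.
  apply/seteqP; split=> -[[[t c]|[[s n] c]]|[[t c] [[s n] c']]].
  - by move=> h; split=> //= k; have [/z] := h k.
  - by move=> h; split=> //= k; have [/z] := h k.
  - by move=> h; split=> /= k; have [/z ? /z ?] := h k.
  - by move=> [/= h _] k; rewrite /plane_act /= h addr0.
  - by move=> [/= _ h] k; rewrite /plane_act /= h addr0.
  - by move=> [/= h h'] k; rewrite /plane_act /= h' h !addr0.
have [f0|/existsNP[k0 f0]] := pselect (forall k, (f1 k, f2 k) = (0, 0)).
  apply: contractible_joinl.
  rewrite (_ : [set t : line | _] = setT); first exact: line_contractible.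
  by apply/seteqP; split=> // t _ k; have [] := f0 k.
apply: contractible_joinr.
have [s0 [hs us]] := slope_unique f0.
rewrite (_ : [set t : slope_lines | _] =
  fgraph_set (next := fun t : option rat * int => (t.1, t.2 + 1)) [set t | t.1 = s0]).
  exact: slope_line_contractible.
apply/seteqP; split=> -[[s n] c] /=; first by move=> /(_ k0) /us.
rewrite /fgraph_set /= => -> k; apply: hs; apply/eqP; rewrite -subr_eq0; apply/eqP.
have e := kill k; have e0 := kill k0.
have [a0|a0] := eqVneq a 0.
  have b0 : b != 0 by apply/eqP => b0; apply: ab; rewrite a0 b0.
  apply: (mulfI b0); rewrite mulr0.
  transitivity (f1 k * (a * f1 k0 + b * f2 k0) - f1 k0 * (a * f1 k + b * f2 k)); first by ring.
  by rewrite e e0 !mulr0 subrr.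
apply: (mulfI a0); rewrite mulr0.
transitivity (f2 k0 * (a * f1 k + b * f2 k) - f2 k * (a * f1 k0 + b * f2 k0)); first by ring.
by rewrite e e0 !mulr0 subrr.
Qed.

End Plane.

(** * Central extensions by a cyclic group *)

Section CentralExtension.
Variables (G Q : groupType) (f : G -> Q) (z : G) (n : nat).
Local Open Scope group_scope.
Hypotheses (fM : {morph f : x y / x * y}) (f_surj : forall q, exists x, f x = q).
Hypotheses (f_ker : forall x, f x = 1 <-> cyc z x) (z_central : forall h, commute z h).
Hypothesis engel : forall u h : G, iter n (fun u => [~ u, h]) u = 1.
Hypothesis Q_model : finite_vc_model Q.

Lemma central_extension_model : finite_vc_model G.
Proof.
have [P [B [m [P_small P_stab P_fix]]]] := Q_model.
have pa1 (x : P) : gact (f 1) x = x by rewrite morph1 // gact1.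
have paM g h (x : P) : gact (f (g * h)) x = gact (f g) (gact (f h) x).
  by rewrite fM gactM.
pose X : gposet G := GPoset pa1 paM (fun g => @gact_le Q P (f g)).
have X_fix K : vc_sub K -> contractible_poset (@pfix G X K) m.
  move=> /(vc_sub_image fM) /P_fix; congr contractible_poset.
  apply/seteqP; split=> x h; first by move=> g Kg; apply: h; exists g.
  by move=> _ [g Kg <-]; exact: h.
have rank (x : X) : exists f12 : (G -> int) * (G -> int), rank2_map (pstab x) f12.1 f12.2.
  have HG : is_subgroup (pstab x) by exact: pstab_subgroup.
  have [_ [d dx [T hT]]] := P_stab x.
  have [c cd] := f_surj d; pose lift q := sval (cid (f_surj q)).
  have liftE q : f (lift q) = q by rewrite /lift; case: cid.
  have [|||||f1 [f2 h]] := @engel_rank2_map G (pstab x) c z (map lift T) n HG.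
  - by rewrite /pstab /= cd.
  - have : f z = 1 by apply/f_ker; exists 1%R.
    by rewrite /pstab /= => ->; exact: gact1.
  - by move=> h _; exact: z_central.
  - move=> h hx; have [t tT [k _ e]] := hT (f h) hx.
    exists (lift t); first exact: map_f.
    have [j _ ej] : cyc z ((zpow c k)^-1 * ((lift t)^-1 * h)).
      apply/f_ker; rewrite !fM !(morphV _ fM) (zpow_morph _ _ fM) cd liftE -e.
      by rewrite mulVg.
    by exists k, j; rewrite ej mulVKg.
  - by move=> *; exact: engel.
  - by exists (f1, f2).
pose r (y : X) := sval (cid (rank y)).
have rP y : rank2_map (pstab y) (r y).1 (r y).2 := svalP (cid (rank y)).
have HG y : is_subgroup (@pstab G X y) by exact: pstab_subgroup.
have aP : group_action (@gact G X) by split; [exact: pa1|exact: paM].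
(* Sections over [x] must be defined at [x], to cut down its stabiliser, and the domains must grow
   with [x]; the down-set of [x] is the least choice, and it is finite. *)
apply: (@sections_model G X B m P_small X_fix X (@gact G X) aP (fun x y => ple y x) B
  _ _ _ _ plane_poset 16 1 plane_small
  (fun y g => plane_act ((r y).1 g) ((r y).2 g))).
- by move=> x x' y xx' yx; exact: ple_trans xx'.
- by move=> g x y; exact: gact_le.
- by move=> x; exists x; exact: plexx.
- exact: P_small.
- move=> y e; have [h1 h2 _] := rP y.
  by rewrite (additive1 (HG y) h1) (additive1 (HG y) h2) plane_act0.
- move=> y g h e gy hy; have [h1 h2 _] := rP y.
  by rewrite h1 // h2 // plane_actD.
- by move=> y g e e' _; exact: plane_act_le.
- move=> y e; have [h1 h2 h3] := rP y.
  have z0 (u v : int) : (u + v)%R = u -> v = 0%R.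
    by move=> euv; apply: (addrI u); rewrite euv addr0.
  case: e => [[[t c]|[[s k] c]]|[[t c] w]].
  + exists [set h | pstab y h /\ (0 * (r y).1 h + 1 * (r y).2 h = 0)%R]; first exact: h3.
    by move=> g gy [/z0 e]; split=> //; rewrite e mul0r mulr0 addr0.
  + have [a [b [ab sE]]] := slope_form_coef s.
    exists [set h | pstab y h /\ (a * (r y).1 h + b * (r y).2 h = 0)%R]; first exact: h3.
    by move=> g gy [/z0 e]; split=> //; rewrite -sE.
  + exists [set h | pstab y h /\ (0 * (r y).1 h + 1 * (r y).2 h = 0)%R]; first exact: h3.
    by move=> g gy [/z0 e _]; split=> //; rewrite e mul0r mulr0 addr0.
- move=> y K Kvc Ky.
  have [a [b [ab kill]]] := rank2_map_kills (HG y) (rP y) Kvc Ky.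
  have := @plane_fix {k | K k} (fun k => (r y).1 (sval k)) (fun k => (r y).2 (sval k)) a b ab.
  move=> /(_ (fun k => kill _ (svalP k))); congr contractible_poset.
  apply/seteqP; split=> e h; first by move=> k Kk; exact: (h (exist _ k Kk)).
  by move=> [k Kk]; exact: h.
Qed.

End CentralExtension.

(** * Coinduction from a subgroup of finite index *)

Section FiniteIndexModel.
Variables (G U : groupType) (f : U -> G).
Local Open Scope group_scope.
Hypotheses (fM : {morph f : x y / x * y}) (f_inj : injective f).
Variable T : seq G.
Hypothesis hT : covered [set: G] (range f) T.
Hypothesis U_model : finite_vc_model U.

Let NG : is_subgroup (range f).
Proof. exact: (subgroup_image fM (subgroupT U)). Qed.

Lemma vc_sub_preimage K : vc_sub K -> K `<=` range f -> vc_sub (f @^-1` K).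
Proof.
move=> [KG [c Kc [S hS]]] Kf; split; first exact: subgroup_preimage.
have [d _ dc] := Kf _ Kc; exists d; first by rewrite /= dc.
have [S' S'K hS'] := covered_sub (cyc_subgroup c) KG (@subset_refl _ K) hS.
pose inv x : U := if pselect (range f x) is left h then s2val (cid2 h) else 1.
have invE x : range f x -> f (inv x) = x.
  by move=> fx; rewrite /inv; case: pselect => // h; case: cid2.
exists (map inv S') => u Ku; have [t tS [_ [k _ e]]] := hS' _ Ku.
exists (inv t); first exact: map_f.
exists k => //; apply: f_inj; rewrite (zpow_morph _ _ fM) dc e fM (morphV _ fM) invE //.
by apply: Kf; exact: S'K.
Qed.

Let Y : choiceType := quotient_type NG.
Let a : G -> Y -> Y := @coset_act G _ NG.

Let aP : group_action a := coset_act_action NG.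

Let a_stab g y : a g y = y -> range f (g ^ qrep y).
Proof. by move/coset_act_fix. Qed.

Let inv x : U := if pselect (range f x) is left h then s2val (cid2 h) else 1.
Let invE x : range f x -> f (inv x) = x.
Proof. by move=> fx; rewrite /inv; case: pselect => // h; case: cid2. Qed.

(** The base is a point and the sections are defined on all of the finite set of cosets: they form
    the coinduced poset, a finite power of [P] as a poset. *)
Lemma finite_index_model : finite_vc_model G.
Proof.
have [P [B [m [P_small P_stab P_fix]]]] := U_model.
apply: (@sections_model G (unit_gposet G) 1 0 unit_small _ Y a aP (fun _ _ => True) (size T)
  _ _ _ _ P B m P_small (fun y g => gact (inv (g ^ qrep y)))) => //.
- by move=> K _; exact: unit_contractible.
- by move=> _; exists (qproj NG 1).
- move=> _; exists (map (qproj NG) T); first by rewrite size_map.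
  move=> y _; have [t tT ht] := @hT (qrep y) I.
  have <- : qproj NG t = y by rewrite -[RHS]qprojK; apply: (qproj_eq NG _ _).2.
  exact: map_f.
- move=> y e; rewrite conj1g (_ : inv 1 = 1) ?gact1 //.
  by apply: f_inj; rewrite invE ?morph1 //; exact: subgroup1 NG.
- move=> y g h e gy hy; rewrite -gactM; congr gact; apply: f_inj.
  rewrite fM !invE ?conjMg //; try exact: a_stab.
  by apply: (subgroupM NG); exact: a_stab.
- by move=> y g e e' _; exact: gact_le.
- move=> y e; exists [set x | (f @` pstab e) (x ^ qrep y)].
    by apply: vc_sub_conj; apply: vc_sub_image => //; exact: P_stab.
  by move=> g gy ge; exists (inv (g ^ qrep y)) => //; apply: invE; exact: a_stab.
- move=> y K Kvc Ky.
  have K'vc := vc_sub_conj (qrep y)^-1 Kvc.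
  have K'f : [set x | K (x ^ (qrep y)^-1)] `<=` range f.
    by move=> x /= /Ky /a_stab; rewrite conjgKV.
  have := P_fix _ (vc_sub_preimage K'vc K'f); congr contractible_poset.
  apply/seteqP; split=> e h.
    move=> k Kk; apply: h; rewrite /= invE; last by apply: a_stab; exact: Ky.
    by rewrite conjgK.
  move=> u /= Ku; have := h _ Ku; rewrite conjgKV.
  by congr (gact _ _ = _); apply: f_inj; rewrite invE //; exists u.
Qed.

End FiniteIndexModel.

(** As an identity on left-normed commutators, nilpotency passes at once to subgroups and to
    preimages under injective morphisms. *)
Definition nilpotent_class (G : groupType) (H : set G) (c : nat) : Prop :=
  forall u xs, H u -> (forall x, x \in xs -> H x) -> size xs = c ->
  foldl (fun v x => [~ v, x]%g) u xs = 1%g.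

Definition generated_by (G : groupType) (s : seq G) : set G := generated [set` s].

(** * Finitely generated virtually nilpotent groups *)

Section Nilpotent.
Variable G : groupType.
Local Open Scope group_scope.
Implicit Types (N : set G) (s zs : seq G).

Lemma nilpotent_subgroup_class N : nilpotent_subgroup N ->
  is_subgroup N /\ exists c, nilpotent_class N c.
Proof.
move=> [NG [n hn]]; split=> //; exists n => u xs Nu Nxs sz.
have : lower_central N n = [set 1] by [].
suff h : forall xs, (forall x, x \in xs -> N x) ->
    lower_central N (size xs) (foldl (fun v x => [~ v, x]) u xs).
  by have := h xs Nxs; rewrite sz hn.
elim/last_ind => [//|ys y IH] Nys; rewrite size_rcons foldl_rcons /=.
apply: sub_generated; exists (foldl (fun v x => [~ v, x]) u ys).
  by apply: IH => x xy; apply: Nys; rewrite mem_rcons inE xy orbT.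
by exists y => //; apply: Nys; rewrite mem_rcons inE eqxx.
Qed.

Lemma nilpotent_class_le N N' c : N' `<=` N -> nilpotent_class N c -> nilpotent_class N' c.
Proof.
move=> sub h u xs Nu Nxs; apply: h; first exact: sub.
by move=> x /Nxs; exact: sub.
Qed.

Lemma nilpotent_engel c : nilpotent_class [set: G] c ->
  forall u h : G, iter c (fun u => [~ u, h]) u = 1.
Proof.
move=> hc u h; rewrite -[RHS](hc u (nseq c h)) ?size_nseq //.
by elim: c u {hc} => // n IH u; rewrite iterSr IH.
Qed.

Lemma generated_by_subgroup s : is_subgroup (generated_by s).
Proof. exact: generated_subgroup. Qed.

Lemma generated_by_mem s x : x \in s -> generated_by s x.
Proof. by move=> xs; exact: sub_generated. Qed.

Lemma generated_by_le s H : is_subgroup H -> (forall x, x \in s -> H x) ->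
  generated_by s `<=` H.
Proof. by move=> HG sH; apply: generated_le. Qed.

Lemma generated_by_sub s s' : {subset s <= s'} -> generated_by s `<=` generated_by s'.
Proof.
move=> ss'; apply: generated_by_le; first exact: generated_by_subgroup.
by move=> x /ss'; exact: generated_by_mem.
Qed.

Lemma generated_by_conj s : (forall x g, x \in s -> generated_by s (x ^ g)) ->
  forall x g, generated_by s x -> generated_by s (x ^ g).
Proof.
move=> h x g; move: x; apply: generated_by_le; last by move=> x xs; exact: h.
split; first by rewrite conj1g; exact: subgroup1 (generated_by_subgroup s).
by move=> x y hx hy; rewrite conjMg conjVg; exact: (generated_by_subgroup s).2.
Qed.

(** A finite central series with cyclic factors, given by a generator of each factor. *)
Definition polycentral zs : Prop :=
  generated_by zs = [set: G] /\
  forall i, i < size zs -> forall g, generated_by (take i zs) [~ nth 1 zs i, g].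

(** Modulo a normal subgroup, the elements commuting with [u] form a subgroup, so generators
    suffice. *)
Lemma commutator_closure (M : set G) u s : is_subgroup M ->
  (forall x g, M x -> M (x ^ g)) -> generated_by s = [set: G] ->
  (forall x, x \in s -> M [~ u, x]) -> forall g, M [~ u, g].
Proof.
move=> MG Mn sG h g; have : generated_by s g by rewrite sG.
apply: (@generated_by_le s [set g | M [~ u, g]]) => //.
have RM x y : [~ u, x * y] = [~ u, y] * [~ u, x] ^ y.
  have e p q r : p * r = p * q * (q^-1 * r) :> G by rewrite -mulgA mulVKg.
  by rewrite !commgEl conjMg conjVg conjgM; exact: e.
split; first by rewrite /= commg1; exact: subgroup1.
move=> x y /= hx hy; rewrite RM; apply: subgroupM => //; last exact: Mn.
have -> : [~ u, y^-1] = ([~ u, y] ^ y^-1)^-1.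
  apply: (mulIg ([~ u, y] ^ y^-1)); rewrite mulVg.
  by rewrite -RM mulgV commg1.
by apply: subgroupV => //; exact: Mn.
Qed.

(* The sequence lists the left-normed commutators in the generators by decreasing
   weight. *)
Lemma nilpotent_polycentral gens c : generated_by gens = [set: G] ->
  nilpotent_class [set: G] c -> exists zs, polycentral zs.
Proof.
move=> gG hc.
have {hc} hc : nilpotent_class [set: G] c.+1.
  by move=> u [//|x xs] _ _ [sz] /=; exact: hc.
pose W := fix W w := if w is w'.+1 then [seq [~ u, x] | u <- W w', x <- gens] else gens.
have Wc u : u \in W c.+1 -> u = 1.
  have Wf w v : v \in W w -> exists v0 xs, size xs = w /\ v = foldl (fun v x => [~ v, x]) v0 xs.
    elim: w v => [|w IH] v /=; first by exists v, [::].
    move=> /allpairsP[[v' x] /= [/IH[v0 [xs [sz ->]]] _ ->]].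
    by exists v0, (rcons xs x); rewrite size_rcons sz foldl_rcons.
  by move=> /Wf[v0 [xs [sz ->]]]; apply: hc.
pose Z := fix Z k := if k is k'.+1 then Z k' ++ W (c - k') else [::].
have WZ k u : k <= c.+1 -> u \in W (c.+1 - k) -> generated_by (Z k) u.
  case: k => [|k] kc; last first.
    by rewrite subSS => uW; apply: generated_by_mem; rewrite /= mem_cat uW orbT.
  by rewrite subn0 => /Wc ->; exact: subgroup1 (generated_by_subgroup _).
have normal_step k : (forall x g, generated_by (Z k) x -> generated_by (Z k) (x ^ g)) ->
    k <= c -> forall u g, u \in W (c - k) -> generated_by (Z k) [~ u, g].
  move=> nk kc u g uW.
  apply: (commutator_closure (generated_by_subgroup (Z k)) nk gG) => x xg.
  apply: WZ; first exact: leqW.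
  by rewrite subSn //=; apply/allpairsP; exists (u, x).
have normal k : k <= c.+1 -> forall x g, generated_by (Z k) x -> generated_by (Z k) (x ^ g).
  elim: k => [|k IH] kc.
    by apply: generated_by_conj => x g; rewrite in_nil.
  have nk := IH (ltnW kc).
  have inc : generated_by (Z k) `<=` generated_by (Z k.+1).
    by apply: generated_by_sub => x xZ; rewrite /= mem_cat xZ.
  apply: generated_by_conj => x g; rewrite /= mem_cat => /orP[xZ|xW].
    by apply: inc; apply: nk; exact: generated_by_mem.
  have -> : x ^ g = x * [~ x, g] by rewrite commgEl mulVKg.
  apply: (subgroupM (generated_by_subgroup (Z k.+1))).
    by apply: generated_by_mem; rewrite /= mem_cat xW orbT.
  by apply: inc; exact: normal_step.
exists (Z c.+1); split.
  apply/seteqP; split=> // x _.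
  have : generated_by gens x by rewrite gG.
  by apply: generated_by_sub => y yg; rewrite /= subnn mem_cat yg orbT.
have : c.+1 <= c.+1 by [].
elim: {1 3 4 5}c.+1 => [//|k IH] kc i.
rewrite /= size_cat nth_cat take_cat.
have [ik _|ik iW] := ltnP i (size (Z k)); first exact: IH (ltnW kc) _ ik.
move=> g; apply: (@generated_by_sub (Z k)).
  by move=> x xZ; rewrite mem_cat xZ.
apply: normal_step => //; first exact: normal (ltnW kc).
by apply: mem_nth; rewrite ltn_subLR.
Qed.

End Nilpotent.

Section GeneratedImage.
Local Open Scope group_scope.

Lemma generated_by_image (G Q : groupType) (f : G -> Q) s x :
  {morph f : x y / x * y} -> generated_by s x -> generated_by (map f s) (f x).
Proof.
move=> fM; have h := subgroup_preimage fM (generated_by_subgroup (map f s)).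
by apply: (generated_by_le h) => y ys; apply: generated_by_mem; exact: map_f.
Qed.

Lemma generated_by_image_inv (U G : groupType) (f : U -> G) (us : seq U) y :
  {morph f : x y / x * y} -> generated_by (map f us) y -> (f @` generated_by us) y.
Proof.
move=> fM; apply: generated_by_le.
  exact: (subgroup_image fM (generated_by_subgroup us)).
by move=> _ /mapP[u uus ->]; exists u => //; exact: generated_by_mem.
Qed.

Lemma nilpotent_class_preimage (U G : groupType) (f : U -> G) (N : set G) c :
  {morph f : x y / x * y} -> injective f -> nilpotent_class N c ->
  nilpotent_class (f @^-1` N) c.
Proof.
move=> fM fi hc u xs Nu Nxs sz; apply: fi.
have -> : f (foldl (fun v x => [~ v, x]) u xs) =
    foldl (fun v x => [~ v, x]) (f u) (map f xs).
  by elim: xs u {sz Nu Nxs} => //= x xs IH u; rewrite IH (morphR _ _ fM).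
rewrite (morph1 fM) hc //; last by rewrite size_map.
by move=> _ /mapP[v vxs ->]; exact: Nxs.
Qed.

Lemma subgroup_seq (G : groupType) (H : set G) (HG : is_subgroup H) (s : seq G) :
  (forall x, x \in s -> H x) -> exists us : seq (subgroup_of HG), map (@sg_incl _ _ HG) us = s.
Proof.
elim: s => [|x s IH] sH; first by exists [::].
have [y ys|us <-] := IH; first by apply: sH; rewrite inE ys orbT.
have Hx : H x by apply: sH; rewrite inE eqxx.
by exists ((SubgroupElt Hx : subgroup_of HG) :: us).
Qed.

Lemma subgroup_generators (G : groupType) (H : set G) (HG : is_subgroup H) (s : seq G) :
  generated_by s = H -> exists2 us : seq (subgroup_of HG),
    map (@sg_incl _ _ HG) us = s & generated_by us = [set: subgroup_of HG].
Proof.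
move=> sH; have [x xs|us usE] := @subgroup_seq _ _ HG s.
  by rewrite -sH; exact: generated_by_mem.
exists us => //; apply/seteqP; split=> // u _.
have : generated_by (map (@sg_incl _ _ HG) us) (sg_incl u).
  by rewrite usE sH; exact: sgvalP.
by move=> /(generated_by_image_inv (@sg_inclM _ _ HG))[v hv /(@sg_incl_inj _ _ HG) <-].
Qed.

(** The head [z] of the list is central. The images of the other elements form such a list for the
    quotient by [z], where the Engel condition holds with the same exponent. *)
Lemma polycentral_model n (G : groupType) (zs : seq G) k : size zs = n ->
  polycentral zs -> (forall u h : G, iter k (fun u => [~ u, h]) u = 1) ->
  finite_vc_model G.
Proof.
elim: n G zs => [|n IH] G [//|z zs] // sz [gen cen] engel.
  apply: trivial_model => g; have : generated_by [::] g by rewrite gen.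
  apply: (@generated_by_le G [::] [set 1]) => //; split=> // x y -> ->.
  by rewrite /= invg1 mulg1.
have zc h : commute z h.
  apply/commgP/eqP; have /= := cen 0 isT h.
  apply: (@generated_by_le G [::] [set 1]) => //; split=> // x y -> ->.
  by rewrite /= invg1 mulg1.
have NG := cyc_subgroup z.
have Nn x g : cyc z x -> cyc z (x ^ g).
  by move=> [m _ <-]; exists m => //; rewrite zpowJ conjgE (zc g) mulKg.
have [Q [f [fM f_surj f_ker]]] := quotient_exists NG Nn.
apply: (central_extension_model fM f_surj f_ker zc engel).
apply: (IH Q (map f zs)); first by rewrite size_map; case: sz.
  have fz : f z = 1 by apply/f_ker; exists 1%R.
  have drop_z s x : generated_by (f z :: s) x -> generated_by s x.
    apply: generated_by_le; first exact: generated_by_subgroup.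
    move=> y; rewrite inE => /predU1P[->|]; last exact: generated_by_mem.
    by rewrite fz; exact: subgroup1 (generated_by_subgroup s).
  split.
    apply/seteqP; split=> // q _; have [x <-] := f_surj q.
    apply: drop_z; have : generated_by (z :: zs) x by rewrite gen.
    exact: (@generated_by_image _ _ f (z :: zs) x fM).
  move=> i; rewrite size_map => izs q; have [g <-] := f_surj q.
  rewrite (nth_map 1) // -(morphR _ _ fM) -map_take; apply: drop_z.
  by apply: (@generated_by_image _ _ f (z :: take i zs)) => //; exact: (cen i.+1).
move=> u h; have [x <-] := f_surj u; have [y <-] := f_surj h.
have := congr1 f (engel x y); rewrite morph1 // => <-.
by elim: (k) => //= j IHj; rewrite (morphR _ _ fM) -IHj.
Qed.

(* Schreier's lemma *)
Lemma finite_index_generated (G : groupType) (gs : seq G) (N : set G) T :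
  generated_by gs = [set: G] -> is_subgroup N -> covered [set: G] N T ->
  exists2 ns, (forall x, x \in ns -> N x) & generated_by ns = N.
Proof.
move=> gG NG hT; pose gs2 := gs ++ map (fun x => x^-1) gs.
pose ns := [seq x <- T ++ [seq t'^-1 * s | t' <- T, s <- [seq s * t | s <- gs2, t <- T]] | `[< N x >]].
have nsN x : x \in ns -> N x by rewrite mem_filter => /andP[/asboolP].
exists ns => //; have HG := generated_by_subgroup ns.
have HN : generated_by ns `<=` N by exact: generated_by_le.
(* The union of the cosets of [generated_by ns] by elements of [T]: it contains 1 and is stable
   under left multiplication by the generators and their inverses, hence is everything. *)
pose S := [set g | exists2 t, t \in T & generated_by ns (t^-1 * g)].
have TN t : t \in T -> N t -> generated_by ns t.
  by move=> tT Nt; apply: generated_by_mem; rewrite mem_filter mem_cat tT andbT; exact/asboolP.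
have S1 : S 1.
  have [t tT Nt] := hT 1 I; exists t => //; rewrite mulg1 in Nt *.
  by apply: (subgroupV HG); apply: TN => //; rewrite -[t]invgK; exact: (subgroupV NG Nt).
have Sgs s g : s \in gs2 -> S g -> S (s * g).
  move=> sg [t tT hg]; have [t' t'T Nt'] := hT (s * t) I.
  exists t' => //; have -> : t'^-1 * (s * g) = (t'^-1 * (s * t)) * (t^-1 * g).
    by rewrite -!mulgA mulVKg.
  apply: (subgroupM HG) => //; apply: generated_by_mem; rewrite mem_filter mem_cat.
  apply/andP; split; first exact/asboolP.
  apply/orP; right; apply/allpairsP; exists (t', s * t); split=> //.
  by apply/allpairsP; exists (s, t).
have SG g : S g.
  pose St := [set x | forall g, (S g -> S (x * g)) /\ (S g -> S (x^-1 * g))].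
  have : St g.
    have : generated_by gs g by rewrite gG.
    apply: (@generated_by_le G gs St); last first.
      move=> x xg h; split; apply: Sgs; rewrite mem_cat ?xg //.
      by rewrite map_f ?orbT.
    split; first by move=> h; rewrite invg1 mul1g.
    move=> x y hx hy h; split=> Sh.
      by rewrite -mulgA; apply: (hx _).1; exact: (hy _).2.
    by rewrite invgM invgK -mulgA; apply: (hy _).1; exact: (hx _).2.
  by move=> /(_ 1) [+ _]; rewrite mulg1; exact.
apply/seteqP; split=> // n Nn; have [t tT ht] := SG n.
have Nt : N t.
  have := subgroupM NG Nn (subgroupV NG (HN _ ht)).
  by rewrite invgM invgK mulVKg.
by rewrite -(mulVKg t n); apply: (subgroupM HG) => //; exact: TN.
Qed.

Lemma virtually_nilpotent_model (G : groupType) (gs : seq G) (N : set G) c T :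
  generated_by gs = [set: G] -> is_subgroup N -> nilpotent_class N c ->
  covered [set: G] N T -> finite_vc_model G.
Proof.
move=> gG NG hc hT; have [ns nsN nsE] := finite_index_generated gG NG hT.
pose U := subgroup_of NG; pose f : U -> G := @sg_incl G N NG.
have fM : {morph f : x y / x * y} by exact: sg_inclM.
have [us _ usU] := @subgroup_generators _ _ NG ns nsE.
have nU : nilpotent_class [set: U] c.
  apply: nilpotent_class_le (nilpotent_class_preimage fM (@sg_incl_inj _ _ NG) hc).
  by move=> u _; exact: sgvalP.
have [zs pz] := nilpotent_polycentral usU nU.
apply: (@finite_index_model G U f fM (@sg_incl_inj _ _ NG) T); first by rewrite range_sg_incl.
exact: polycentral_model erefl pz (nilpotent_engel nU).
Qed.

End GeneratedImage.

Lemma hierarchy1 (R : realType) (G : groupType) :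
  finite_vc_model G -> hierarchy R virtually_cyclic 1%N G.
Proof.
move=> [P [B [m [P_small P_stab P_fix]]]].
apply: hierarchy_step; first by exists 0%N.
apply: (poset_acts_with R P_small) => [V _ /fset0Pn[p pV]|K /vc_subP Kvc]; last first.
  by exists m; exact: P_fix.
exists 0%N => //.
have vc : vc_sub [set g | forall p, p \in V -> gact (g0 := P) g p = p].
  apply: (vc_subS (P_stab p)); last by move=> g; exact.
  split=> [q _|g h hg hh q qV]; first exact: gact1.
  by rewrite gactM -{1}(hh q qV) gactK hg.
have [K [f [hK fi fr]]] := (vc_subP _).2 vc.
exists K, f; split=> //; apply: hierarchy_base hK => b.
by rewrite ltEnat /= ltn0.
Qed.

(** * Countable groups *)

Section LocallyVirtuallyNilpotent.
Local Open Scope group_scope.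

Definition generates_vn (G : groupType) (s : seq G) : Prop :=
  exists N c T, [/\ is_subgroup N, N `<=` generated_by s, nilpotent_class N c &
    covered (generated_by s) N T].

(** This local form covers virtually nilpotent groups as well as [A] and the commensurators of the
    second statement. *)
Definition locally_vn (G : groupType) (H : set G) : Prop :=
  forall s : seq G, (forall x, x \in s -> H x) -> generates_vn s.

Lemma generates_vn_pullback (U G : groupType) (f : U -> G) (us : seq U) :
  {morph f : x y / x * y} -> injective f ->
  generates_vn (map f us) -> generates_vn us.
Proof.
move=> fM fi [N [c [T [NG Ns hc hT]]]].
exists (f @^-1` N), c.
have [T' T's hT'] := covered_sub NG (generated_by_subgroup _) (@subset_refl _ _) hT.
pose inv x : U := if pselect (exists u, f u = x) is left h then sval (cid h) else 1.
have invE u : f (inv (f u)) = f u.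
  by rewrite /inv; case: pselect => [h|]; [case: cid|case; exists u].
exists (map inv T'); split.
- exact: subgroup_preimage.
- by move=> u /Ns /(generated_by_image_inv fM)[v hv /fi <-].
- exact: nilpotent_class_preimage.
- move=> u hu; have [t tT [_ ht]] := hT' _ (generated_by_image fM hu).
  exists (inv t); first exact: map_f.
  have [v _ vt] := generated_by_image_inv fM (T's _ tT).
  by rewrite /= fM (morphV _ fM) -vt invE vt.
Qed.

Lemma generates_vn_model (G : groupType) (s : seq G) :
  generated_by s = [set: G] -> generates_vn s -> finite_vc_model G.
Proof.
move=> sG [N [c [T [NG Ns hc hT]]]].
by apply: (virtually_nilpotent_model sG NG hc (T := T)); rewrite -sG.
Qed.

Lemma locally_vn_subgroup (G : groupType) (H : set G) (HG : is_subgroup H) :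
  locally_vn H -> locally_vn [set: subgroup_of HG].
Proof.
move=> hH us _; apply: (generates_vn_pullback (@sg_inclM _ _ HG) (@sg_incl_inj _ _ HG)).
by apply: hH => _ /mapP[u _ ->]; exact: sgvalP.
Qed.

Lemma generates_vn_hierarchy1 (R : realType) (G : groupType) (s : seq G) :
  generates_vn s -> subgroup_in (hierarchy R virtually_cyclic 1%N) (generated_by s).
Proof.
move=> hs; have HG := generated_by_subgroup s.
apply: (@subgroup_in_of _ _ HG); apply: hierarchy1.
have [us usE usT] := @subgroup_generators _ _ HG s erefl.
apply: (generates_vn_model usT).
by apply: (generates_vn_pullback (@sg_inclM _ _ HG) (@sg_incl_inj _ _ HG)); rewrite usE.
Qed.

Lemma virtually_nilpotent_locally (G : groupType) :
  virtually_nilpotent G -> locally_vn [set: G].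
Proof.
move=> [N /nilpotent_subgroup_class[NG [c hc]] fiN] s _.
have [T hT] := (finite_index_covered NG).1 fiN.
have sG := generated_by_subgroup s.
have [T' _ hT'] := covered_sub NG sG (@subsetT _ (generated_by s)) hT.
exists (generated_by s `&` N), c, T'; split.
- exact: subgroupI.
- by move=> x [].
- by apply: nilpotent_class_le hc => x [].
- exact: hT'.
Qed.

End LocallyVirtuallyNilpotent.

(** When stabilisers decrease along the order, the pointwise stabiliser of a chain is that of its
    greatest element. *)
Lemma poset_acts_with_top (R : realType) (G : groupType) (P : gposet G) B
    (F : groupType -> Prop) (S : set G -> Prop) :
  small_down_sets P B -> (forall p, S (@pstab G P p)) ->
  (forall p q : P, ple p q -> pstab q `<=` pstab p) ->
  (forall K, subgroup_in F K -> exists m, contractible_poset (@pfix G P K) m) ->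
  acts_with R F S.
Proof.
move=> bP hS mono hF; apply: (poset_acts_with R bP) => [V cV V0|K /hF[m [h hh]]]; last by exists m, h.
have [q qV qmax] := chain_max cV V0.
have -> : [set g | forall p, p \in V -> gact (g0 := P) g p = p] = pstab q; last exact: hS.
apply/seteqP; split=> g hg; first exact: hg.
by move=> p /qmax pq; exact: (mono _ _ pq).
Qed.

(** * The tree of cosets of an increasing union *)

Section CosetTree.
Variables (R : realType) (G : groupType) (e : nat -> G).
Hypothesis e_surj : forall g, exists n, e n = g.
Hypothesis G_lvn : locally_vn [set: G].
Local Open Scope group_scope.

Let s (i : nat) : seq G := [seq e j | j <- iota 0 i].
Let N i : set G := generated_by (s i).
Let NG i : is_subgroup (N i) := generated_by_subgroup (s i).

Let N_le i j : (i <= j)%N -> N i `<=` N j.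
Proof.
move=> ij; apply: generated_by_sub => x /mapP[k]; rewrite mem_iota add0n => ki ->.
by apply: map_f; rewrite mem_iota add0n (leq_trans ki).
Qed.

Let N_mem i j : (i < j)%N -> N j (e i).
Proof.
by move=> ij; apply: generated_by_mem; apply: map_f; rewrite mem_iota.
Qed.

Let N_seq (l : seq G) : exists i, forall x, x \in l -> N i x.
Proof.
elim: l => [|x l [i hi]]; first by exists 0.
have [n en] := e_surj x; exists (maxn i n.+1) => y.
rewrite inE => /predU1P[->|/hi/(N_le (leq_maxl i n.+1)) //].
by rewrite -en; apply: (N_le (leq_maxr i n.+1)); exact: N_mem.
Qed.

Let T : choiceType := {i : nat & quotient_type (NG i)}.

Let pt i x : T := Tagged (fun i => quotient_type (NG i)) (qproj (NG i) x).

Let pt_rep (t : T) : t = pt (tag t) (qrep (tagged t)).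
Proof. by case: t => i q; rewrite /pt /= qprojK. Qed.

Let pt_eq i x y : N i (x^-1 * y) -> pt i x = pt i y.
Proof. by move=> /(qproj_eq (NG i)) h; rewrite /pt h. Qed.

Let next (t : T) : T := pt (tag t).+1 (qrep (tagged t)).

Let act (g : G) (t : T) : T := pt (tag t) (g * qrep (tagged t)).

Let next_pt i x : next (pt i x) = pt i.+1 x.
Proof.
apply: pt_eq => /=; apply: (N_le (leqnSn i)); exact: coset_repP.
Qed.

Let act_pt g i x : act g (pt i x) = pt i (g * x).
Proof. by rewrite [RHS]/pt -coset_actE. Qed.

Let act_action : group_action act.
Proof.
split=> [t|g h t]; first by rewrite [in RHS](pt_rep t) /act mul1g.
by rewrite (pt_rep t) !act_pt mulgA.
Qed.

Let act_next g t : act g (next t) = next (act g t).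
Proof. by rewrite (pt_rep t) act_pt !next_pt act_pt. Qed.

Let act_fix g (t : T) : act g t = t <-> N (tag t) (g ^ qrep (tagged t)).
Proof.
case: t => i q /=; rewrite -coset_act_fix /act /pt /=; split=> [h|].
  exact: eq_from_Tagged h.
by rewrite /coset_act => ->.
Qed.

Let iter_next k i x : iter k next (pt i x) = pt (k + i) x.
Proof. by elim: k => // k IH; rewrite iterS IH next_pt. Qed.

Let P : gposet G := fgraph_gposet act_action.1 act_action.2 act_next.

(** The vertices of level [i] are the cosets of [N i], and each is joined to the coset of [N i.+1]
    containing it. The stabilisers are conjugates of the groups [N i], which are finitely
    generated. *)
Lemma countable_locally_vn_hierarchy2_enum : hierarchy R virtually_cyclic 2%N G.
Proof.
apply: hierarchy_step; first by exists 0%N.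
apply: (@poset_acts_with_top R G P 3); first exact: fgraph_small.
- move=> p; exists 1%N => //; rewrite fgraph_pstab.
  set t := p.1.
  have -> : [set g | act g t = t] =
      generated_by [seq x ^ (qrep (tagged t))^-1 | x <- s (tag t)].
    pose f x := x ^ (qrep (tagged t))^-1.
    have fM : {morph f : x y / x * y} by move=> x y; exact: conjMg.
    apply/seteqP; split=> g.
      by move=> /act_fix /(generated_by_image fM); rewrite /f conjgK.
    by move=> /(generated_by_image_inv fM)[x hx <-]; apply/act_fix; rewrite /f conjgKV.
  by apply: generates_vn_hierarchy1; exact: G_lvn.
- move=> p q [->//|[_ _ h]]; rewrite !fgraph_pstab => g /= gq.
  by case: h => ->; rewrite ?act_next gq.
- move=> K /vc_subP [KG [c Kc [l hl]]].
  exists 0; rewrite fgraph_pfix.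
  (* The subgroup [K] is contained in the one generated by [c] and [l], hence in some [N i0]; it
     then fixes the coset of 1 at level [i0], which is taken as root. *)
  have [i0 hi0] := N_seq (c :: l).
  have KN : K `<=` N i0.
    move=> k Kk; have [t tl [n _ en]] := hl k Kk.
    rewrite -(mulVKg t k) -en; apply: (subgroupM (NG i0)).
      by apply: hi0; rewrite inE tl orbT.
    by apply: (subgroup_zpow _ (NG i0)); apply: hi0; rewrite inE eqxx.
  apply: (@fgraph_contractible _ _ _ (pt i0 1) (fun t => Posz (tag t))).
  + move=> k Kk; rewrite act_pt mulg1; apply: pt_eq.
    by rewrite mulg1; apply: (subgroupV (NG i0)); exact: KN.
  + by move=> t ht k Kk; rewrite act_next ht.
  + by move=> t; rewrite /= -addn1 PoszD.
  (* The two exponents bring both vertices to the level [i0 + j.+1 + i], which is beyond [j], so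
     that its group contains [x = e j]. *)
  + move=> t ht; rewrite (pt_rep t); move: (tag t) (qrep _) => i x.
    have [j ej] := e_surj x.
    exists (i0 + j.+1), (j.+1 + i); rewrite !iter_next.
    have -> : (j.+1 + i + i0 = i0 + j.+1 + i)%N by lia.
    apply: pt_eq; rewrite mulg1 -ej; apply: (subgroupV (NG _)); apply: N_mem.
    by lia.
Qed.

End CosetTree.

Section Hierarchy2.
Local Open Scope group_scope.

Lemma countable_surjection (G : groupType) :
  countable [set: G] -> exists e : nat -> G, forall g, exists n, e n = g.
Proof.
move=> /countable_injP[f fi].
pose e n := if pselect (exists g, f g = n) is left h then sval (cid h) else 1.
exists e => g; exists (f g); rewrite /e; case: pselect => [h|]; last by case; exists g.
by case: cid => x /= fx; apply: fi; rewrite ?inE.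
Qed.

Lemma countable_locally_vn_hierarchy2 (R : realType) (G : groupType) :
  countable [set: G] -> locally_vn [set: G] -> hierarchy R virtually_cyclic 2%N G.
Proof.
move=> /countable_surjection[e he] hG.
exact: countable_locally_vn_hierarchy2_enum he hG.
Qed.

Lemma subgroup_hierarchy2 (R : realType) (G : groupType) (H : set G) :
  is_subgroup H -> countable H -> locally_vn H ->
  subgroup_in (hierarchy R virtually_cyclic 2%N) H.
Proof.
move=> HG cH hH; apply: (@subgroup_in_of _ _ HG).
apply: countable_locally_vn_hierarchy2; last exact: locally_vn_subgroup.
have /countable_injP[f fi] := cH.
apply/countable_injP; exists (fun u => f (sg_incl u)) => u v _ _ e.
by apply: (@sg_incl_inj _ _ HG); apply: fi; rewrite ?inE //; exact: sgvalP.
Qed.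

End Hierarchy2.

(** * Abelian-by-cyclic groups *)

Section DiscretePoset.
Variables (G : groupType) (T : choiceType) (a : G -> T -> T).
Hypothesis aP : group_action a.

Definition discrete_poset : poset :=
  @Poset T eq (fun _ => erefl) (fun _ _ e _ => e) (fun _ _ _ e e' => etrans e e').

Definition discrete_gposet : gposet G :=
  @GPoset G discrete_poset a aP.1 aP.2 (fun g _ _ e => congr1 (a g) e).

Lemma discrete_small : small_down_sets discrete_poset 1.
Proof. by move=> x; exists [:: x] => // y ->; rewrite inE. Qed.

End DiscretePoset.

Lemma singleton_contractible (P : poset) (q : P) : contractible_poset [set q] 0.
Proof.
exists (fun _ _ x => x).
have z : zigzag [set q] (fun _ x => x) id.
  split=> //; first by move=> n p _; case: odd; exact: plexx.
  by move=> p _; exists 0.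
by split=> //; exists q.
Qed.

Section AbelianByCyclic.
Variables (R : realType) (G : groupType) (A : set G) (p : G -> int) (t : G).
Local Open Scope group_scope.
Hypothesis AG : is_subgroup A.
Hypothesis A_abelian : forall x y, A x -> A y -> x * y = y * x.
Hypothesis A_countable : countable A.
Hypothesis pM : forall x y, p (x * y) = (p x + p y)%R.
Hypothesis p_ker : forall x, p x = 0%R <-> A x.
Hypothesis pt : p t = 1%R.

Let pA : additive_on [set: G] p. Proof. by move=> x y _ _; exact: pM. Qed.
Let pV x : p x^-1 = (- p x)%R. Proof. exact: (additiveV (subgroupT G) pA). Qed.
Let pX x n : p (x ^+ n) = (Posz n * p x)%R. Proof. exact: (additiveX (subgroupT G) pA). Qed.
Let pZ x n : p (zpow x n) = (n * p x)%R. Proof. exact: (additive_zpow (subgroupT G) pA). Qed.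
Let pJ x y : p (x ^ y) = p x.
Proof. by rewrite conjgE !pM pV; ring. Qed.
Let pR x y : p [~ x, y] = 0%R.
Proof. by rewrite commgEl pM pV pJ addNr. Qed.

Lemma A_normal x g : A x -> A (x ^ g).
Proof. by move=> /p_ker e; apply/p_ker; rewrite pJ. Qed.

Let AR x g : A [~ x, g]. Proof. by apply/p_ker. Qed.

(** As [A] is abelian, its conjugation action factors through [p]. *)
Lemma conj_same a v w : A a -> p v = p w -> a ^ v = a ^ w.
Proof.
move=> Aa e; have Ac : A (v * w^-1) by apply/p_ker; rewrite pM pV e subrr.
rewrite -(mulgVK w v) conjgM; congr (_ ^ w).
by rewrite conjgE (A_abelian Aa Ac) mulKg.
Qed.

Lemma conj_swap a v w : A a -> (a ^ v) ^ w = (a ^ w) ^ v.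
Proof. by move=> Aa; rewrite -!conjgM; apply: conj_same => //; rewrite !pM addrC. Qed.

Lemma commMl a b w : A a -> A b -> [~ a * b, w] = [~ a, w] * [~ b, w].
Proof.
move=> Aa Ab; rewrite !commgEl invgM conjMg.
have Aw : A (a ^ w) by exact: A_normal.
have e u v x y : A v -> A x -> u * v * (x * y) = u * x * (v * y).
  move=> Av Ax; rewrite -!mulgA; congr (_ * _); rewrite !mulgA.
  by congr (_ * _); exact: A_abelian.
have AV x : A x -> A x^-1 by exact: subgroupV.
rewrite (A_abelian (AV _ Ab) (AV _ Aa)).
by apply: e => //; exact: AV.
Qed.

(** Written additively, the kernel of [(w - 1) ^ r] on the module [A]. *)
Definition engel_level (w : G) (r : nat) : set G :=
  [set a | A a /\ iter r (fun b => [~ b, w]) a = 1].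

Let iterA w r a : A a -> A (iter r (fun b => [~ b, w]) a).
Proof. by case: r => //= r _; exact: AR. Qed.

Let iterM w r a b : A a -> A b -> iter r (fun b => [~ b, w]) (a * b) =
  iter r (fun b => [~ b, w]) a * iter r (fun b => [~ b, w]) b.
Proof.
move=> Aa Ab; elim: r => //= r ->; apply: commMl; exact: iterA.
Qed.

Let iter1 w r : iter r (fun b => [~ b, w]) (1 : G) = 1.
Proof. by elim: r => //= r ->; exact: comm1g. Qed.

Lemma engel_level_subgroup w r : is_subgroup (engel_level w r).
Proof.
split; first by split; [exact: subgroup1|exact: iter1].
move=> a b [Aa ea] [Ab eb]; split; first exact: AG.2.
have Ab' := subgroupV AG Ab.
rewrite iterM // ea mul1g; apply: (mulgI (iter r (fun b => [~ b, w]) b)).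
by rewrite -iterM // mulgV iter1 eb mulg1.
Qed.

Lemma engel_level_conj w r a v : engel_level w r a -> engel_level w r (a ^ v).
Proof.
move=> [Aa ea]; split; first exact: A_normal.
have -> : iter r (fun b => [~ b, w]) (a ^ v) = (iter r (fun b => [~ b, w]) a) ^ v.
  elim: r {ea} => //= r ->; rewrite !commgEl [RHS]conjMg conjVg.
  by rewrite (conj_swap v w (iterA w r Aa)).
by rewrite ea conj1g.
Qed.

Lemma engel_levelS w r a : engel_level w r.+1 a <-> A a /\ engel_level w r [~ a, w].
Proof.
split=> [[Aa e]|[Aa [_ e]]]; last by split=> //; rewrite iterSr.
by split=> //; split; [exact: AR|rewrite iterSr in e].
Qed.

Lemma engel_level_le w r r' a : (r <= r')%N -> engel_level w r a -> engel_level w r' a.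
Proof.
move=> rr' [Aa ea]; split=> //.
by rewrite -(subnK rr') iterD ea iter1.
Qed.

(** Used to pass from [w] to its powers in the second argument of commutators. *)
Lemma comm_subgroup (B C : set G) : is_subgroup B -> (forall x v, B x -> B (x ^ v)) ->
  is_subgroup [set v | forall a, C a -> B [~ a, v]].
Proof.
move=> BG Bn; split; first by move=> a _; rewrite commg1; exact: subgroup1.
move=> v v' hv hv' a Ca.
have RM x y : [~ a, x * y] = [~ a, y] * [~ a, x] ^ y.
  have e q r s : q * s = q * r * (r^-1 * s) :> G by rewrite -mulgA mulVKg.
  by rewrite !commgEl conjMg conjVg conjgM; exact: e.
rewrite RM; apply: subgroupM => //; last by apply: Bn; exact: hv.
have -> : [~ a, v'^-1] = ([~ a, v'] ^ v'^-1)^-1.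
  by apply: (mulIg ([~ a, v'] ^ v'^-1)); rewrite mulVg -RM mulgV commg1.
by apply: subgroupV => //; apply: Bn; exact: hv'.
Qed.

Lemma engel_level_comm w r n a : engel_level w r.+1 a -> engel_level w r [~ a, zpow w n].
Proof.
move=> ha; have := comm_subgroup (engel_level w r.+1) (engel_level_subgroup w r)
  (@engel_level_conj w r).
by move=> /(@subgroup_zpow _ _ w n) h; apply: h ha => b /engel_levelS[].
Qed.

(** In the group ring, [w ^ n - 1] is a multiple of [w - 1], also for negative [n]. *)
Lemma engel_level_zpow w r n a : engel_level w r a -> engel_level (zpow w n) r a.
Proof.
elim: r a => [//|r IH] a ha; have Aa := ha.1.
apply/engel_levelS; split=> //; apply: IH; exact: engel_level_comm.
Qed.

Lemma engel_level_same w w' r a : p w = p w' -> engel_level w r a -> engel_level w' r a.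
Proof.
move=> e; elim: r a => [//|r IH] a /engel_levelS[Aa ha]; apply/engel_levelS; split=> //.
have -> : [~ a, w'] = [~ a, w] by rewrite !commgEl (conj_same Aa e).
exact: IH.
Qed.

(* It contains the centraliser in [A] of every power of [t]; hence, modulo it,
   elements outside [A] with commuting powers have a common power. *)
Definition unipotent_part : set G :=
  [set a | exists M r, (0 < M)%N /\ engel_level (t ^+ M) r a].

Lemma unipotent_common (s : seq G) : (forall a, a \in s -> unipotent_part a) ->
  exists M r, (0 < M)%N /\ forall a, a \in s -> engel_level (t ^+ M) r a.
Proof.
elim: s => [|b s IH] hs; first by exists 1%N, 0%N.
have [a as'|M [r [M0 h]]] := IH; first by apply: hs; rewrite inE as' orbT.
have [M' [r' [M'0 h']]] : unipotent_part b by apply: hs; rewrite inE eqxx.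
exists (M * M')%N, (maxn r r'); split; first by rewrite muln_gt0 M0.
move=> a; rewrite inE => /predU1P[->|/h ha].
  apply: engel_level_le (leq_maxr r r') _.
  by rewrite mulnC expgnA; have := engel_level_zpow (Posz M) h'.
apply: engel_level_le (leq_maxl r r') _.
by rewrite expgnA; have := engel_level_zpow (Posz M') ha.
Qed.

Lemma unipotent_subgroup : is_subgroup unipotent_part.
Proof.
split; first by exists 1%N, 0%N; split=> //; split=> //; exact: subgroup1.
move=> a b ha hb; have [c|M [r [M0 h]]] := @unipotent_common [:: a; b].
  by rewrite !inE => /orP[] /eqP ->.
exists M, r; split=> //; apply: (engel_level_subgroup _ _).2; apply: h;
  by rewrite !inE eqxx ?orbT.
Qed.

Lemma unipotent_normal a g : unipotent_part a -> unipotent_part (a ^ g).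
Proof.
by move=> [M [r [M0 h]]]; exists M, r; split=> //; exact: engel_level_conj.
Qed.

Lemma unipotentP w r a : p w <> 0%R -> engel_level w r a -> unipotent_part a.
Proof.
move=> /eqP w0 ha; exists `|p w|%N, r; rewrite absz_gt0; split=> //.
have := engel_level_zpow (Num.sg (p w)) ha; apply: engel_level_same.
by rewrite pZ pX pt mulr1 abszE normrEsg.
Qed.

(** The action of [y ^+ k - 1] cannot bring an element of [A] into the unipotent part from outside:
    for a power [w] of [y ^+ k], [w - 1] is a multiple of [y ^+ k - 1], so one further factor
    [w - 1] kills [a]. *)
Lemma unipotent_lift y k a : A a -> p y <> 0%R -> (0 < k)%N ->
  unipotent_part [~ a, y ^+ k] -> unipotent_part a.
Proof.
move=> Aa y0 k0 [M [r [M0 hb]]].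
pose w := (y ^+ k) ^+ M.
have pw : p w = (Posz M * (Posz k * p y))%R by rewrite !pX.
have w0 : p w <> 0%R.
  rewrite pw => /eqP; rewrite !mulf_eq0 !eqz_nat (gtn_eqF M0) (gtn_eqF k0) /=.
  by move/eqP.
have hb' : engel_level w r [~ a, y ^+ k].
  have := engel_level_zpow (Posz k * p y)%R hb; apply: engel_level_same.
  by rewrite pZ pX pt pw; ring.
apply: (unipotentP (r := r.+1) w0); apply/engel_levelS; split=> //.
have h := comm_subgroup [set a] (engel_level_subgroup w r) (@engel_level_conj w r).
have := @subgroup_zpow _ _ (y ^+ k) (Posz M) h; rewrite zpow_nat -/w => h'.
by apply: h' => // _ ->.
Qed.

(** * Commensurators modulo the unipotent part *)

Variables (Q : groupType) (f : G -> Q).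
Hypotheses (fM : {morph f : x y / x * y}) (f_ker : forall x, f x = 1 <-> unipotent_part x).

Let fX x n : f (x ^+ n) = f x ^+ n.
Proof. by have := zpow_morph x (Posz n) fM. Qed.
Let fZ x n : f (zpow x n) = zpow (f x) n.
Proof. exact: zpow_morph. Qed.
Let fR x y : f [~ x, y] = [~ f x, f y].
Proof. exact: morphR. Qed.
Let fJ x y : f (x ^ y) = f x ^ f y.
Proof. by rewrite !conjgE !fM !(morphV _ fM). Qed.

(* Conjugates of [y] have the same image under [p], so an element commensurates
   the subgroup generated by [f y] if and only if it centralises a power of [f y]. *)
Definition commensurator (y : G) : set G :=
  [set g | exists2 k, (0 < k)%N & commute (f y ^+ k) (f g)].

Lemma commensurator_zpow y (n : int) g : n <> 0%R -> commute (zpow (f y) n) (f g) ->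
  commensurator y g.
Proof.
move=> /eqP n0 h; exists `|n|%N; first by rewrite absz_gt0.
have [np|nn] := leP 0%R n; first by rewrite -zpow_nat gez0_abs.
rewrite -zpow_nat ltz0_abs // zpowN.
by apply: commute_sym; apply: commuteV; exact: commute_sym.
Qed.

Lemma commensurator_subgroup y : is_subgroup (commensurator y).
Proof.
split; first by exists 1%N => //; rewrite (morph1 fM); exact: commute1.
move=> g h [k k0 gk] [l l0 hl]; exists (k * l)%N; first by rewrite muln_gt0 k0.
rewrite fM (morphV _ fM); apply: commuteM.
  by rewrite expgnA; apply: commute_sym; apply: commuteX; exact: commute_sym.
apply: commuteV; rewrite mulnC expgnA; apply: commute_sym; apply: commuteX.
exact: commute_sym.
Qed.

Lemma commensurator_refl y : commensurator y y.
Proof. by exists 1%N => //; exact: commute_refl. Qed.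

Lemma commensurator_A y a : p y <> 0%R -> A a -> commensurator y a -> unipotent_part a.
Proof.
move=> y0 Aa [k k0 h]; apply: (unipotent_lift Aa y0 k0).
by apply/f_ker; rewrite fR fX; apply/eqP/commgP; exact: commute_sym.
Qed.

(** The quotient of [zpow x (p y)] by [zpow y (p x)] lies in [A] and in the commensurator, hence in
    the unipotent part: in [Q] the two elements have a common nonzero power. *)
Lemma commensurator_eq x y : p x <> 0%R -> p y <> 0%R -> commensurator y x ->
  commensurator x = commensurator y.
Proof.
move=> x0 y0 xy; have CG := commensurator_subgroup y.
have e : zpow (f x) (p y) = zpow (f y) (p x).
  have h : f (zpow x (p y) * (zpow y (p x))^-1) = 1.
    apply/f_ker; apply: (commensurator_A y0).
      by apply/p_ker; rewrite pM pV !pZ mulrC subrr.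
    apply: subgroupM => //; first exact: subgroup_zpow.
    by apply: subgroupV => //; apply: subgroup_zpow => //; exact: commensurator_refl.
  rewrite fM (morphV _ fM) !fZ in h.
  by apply/eqP; rewrite -divg_eq1; apply/eqP.
have nz (k : nat) (n : int) : (0 < k)%N -> n <> 0%R -> (n * Posz k)%R <> 0%R.
  by move=> k0 n0 /eqP; rewrite mulf_eq0 eqz_nat (gtn_eqF k0) orbF => /eqP.
have cz (u v : Q) (k : nat) n : commute (u ^+ k) v -> commute (zpow u (n * Posz k)%R) v.
  move=> h; rewrite mulrC zpowM zpow_nat; apply: commute_sym; apply: commute_zpow.
  exact: commute_sym.
apply/seteqP; split=> g [k k0 h].
  apply: (commensurator_zpow (nz _ _ k0 x0)); rewrite zpowM -e -zpowM.
  exact: cz.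
apply: (commensurator_zpow (nz _ _ k0 y0)); rewrite zpowM e -zpowM.
exact: cz.
Qed.

Record comm_class := CommClass {
  cc_set : set G ; cc_setP : exists2 y, p y <> 0%R & cc_set = commensurator y }.

HB.instance Definition _ := gen_eqMixin comm_class.
HB.instance Definition _ := gen_choiceMixin comm_class.

Lemma cc_set_inj : injective cc_set.
Proof. by move=> [C hC] [D hD] /= e; subst D; congr CommClass; apply: Prop_irrelevance. Qed.

Lemma commensurator_conj y g : [set x | commensurator y (x ^ g)] = commensurator (y ^ g^-1).
Proof.
apply/seteqP; split=> x [k k0 h]; exists k => //.
  rewrite fJ -conjXg; move: h; rewrite fJ => h.
  rewrite -(conjgK (f g) (f x)) (morphV _ fM).
  by rewrite /commute -!conjMg h.
rewrite fJ; move: h; rewrite fJ -conjXg (morphV _ fM) => h.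
rewrite -(conjgKV (f g) (f y ^+ k)).
by rewrite /commute -!conjMg h.
Qed.

Lemma cc_act_proof g (C : comm_class) :
  exists2 y, p y <> 0%R & [set x | cc_set C (x ^ g)] = commensurator y.
Proof.
have [y y0 ->] := cc_setP C; exists (y ^ g^-1); first by rewrite pJ.
exact: commensurator_conj.
Qed.

Definition cc_act (g : G) (C : comm_class) : comm_class := CommClass (cc_act_proof g C).

Lemma cc_action : group_action cc_act.
Proof.
split=> [C|g h C]; apply: cc_set_inj; apply/seteqP; split=> x /=.
- by rewrite conjg1.
- by rewrite conjg1.
- by rewrite conjgM.
- by rewrite conjgM.
Qed.

(** The commensurator is its own normaliser. If [g] normalises it, [y ^ g^-1] and [y] both belong to
    it and differ by an element of [A]; so they agree in [Q], which means that [f g] commutes with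
    [f y]. *)
Lemma cc_stab g (C : comm_class) : cc_act g C = C <-> cc_set C g.
Proof.
have [y y0 Cy] := cc_setP C; have CG := commensurator_subgroup y; split.
  move=> /(congr1 cc_set) /=; rewrite Cy commensurator_conj => e.
  have yg : commensurator y (y ^ g^-1) by rewrite -e; exact: commensurator_refl.
  have : unipotent_part (y ^ g^-1 * y^-1).
    apply: (commensurator_A y0); first by apply/p_ker; rewrite pM pV pJ subrr.
    by apply: subgroupM => //; apply: subgroupV => //; exact: commensurator_refl.
  move/f_ker; rewrite fM (morphV _ fM) => /eqP; rewrite divg_eq1 fJ (morphV _ fM) => /eqP h.
  exists 1%N => //; rewrite expg1 /commute.
  by move: h; rewrite conjgE invgK => /(congr1 (fun x => x * f g)); rewrite !mulgA mulgVK.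
rewrite Cy => hg; apply: cc_set_inj; apply/seteqP; split=> x /=; rewrite Cy => hx.
  rewrite -(conjgK g x) conjgE; apply: subgroupM => //; first by rewrite invgK.
  by apply: subgroupM => //; exact: subgroupV.
by rewrite conjgE; apply: subgroupM => //; [exact: subgroupV|exact: subgroupM].
Qed.

Let line_act (g : G) (n : int) : int := (n + p g)%R.
Let line_action : group_action line_act.
Proof.
split=> [n|g h n]; first by rewrite /line_act (additive1 (subgroupT G) pA) addr0.
by rewrite /line_act pM -addrA [(p h + _)%R]addrC.
Qed.
Let line_act_next g n : line_act g (n + 1)%R = (line_act g n + 1)%R.
Proof. by rewrite /line_act; ring. Qed.

Let L : gposet G := fgraph_gposet line_action.1 line_action.2 line_act_next.
Let W : gposet G := discrete_gposet cc_action.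

Let pstab_line (x : L) : pstab x = A.
Proof.
rewrite fgraph_pstab /line_act; apply/seteqP; split=> g /=.
  by move=> e; apply/p_ker; apply: (addrI x.1); rewrite e addr0.
by move=> /p_ker ->; rewrite addr0.
Qed.

Let pstab_class (C : W) : @pstab G W C = cc_set C.
Proof. by apply/seteqP; split=> g; rewrite /pstab /= cc_stab. Qed.

Lemma abelian_locally_vn (H : set G) : H `<=` A -> locally_vn H.
Proof.
move=> HA s sH; exists (generated_by s), 1%N, [:: 1]; split=> //.
- exact: generated_by_subgroup.
- have sA : generated_by s `<=` A by apply: generated_by_le => // x /sH /HA.
  move=> u [|x [|? ?]] // /sA Au hx _ /=; apply/eqP/commgP; apply: A_abelian => //.
  by apply: sA; apply: hx; rewrite inE.
- by move=> h hh; exists 1; rewrite ?inE // invg1 mul1g.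
Qed.

Lemma G_countable : countable [set: G].
Proof.
have /countable_injP[c ci] := A_countable.
apply/countable_injP; exists (fun g => choice.pickle (c (g * (zpow t (p g))^-1), p g)).
have gA g : A (g * (zpow t (p g))^-1).
  by apply/p_ker; rewrite pM pV pZ pt mulr1 subrr.
move=> g h _ _ /(pcan_inj choice.pickleK) [e1 e2].
have := ci _ _ (mem_set (gA g)) (mem_set (gA h)) e1; rewrite e2.
exact: mulIg.
Qed.

(** A finitely generated subgroup [U] of the commensurator that is not in [A] is generated by an
    element [v] and finitely many elements of [A], which are unipotent by [commensurator_A]. A
    suitable power [w] of [v] acts on all of these with one Engel exponent [r]. *)
Lemma commensurator_locally_vn y : p y <> 0%R -> locally_vn (commensurator y).
Proof.
move=> y0 s sC; have [s0|] := pselect (forall x, x \in s -> p x = 0%R).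
  by apply: (@abelian_locally_vn [set x | x \in s]) => // x /s0 /p_ker.
move=> /existsNP[x1 /not_implyP[x1s px1]].
have CG := commensurator_subgroup y.
pose U := generated_by s; have UG : is_subgroup U := generated_by_subgroup s.
have UM x z : U x -> U z -> U (x * z) by exact: (subgroupM UG).
have UV x : U x -> U x^-1 by exact: (subgroupV UG).
have UZ x j : U x -> U (zpow x j) by exact: (subgroup_zpow j UG).
have UJ x z : U x -> U z -> U (x ^ z).
  by move=> hx hz; rewrite conjgE; apply: (UM); [exact: UV|exact: UM].
have UR x z : U x -> U z -> U [~ x, z].
  by move=> hx hz; rewrite commgEl; apply: (UM); [exact: UV|exact: UJ].
have UC : U `<=` commensurator y by apply: generated_by_le.
have exd : exists d, (0 < d)%N && `[< exists2 u, U u & p u = Posz d >].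
  have Ux1 : U x1 by exact: generated_by_mem.
  exists `|p x1|%N; rewrite absz_gt0; apply/andP; split; first exact/eqP.
  apply/asboolP; have [h|h] := leP 0%R (p x1); first by exists x1 => //; rewrite gez0_abs.
  by exists x1^-1; [exact: UV|rewrite pV ltz0_abs].
case: (ex_minnP exd) => d /andP[d0 /asboolP[v Uv pv]] dmin.
have dvd u : U u -> (Posz d %| p u)%Z.
  move=> Uu; have Ur : U (u * zpow v (- (p u %/ d)%Z)%R).
    by apply: (UM) => //; exact: UZ.
  have pr : p (u * zpow v (- (p u %/ d)%Z)%R) = (p u %% d)%Z.
    by rewrite pM pZ pv {1}(divz_eq (p u) d); ring.
  apply/dvdz_mod0P/eqP; apply: contraT => nz.
  have rlt : (`|(p u %% d)%Z| < d)%N.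
    by rewrite -ltz_nat gez0_abs ?modz_ge0 ?gt_eqF // ltz_pmod.
  have : (d <= `|(p u %% d)%Z|)%N.
    apply: dmin; rewrite absz_gt0 nz; apply/asboolP.
    by exists (u * zpow v (- (p u %/ d)%Z)%R) => //; rewrite pr gez0_abs ?modz_ge0 ?gt_eqF.
  by rewrite leqNgt rlt.
(* As [p] maps [U] onto the multiples of [d = p v], each generator is corrected by a power of [v] to
   an element of [A]. *)
pose red x := x * zpow v (- (p x %/ d)%Z)%R.
have Ured x : U x -> U (red x) by move=> Ux; apply: (UM) => //; exact: UZ.
have redA x : U x -> A (red x).
  move=> Ux; apply/p_ker; rewrite pM pZ pv; have /divzK e := dvd x Ux.
  by rewrite -{1}e; ring.
have [_ /mapP[x xs ->]|M [r [M0 hM]]] := @unipotent_common (map red s).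
  have Ux : U x by exact: generated_by_mem.
  by apply: (commensurator_A y0); [exact: redA|apply: UC; exact: Ured].
pose w := v ^+ M.
have Uw : U w by rewrite /w -zpow_nat; exact: UZ.
have pw : p w = (Posz M * Posz d)%R by rewrite pX pv.
have pw0 : p w <> 0%R.
  by rewrite pw => /eqP; rewrite mulf_eq0 !eqz_nat (gtn_eqF M0) (gtn_eqF d0).
pose B k := U `&` engel_level w k.
have BG k : is_subgroup (B k) by apply: subgroupI => //; exact: engel_level_subgroup.
have BJ k b u : U u -> B k b -> B k (b ^ u).
  move=> Uu [Ub hb]; split; [exact: UJ|exact: engel_level_conj].
have Bred x : x \in s -> B r (red x).
  move=> xs; split; first by apply: Ured; exact: generated_by_mem.
  have := engel_level_zpow (Posz d) (hM _ (map_f red xs)); apply: engel_level_same.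
  by rewrite pZ pX pt pw; ring.
have ext v0 : U v0 -> is_subgroup [set u | exists j, B r (u * zpow v0 j)].
  move=> Uv0; have Uz j : U (zpow v0 j) by exact: UZ.
  split; first by exists 0%R; rewrite mulg1; exact: subgroup1.
  move=> g h [i hi] [j hj]; exists (i - j)%R.
  have -> : g * h^-1 * zpow v0 (i - j)%R =
      (g * zpow v0 i) * ((h * zpow v0 j)^-1) ^ (zpow v0 (i - j)%R).
    have e : (zpow v0 (i - j)%R)^-1 = (zpow v0 i)^-1 * zpow v0 j.
      by rewrite -!zpowN -zpowD; congr zpow; ring.
    by rewrite conjgE e invgM !mulgA (mulgK (zpow v0 i)) (mulgK (zpow v0 j)).
  by apply: (subgroupM (BG r)) => //; apply: BJ; [exact: UZ|exact: (subgroupV (BG r))].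
(* The product of [B r] and the powers of [w = v ^+ M]; since [U] is the product of [B r] and the
   powers of [v], [M] cosets of [N] cover it. *)
pose N := U `&` [set u | exists j, B r (u * zpow w j)].
have NG : is_subgroup N by apply: subgroupI => //; exact: ext.
have N0 u : N u -> p u = 0%R -> B r u.
  move=> [Uu [j [Uj [/p_ker h1 h2]]]] pu.
  have j0 : j = 0%R.
    move: h1; rewrite pM pu add0r pZ => /eqP; rewrite mulf_eq0 => /orP[/eqP //|/eqP //].
  by move: Uj h2 h1; rewrite j0 mulg1 => Uj h2 /p_ker h1; split.
have step k b x : B k.+1 b -> N x -> B k [~ b, x].
  move=> [Ub hb] [Ux [j [_ [Axj _]]]]; split; first exact: UR.
  have -> : [~ b, x] = [~ b, zpow w (- j)%R].
    rewrite !commgEl; congr (_ * _); apply: conj_same; first exact: hb.1.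
    by move/p_ker: Axj; rewrite pM !pZ mulNr => /eqP; rewrite addr_eq0 => /eqP.
  exact: engel_level_comm.
exists N, r.+1, [seq v ^+ i | i <- iota 0 M]; split=> //; first by move=> u [].
(* The first commutator of elements of [N] lies in [B r], as [p] vanishes on it, and each of the [r]
   others lowers the level by one: whence the class [r.+1]. *)
- have down k b xs : B k b -> (forall x, x \in xs -> N x) -> size xs = k ->
      foldl (fun v x => [~ v, x]) b xs = 1.
    elim: xs k b => [|x xs IH] [|k] b //=; first by move=> [_ [_ /=]].
    move=> hb hxs [sz]; apply: (IH k) => //; last by move=> z zxs; apply: hxs; rewrite inE zxs orbT.
    by apply: step => //; apply: hxs; rewrite inE eqxx.
  move=> u [//|x xs] Nu hxs [sz] /=; apply: (down r) => //; last first.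
    by move=> z zxs; apply: hxs; rewrite inE zxs orbT.
  have Nx : N x by apply: hxs; rewrite inE eqxx.
  apply: N0; last exact: pR.
  have NM := subgroupM NG; rewrite commgEl conjgE.
  by apply: (NM); [exact: (subgroupV NG)|apply: (NM); [exact: (subgroupV NG)|exact: NM]].
- move=> u Uu.
  have [j hj] : [set u | exists j, B r (u * zpow v j)] u.
    move: u Uu; apply: generated_by_le; first exact: ext.
    by move=> x xs; exists (- (p x %/ d)%Z)%R; exact: Bred.
  (* As [u] is an element of [B r] times [zpow v (- j)], dividing [- j] by [M] leaves a power
     [i < M] of [v] and the power [q] of [w]. *)
  pose i := (- j %% M)%Z; pose q := (- j %/ M)%Z.
  have M0' : Posz M != 0%R by rewrite eqz_nat -lt0n.
  have i0 : (0 <= i)%R by rewrite modz_ge0.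
  exists (v ^+ `|i|%N).
    apply: map_f; rewrite mem_iota /= add0n -ltz_nat gez0_abs //.
    by rewrite ltz_pmod.
  have vi : v ^+ `|i|%N = zpow v i by rewrite -zpow_nat gez0_abs.
  have Uvi : U (zpow v i) by exact: UZ.
  split; first by apply: (UM) => //; rewrite vi; exact: UV.
  exists (- q)%R; rewrite vi.
  have -> : (zpow v i)^-1 * u * zpow w (- q)%R = (u * zpow v j) ^ zpow v i.
    rewrite conjgE -!mulgA; congr (_ * (_ * _)).
    rewrite /w -zpow_nat -zpowM -zpowD; congr zpow.
    have : (- j = q * Posz M + i)%R := divz_eq (- j)%R M.
    by move/(congr1 (fun z => - z)%R); rewrite opprK => ->; ring.
  exact: BJ.
Qed.

(** Suitable powers of [x] and of [x ^ k] are powers of the same [c]; as [p] takes the same nonzero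
    value on both, equal powers of [x] and [x ^ k] coincide, and [k] commutes with such a power of
    [x]. *)
Lemma vc_commensurator K x : vc_sub K -> K x -> p x <> 0%R -> K `<=` commensurator x.
Proof.
move=> [KG [c Kc [T hT]]] Kx px k Kk.
have Kxk : K (x ^ k) by rewrite conjgE; apply: subgroupM => //; [exact: subgroupV|exact: subgroupM].
have [e e0 [u _ eu]] := vc_sub_powers_meet KG hT Kx.
have [e' e'0 [v _ ev]] := vc_sub_powers_meet KG hT Kxk.
exists (e * e')%N; first by rewrite muln_gt0 e0.
have pc : p c <> 0%R.
  move=> pc; have := congr1 p eu; rewrite pZ pc mulr0 pX => /esym/eqP.
  by rewrite mulf_eq0 eqz_nat (gtn_eqF e0) => /eqP.
have E1 : x ^+ (e * e') = zpow c (u * Posz e')%R by rewrite expgnA -eu zpowM.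
have E2 : (x ^ k) ^+ (e * e') = zpow c (v * Posz e)%R by rewrite mulnC expgnA -ev zpowM.
have uv : (u * Posz e' = v * Posz e)%R.
  apply: (mulIf (introN eqP pc)); rewrite -!pZ -E1 -E2 !pX pJ //.
have E : (x ^+ (e * e')) ^ k = x ^+ (e * e') by rewrite conjXg E2 -uv E1.
rewrite -fX /commute -!fM; congr f.
by rewrite [LHS]conjgC E.
Qed.

Lemma abelian_by_cyclic_hierarchy3_quotient : hierarchy R virtually_cyclic 3%N G.
Proof.
apply: hierarchy_step; first by exists 0%N.
have h2 (H : set G) : is_subgroup H -> locally_vn H -> exists2 b : nat, (b < 3)%O &
    subgroup_in (hierarchy R virtually_cyclic b) H.
  move=> HG hH; exists 2%N => //; apply: subgroup_hierarchy2 => //.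
  exact: sub_countable (subset_card_le (@subsetT _ H)) G_countable.
have cw (C : W) : is_subgroup (cc_set C) /\ locally_vn (cc_set C).
  have [y y0 ->] := cc_setP C; split; first exact: commensurator_subgroup.
  exact: commensurator_locally_vn.
(* The bound 8 is [3.+1 * 1.+1], for the line and the discrete set. *)
apply: (@poset_acts_with_top R G (join_gposet L W) 8).
- exact: (join_small (@fgraph_small _ _) (@discrete_small _)).
- move=> [[x|C]|[x C]].
  + by rewrite join_pstabl pstab_line; apply: h2 => //; exact: abelian_locally_vn.
  + by rewrite join_pstabr pstab_class; apply: h2; [exact: (cw C).1|exact: (cw C).2].
  + rewrite join_pstab2 pstab_line pstab_class; apply: h2.
      by apply: subgroupI => //; exact: (cw C).1.
    by apply: abelian_locally_vn => g [].
- move=> [[x|C]|[x C]] [[x'|C']|[x' C']] [] //= h1 h2'.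
  + by rewrite !join_pstabl !pstab_line.
  + by rewrite join_pstabl join_pstab2 !pstab_line => g [].
  + by rewrite h2'.
  + by rewrite join_pstabr join_pstab2 h2' => g [].
  + by rewrite !join_pstab2 !pstab_line h2'.
- move=> K /vc_subP Kvc; exists 1%N; rewrite join_pfix.
  have [K0|/existsNP[x /not_implyP[Kx px]]] := pselect (forall x, K x -> p x = 0%R).
    apply: contractible_joinl.
    rewrite (_ : pfix K = setT); first exact: line_contractible.
    apply/seteqP; split=> // q _ g /K0 pg.
    by have : pstab q g by rewrite pstab_line; apply/p_ker.
  apply: contractible_joinr.
  have hx : exists2 y, p y <> 0%R & commensurator x = commensurator y by exists x.
  rewrite (_ : pfix K = [set (CommClass hx : W)]); first exact: singleton_contractible.
  apply/seteqP; split=> [C hC|_ ->].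
    have := hC x Kx; have [y y0 Cy] := cc_setP C.
    move=> /cc_stab; rewrite Cy => xy; apply: cc_set_inj => /=.
    by rewrite Cy (commensurator_eq px y0 xy).
  by move=> g Kg; apply/cc_stab => /=; exact: vc_commensurator Kg.
Qed.

End AbelianByCyclic.

(** * Projection of a semi-direct product to the integers, and conclusion *)

Lemma semidirect_projection (G : groupType) (A Q : set G) :
  semidirect_product A Q -> infinite_cyclic Q ->
  exists (p : G -> int) (t : G),
    [/\ forall x y, p (x * y)%g = (p x + p y)%R, forall x, p x = 0%R <-> A x &
        p t = 1%R].
Proof.
move=> [AG QG AJ AQ prod] [f [finj fM frange]].
have Qf n : Q (f n) by rewrite -frange; exists n.
have f0 : f 0%R = 1%g by apply: (mulgI (f 0%R)); rewrite -fM addr0 mulg1.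
have fN n : f (- n)%R = (f n)^-1%g by apply: (mulgI (f n)); rewrite -fM subrr f0 mulgV.
have uniq x m n : A (x * f m)%g -> A (x * f n)%g -> m = n.
  move=> hm hn; apply/eqP; rewrite -subr_eq0 addrC; apply/eqP/finj; rewrite f0.
  suff : [set 1%g] (f (- n + m)%R) by [].
  rewrite -AQ; split=> //; have := subgroupM AG (subgroupV AG hn) hm.
  by rewrite invgM fM fN mulgA mulgVK.
have ex x : exists n, A (x * f (- n)%R)%g.
  have : [set: G] x by []; rewrite -prod => -[a Aa [q]].
  by rewrite -frange => -[n _ <-] <-; exists n; rewrite fN mulgK.
have [p pP] := choice ex.
have pE x n : A (x * f (- n)%R)%g -> p x = n.
  by move=> h; apply: oppr_inj; exact: uniq (pP x) h.
exists p, (f 1%R); split=> [x y|x|].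
- apply: pE; rewrite opprD fM !mulgA.
  have -> : (x * y * f (- p x)%R * f (- p y)%R)%g =
      ((x * f (- p x)%R) * (y * f (- p y)%R) ^ f (- p x)%R)%g.
    rewrite conjgE !mulgA (mulgK (f (- p x)%R)) -!mulgA; congr (x * (y * _))%g.
    by rewrite -!fM addrC.
  by apply: (subgroupM AG); [exact: pP|apply: AJ; exact: pP].
- by split=> h; [have := pP x; rewrite h oppr0 f0 mulg1|apply: pE; rewrite oppr0 f0 mulg1].
- by apply: pE; rewrite -fM subrr f0; exact: AG.1.
Qed.

Close Scope classical_set_scope.

Theorem mainTheorem5 (R : realType) :
  (forall G : groupType,
     countable [set: G]%classic -> virtually_nilpotent G ->
     hierarchy R virtually_cyclic 2%N G) /\
  (forall (G : groupType) (A Q : set G),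
     semidirect_product A Q ->
     countable A -> {in A &, forall x y : G, (x * y = y * x)%g} ->
     infinite_cyclic Q ->
     hierarchy R virtually_cyclic 3%N G).
Proof.
split=> [G cG vnG|G A Q GAQ cA Aab Qcyc].
  exact/(countable_locally_vn_hierarchy2 _ cG)/virtually_nilpotent_locally.
have [p [t [pM p_ker pt]]] := semidirect_projection GAQ Qcyc.
have [AG _ _ _ _] := GAQ.
have A_comm x y : A x -> A y -> (x * y = y * x)%g.
  by move=> Ax Ay; apply: Aab; exact: mem_set.
have [Q' [f [fM _ f_ker]]] := quotient_exists (unipotent_subgroup t AG A_comm pM p_ker)
  (unipotent_normal A_comm pM p_ker).
exact: (abelian_by_cyclic_hierarchy3_quotient R AG A_comm cA pM p_ker pt fM f_ker).
Qed.
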